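(* Let $k\ge4$ and $F(s)=|s|^{k-1}s$ for $s\in\mathbb{R}$, and consider on $\mathbb{Z}^4\times\mathbb{R}$ the equation $$\partial_t^2u(x,t)-\Delta u(x,t)=F(u(x,t)),\qquad u(x,0)=0,\quad\partial_tu(x,0)=f(x).$$ If $f\in l^1(\mathbb{Z}^4)$ with $\|f\|_{l^1}$ sufficiently small, then for any $2\le p\le\infty$ the global solution $u_k$ of this equation exists in $l^p$, and for every $\varepsilon\in(0,\frac32)$ there is a constant $C$ independent of $t$ such that $$\|u_k(\cdot,t)\|_{l^p}\le C(1+|t|)^{-\zeta_p}\quad\text{for all }t\in\mathbb{R},\qquad \zeta_p=\Big(\frac32-\varepsilon\Big)\Big(1-\frac2p\Big).$$
   Context: $\Delta u(x,t)=\sum_{y\in\mathbb{Z}^4,\ |x-y|_1=1}(u(y,t)-u(x,t))$ is the discrete Laplacian. A solution is understood in the Duhamel sense: $$u(\cdot,t)=G(\cdot,t)*f+\int_0^tG(\cdot,t-s)*F(u(\cdot,s))\,ds,$$ where $*$ is convolution on $\mathbb{Z}^4$ and $$G(x,t)=\frac{1}{(2\pi)^4}\int_{[-\pi,\pi]^4}e^{ix\cdot\xi}\,\frac{\sin(t\,\omega(\xi))}{\omega(\xi)}\,d\xi,\qquad \omega(\xi)=\Big(\sum_{j=1}^4(2-2\cos\xi_j)\Big)^{1/2}.$$ Global means defined for all $t\in\mathbb{R}$. *)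

(* Defs.v *)
From HB Require Import structures.
From mathcomp Require Import all_boot all_order all_algebra.
From mathcomp Require Import all_classical all_reals all_analysis.
From mathcomp Require Import measurable_realfun.
Set Implicit Arguments.
Unset Strict Implicit.
Unset Printing Implicit Defensive.
Import Order.TTheory GRing.Theory Num.Theory.
Import numFieldNormedType.Exports.
Local Open Scope classical_set_scope.
Local Open Scope ring_scope.

(* [lattice] carries the discrete sigma-algebra, so sums over Z^4 are integrals
   against the counting measure and l^p norms are [Lnorm]s. *)
Definition lattice := 'rV[int]_4.
HB.instance Definition _ := GRing.Zmodule.on lattice.
HB.instance Definition _ := isPointed.Build lattice 0.
HB.instance Definition _ := @isMeasurable.Build default_measure_display
  lattice discrete_measurable discrete_measurable0
  discrete_measurableC discrete_measurableU.

Section lattice_functions.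
Variable R : realType.
Implicit Types (g h : lattice -> R) (x y : lattice).

Definition l_norm (p : \bar R) h : \bar R :=
  Lnorm (@counting lattice R) p (EFin \o h).

(* A non-summable series gets a junk value from [conv]; [conv_summable] states
   that the series converges absolutely. *)
Definition conv g h x : R := \int[@counting lattice R]_y (g (x - y) * h y).

Definition conv_summable g h x : Prop :=
  (@counting lattice R).-integrable setT (fun y => (g (x - y) * h y)%:E).

End lattice_functions.

Section frequencies.
Variable R : realType.
Local Notation mu := (@lebesgue_measure R).
Local Notation RR := (measurableTypeR R).

Definition lebesgue2 : set (RR * RR) -> \bar R := (mu \x mu)%E.
HB.instance Definition _ := Measure.on lebesgue2.

Lemma lebesgue2_sigma_finite : sigma_finite setT lebesgue2.
Proof.
have /sigma_finiteP[F [TF ndF Foo]] := sigma_finiteT mu.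
exists (fun n => F n `*` F n).
  rewrite -setXTT TF predeqE => -[x y]; split.
    move=> [/= [n _ Fnx] [k _ Gky]]; exists (maxn n k) => //; split.
    - by move: x Fnx; exact/subsetPset/ndF/leq_maxl.
    - by move: y Gky; exact/subsetPset/ndF/leq_maxr.
  by move=> [n _ []/= ? ?]; split; exists n.
move=> k; have [? ?] := Foo k.
split; first exact: measurableX.
by rewrite [X in (X < _)%E]product_measure1E// lte_mul_pinfty// ge0_fin_numE.
Qed.

HB.instance Definition _ := Measure_isSigmaFinite.Build _ _ _
  lebesgue2 lebesgue2_sigma_finite.

Definition lebesgue4 : set (RR * RR * (RR * RR)) -> \bar R :=
  (lebesgue2 \x lebesgue2)%E.
HB.instance Definition _ := Measure.on lebesgue4.

Implicit Type xi : RR * RR * (RR * RR).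

Definition freq_coord xi (j : 'I_4) : R :=
  tnth [tuple xi.1.1; xi.1.2; xi.2.1; xi.2.2] j.

Definition freq_cube : set (RR * RR * (RR * RR)) :=
  [set xi | forall j, - pi <= freq_coord xi j <= pi].

Definition phase (x : lattice) xi : R :=
  \sum_(j < 4) (x ord0 j)%:~R * freq_coord xi j.

Definition omega xi : R :=
  Num.sqrt (\sum_(j < 4) (2 - 2 * cos (freq_coord xi j))).

(* The real part of the integral defining G; its imaginary part vanishes by
   [kernel_imaginary_part] below. *)
Definition kernel (x : lattice) (t : R) : R :=
  ((2 * pi) ^+ 4)^-1 * \int[lebesgue4]_(xi in freq_cube)
    (cos (phase x xi) * (sin (t * omega xi) / omega xi)).

End frequencies.
Arguments lebesgue2 {R}.
Arguments lebesgue4 {R}.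

Section wave_equation.
Variable R : realType.
Implicit Types (k t s T M : R) (f : lattice -> R) (u : lattice -> R -> R).

Definition nonlinearity k s : R := `|s| `^ (k - 1) * s.

Definition time_segment t : set (measurableTypeR R) :=
  [set s | 0 <= s <= t \/ t <= s <= 0].

(* The oriented integral of h from 0 to t. *)
Definition time_integral (h : R -> R) t : R :=
  Num.sg t * \int[@lebesgue_measure R]_(s in time_segment t) h s.

Definition duhamel_integrand k u x t s : R :=
  conv (fun z => kernel z (t - s)) (fun y => nonlinearity k (u y s)) x.

Definition duhamel_solution k f u : Prop := forall x t,
  [/\ conv_summable (fun z => kernel z t) f x,
      forall s, time_segment t s ->
        conv_summable (fun z => kernel z (t - s))
          (fun y => nonlinearity k (u y s)) x,
      (@lebesgue_measure R).-integrable (time_segment t)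
        (EFin \o duhamel_integrand k u x t) &
      u x t = conv (fun z => kernel z t) f x +
              time_integral (duhamel_integrand k u x t) t].

(* Global solutions of class L^oo_loc(R; l^p); such a solution is automatically
   continuous from R to l^p. *)
Definition global_lp_solution k f (p : \bar R) u : Prop :=
  duhamel_solution k f u /\
  forall T, exists M, forall t, `|t| <= T ->
    (l_norm p (fun x => u x t) <= M%:E)%E.

(* In \bar R, +oo^-1 = 0, so 2 / p = 0 for p = +oo. *)
Definition zeta (eps : R) (p : \bar R) : R :=
  (3 / 2 - eps) * (1 - 2 * fine (p^-1)%E).

End wave_equation.

Section kernel_is_real.
Variable R : realType.
Local Notation RR := (measurableTypeR R).
Local Notation R4 := (RR * RR * (RR * RR))%type.

Lemma measurable_freq_coord (j : 'I_4) :
  measurable_fun [set: R4] (fun xi => freq_coord xi j).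
Proof.
rewrite /freq_coord; case: j => -[|[|[|[|//]]]] j4; rewrite /tnth /=.
- by apply: measurableT_comp; [exact: measurable_fst|exact: measurable_fst].
- by apply: measurableT_comp; [exact: measurable_snd|exact: measurable_fst].
- by apply: measurableT_comp; [exact: measurable_fst|exact: measurable_snd].
- by apply: measurableT_comp; [exact: measurable_snd|exact: measurable_snd].
Qed.

Lemma measurable_freq_cube : measurable (@freq_cube R).
Proof.
have -> : @freq_cube R = \bigcap_(j in [set: 'I_4])
   ((fun xi : R4 => freq_coord xi j) @^-1` `[- pi, pi]%classic).
  apply/seteqP; split => xi /=.
    by move=> h j _ /=; rewrite in_itv /=; exact: h.
  by move=> h j; have := h j I; rewrite /= in_itv.
apply: fin_bigcap_measurable => //.
by move=> j _; rewrite -[_ @^-1` _]setTI; apply: measurable_freq_coord.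
Qed.

Lemma measurable_phase x : measurable_fun [set: R4] (phase x).
Proof.
apply: measurable_sum => j; apply: measurable_funM => //.
exact: measurable_freq_coord.
Qed.

Lemma measurable_omega : measurable_fun [set: R4] (@omega R).
Proof.
apply: measurableT_comp; last first.
  apply: measurable_sum => j; apply: measurable_funB => //.
  apply: measurable_funM => //; apply: measurableT_comp.
    by apply: continuous_measurable_fun; exact: continuous_cos.
  exact: measurable_freq_coord.
by apply: continuous_measurable_fun; exact: sqrt_continuous.
Qed.

Lemma measurable_multiplier (t : R) :
  measurable_fun [set: R4] (fun xi => sin (t * omega xi) / omega xi).
Proof.
apply: measurable_funM.
  apply: measurableT_comp.
    by apply: continuous_measurable_fun; exact: continuous_sin.
  by apply: measurable_funM => //; exact: measurable_omega.
have -> : (fun xi : R4 => (omega xi)^-1) = (fun xi => omega xi `^ (-1)).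
  by apply/funext => xi; rewrite powR_inv1 // sqrtr_ge0.
by apply: (measurableT_comp (measurable_powR _)); exact: measurable_omega.
Qed.

Let opp2 (z : RR * RR) : RR * RR := (- z.1, - z.2).
Let opp4 (xi : R4) : R4 := (opp2 xi.1, opp2 xi.2).

Let measurable_opp2 : measurable_fun [set: RR * RR] opp2.
Proof. by apply: measurable_fun_pair; apply: measurableT_comp. Qed.

Let measurable_opp4 : measurable_fun [set: R4] opp4.
Proof. by apply: measurable_fun_pair; apply: measurableT_comp. Qed.

Lemma product_measure_preimage d1 d2 (T1 : measurableType d1)
  (T2 : measurableType d2) (m1 : {sigma_finite_measure set T1 -> \bar R})
  (m2 : {sigma_finite_measure set T2 -> \bar R})
  (n1 : T1 -> T1) (n2 : T2 -> T2) :
  measurable_fun setT n1 -> measurable_fun setT n2 ->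
  (forall A, measurable A -> m1 (n1 @^-1` A) = m1 A) ->
  (forall A, measurable A -> m2 (n2 @^-1` A) = m2 A) ->
  forall X, measurable X ->
  (m1 \x m2)%E ((fun z => (n1 z.1, n2 z.2)) @^-1` X) = (m1 \x m2)%E X.
Proof.
move=> mn1 mn2 h1 h2 X mX.
have mn : measurable_fun setT (fun z : T1 * T2 => (n1 z.1, n2 z.2)).
  by apply: measurable_fun_pair; apply: measurableT_comp.
have := @product_measure_unique _ _ _ _ _ m1 m2
  (pushforward (m1 \x m2)%E (fun z : T1 * T2 => (n1 z.1, n2 z.2))).
move=> /(_ mn _ X mX) -> //.
move=> A B mA mB; rewrite -(h1 A) // -(h2 B) //.
rewrite -product_measure1E //.
- by rewrite -[_ @^-1` _]setTI; exact: mn1.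
- by rewrite -[_ @^-1` _]setTI; exact: mn2.
Qed.

Let lebesgue4_opp4 X : measurable X ->
  lebesgue4 (opp4 @^-1` X) = @lebesgue4 R X.
Proof.
have h2 A : measurable A -> lebesgue2 (opp2 @^-1` A) = @lebesgue2 R A.
  by move=> mA; apply: (@product_measure_preimage _ _ _ _
    (@lebesgue_measure R) (@lebesgue_measure R)) => // B mB;
    exact: lebesgue_measureN.
by move=> mX; exact: (@product_measure_preimage _ _ _ _
    (@lebesgue2 R) (@lebesgue2 R)).
Qed.

Let freq_coord_opp4 xi j : freq_coord (opp4 xi) j = - freq_coord xi j.
Proof. by case: j => -[|[|[|[|//]]]] j4; rewrite /freq_coord /tnth /=. Qed.

Let ge0_integral_opp4 (h : R4 -> \bar R) :
  measurable_fun setT h -> (forall xi, 0 <= h xi)%E ->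
  (\int[lebesgue4]_(xi in @freq_cube R) h xi =
   \int[lebesgue4]_(xi in @freq_cube R) h (opp4 xi))%E.
Proof.
move=> mh h0.
have {2}-> : @freq_cube R = opp4 @^-1` @freq_cube R.
  apply/seteqP; split => xi /= hx j; have := hx j; rewrite freq_coord_opp4;
    by rewrite lerN2 (lerNl (freq_coord xi j)) andbC.
rewrite -(ge0_integral_pushforward measurable_opp4); last 3 first.
- exact: measurable_freq_cube.
- exact: measurable_funTS.
- by move=> *; exact: h0.
by apply: eq_measure_integral => A mA _; exact/esym/lebesgue4_opp4.
Qed.

Lemma kernel_imaginary_part (x : lattice) (t : R) :
  \int[lebesgue4]_(xi in @freq_cube R)
    (sin (phase x xi) * (sin (t * omega xi) / omega xi)) = 0.
Proof.
set F := fun xi => sin _ * _.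
have mF : measurable_fun [set: R4] (EFin \o F).
  apply/measurable_EFinP; apply: measurable_funM; last first.
    exact: measurable_multiplier.
  apply: measurableT_comp; last exact: measurable_phase.
  by apply: continuous_measurable_fun; exact: continuous_sin.
have FN xi : F (opp4 xi) = - F xi.
  rewrite /F; have -> : phase x (opp4 xi) = - phase x xi.
    rewrite /phase -sumrN; apply: eq_bigr => j _.
    by rewrite freq_coord_opp4 mulrN.
  have -> : omega (opp4 xi) = omega xi.
    rewrite /omega; congr Num.sqrt; apply: eq_bigr => j _.
    by rewrite freq_coord_opp4 cosN.
  by rewrite sinN mulNr.
rewrite /Rintegral integralE (ge0_integral_opp4 (measurable_funepos mF)) //.
have -> : (fun xi => (EFin \o F)^\+%E (opp4 xi)) = ((EFin \o F)^\-)%E.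
  by apply/funext => xi; rewrite funeposE funenegE /= FN.
by case: (integral _ _ _) => [r| |] //=; rewrite subrr.
Qed.

End kernel_is_real.

(* Main.v *)
Require Import Defs.
From HB Require Import structures.
From mathcomp Require Import all_boot all_order all_algebra.
From mathcomp Require Import all_classical all_reals all_analysis.
From mathcomp Require Import measurable_realfun ess_sup_inf.
From mathcomp Require Import ring lra.
Set Implicit Arguments.
Unset Strict Implicit.
Unset Printing Implicit Defensive.
Import Order.TTheory GRing.Theory Num.Theory.
Import numFieldNormedType.Exports.
Local Open Scope classical_set_scope.
Local Open Scope ring_scope.

(** Everything rests on three bounds for the kernel G: the dispersive estimate
    |G(x,t)| <= C_e (1+|t|)^(-3/2+e), uniform in x ([kernel_decay]); a bound on
    the l^2 norm that is uniform in t ([kernel_sum_sqr_le]); and the crude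
    l^1 bound e^(4|t|) ([kernel_sum_norm_le]).

    The dispersive estimate.  Put t = r^2.  For omega > 0 the substitution
    v = omega u - t/(2u) turns the integral over u > 0 of
    cos(r^4/(4u^2) + omega^2 u^2 + theta) into a Fresnel integral with phase
    shift theta + t omega, divided by omega ([glasser], [chirp_limit]).  Two
    values of theta suffice to recover sin(t omega)/omega.  The point is that
    at fixed u the variable omega^2 = sum_j (2 - 2 cos xi_j) enters linearly:
    the average over the frequency cube of e^(i x.xi + i u^2 omega^2)
    is a product of four Bessel functions of argument 2u^2, and the fourth power of
    each of them is at most C / (u^2 (1 + ||x_j| - 2u^2|)), also at
    the turning point ([oscillation_fourth_power], [cube_oscillation]).  By the
    arithmetic-geometric mean inequality the product is at most the sum of
    these four bounds.  In the region u <= r/4 the phase has no stationary point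
    and a smooth weight removes all but a part of relative size (u/r)^4
    ([low_part_bound]).  As min(1, (u/r)^4) <= C (u/r)^(3-2e), what is left is
    r^(-(3-2e)) times the integral of u^(1-2e) / (1 + |b - 2u^2|) over u > 1,
    which is at most 2/e for every b ([resonance_integral]).

    The l^2 bound is Bessel's inequality together with the integrability of
    omega^-2 on the four-dimensional cube ([omega_inv_sqr_le]).  The l^1 bound
    comes from the power series of the sine, because omega^2 acts on
    Fourier coefficients as a finite difference operator of norm 16.

    The equation.  On the ball |u(x,t)| <= A / (1+|t|), sum_x u(x,t)^2 <= A^2
    with A <= 1, the hypothesis k >= 4 gives |F(u)| <= u^4 and therefore
    sum_x |F(u(x,s))| <= A^4 (1+|s|)^(-2), which is integrable in time.  The first
    two kernel bounds show that the Duhamel map preserves this ball if A and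
    the l^1 norm of f are small ([step_in_ball]).  The l^1 bound makes the map
    a contraction for the norm sup e^(-Lam |t|) |u(x,t)| ([wave_difference_le]); this
    yields the solution, and the same estimate on bounded time
    intervals shows uniqueness among locally bounded functions, in particular
    in every l^p.  Inserting the dispersive estimate for a given e once more
    into the Duhamel formula gives the pointwise decay with exponent 3/2 - e, and
    the l^p decay follows by interpolation with the l^2 bound. *)

(** * Calculus on intervals *)

Section derivation_rules.
Variable R : realType.
Implicit Types (f g : R -> R) (x c df dg : R).

Lemma derivable_rule_cst c x : is_derive x 1 (fun _ : R => c) 0.
Proof. exact: is_derive_cst. Qed.

Lemma derivable_rule_id x : is_derive x 1 (fun y : R => y) 1.
Proof. exact: is_derive_id. Qed.

Lemma derivable_rule_add f g x df dg : is_derive x 1 f df -> is_derive x 1 g dg ->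
  is_derive x 1 (fun y => f y + g y) (df + dg).
Proof. exact: is_deriveD. Qed.

Lemma derivable_rule_opp f x df : is_derive x 1 f df ->
  is_derive x 1 (fun y => - f y) (- df).
Proof. exact: is_deriveN. Qed.

Lemma derivable_rule_mul f g x df dg : is_derive x 1 f df -> is_derive x 1 g dg ->
  is_derive x 1 (fun y => f y * g y) (f x * dg + g x * df).
Proof. exact: is_deriveM. Qed.

Lemma derivable_rule_inv f x df : f x != 0 -> is_derive x 1 f df ->
  is_derive x 1 (fun y => (f y)^-1) (- f x ^- 2 * df).
Proof. exact: is_deriveV. Qed.

Lemma derivable_rule_exp f n x df : is_derive x 1 f df ->
  is_derive x 1 (fun y => f y ^+ n) (n%:R * f x ^+ n.-1 * df).
Proof.
rewrite (_ : (fun y => f y ^+ n) = f ^+ n); first exact: is_deriveX.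
by apply/funext => y; rewrite exprfctE.
Qed.

Lemma derivable_rule_sin f x df : is_derive x 1 f df ->
  is_derive x 1 (fun y => sin (f y)) (cos (f x) * df).
Proof. by move=> h; apply: (@is_derive1_comp _ sin f). Qed.

Lemma derivable_rule_cos f x df : is_derive x 1 f df ->
  is_derive x 1 (fun y => cos (f y)) (- sin (f x) * df).
Proof. by move=> h; apply: (@is_derive1_comp _ cos f). Qed.

Lemma derivable_rule_atan f x df : is_derive x 1 f df ->
  is_derive x 1 (fun y => atan (f y)) ((1 + f x ^+ 2)^-1 * df).
Proof. by move=> h; apply: (@is_derive1_comp _ (@atan R) f). Qed.

Lemma derivable_rule_powR f a x df : 0 < f x -> is_derive x 1 f df ->
  is_derive x 1 (fun y => f y `^ a) (a * f x `^ (a - 1) * df).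
Proof.
move=> f0 h; apply: (@is_derive1_comp _ ((@powR R)^~ a) f).
exact: is_derive1_powR.
Qed.

Lemma is_derive_continuous f x df : is_derive x 1 f df -> {for x, continuous f}.
Proof.
by move=> h; apply/differentiable_continuous; rewrite -derivable1_diffP.
Qed.

End derivation_rules.

(** The rules above are stated for explicit lambda terms, so that derivatives
    can be computed by unification; [derive_to] leaves the comparison with
    the expected derivative, and [cont] proves continuity by
    differentiability. *)
Ltac der := match goal with
  | |- is_derive _ _ _ _ => first
    [ match goal with H : context [is_derive] |- _ => solve [eapply H; eassumption | eapply H] end
    | eapply derivable_rule_id
    | eapply derivable_rule_cst
    | eapply derivable_rule_add; der
    | eapply derivable_rule_opp; der
    | eapply derivable_rule_inv; der
    | eapply derivable_rule_exp; der
    | eapply derivable_rule_mul; der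
    | eapply derivable_rule_sin; der
    | eapply derivable_rule_cos; der
    | eapply derivable_rule_atan; der
    | eapply derivable_rule_powR; der ]
  | _ => idtac end.
Tactic Notation "lra_from" hyp_list(hs) := clear - hs; lra.
Ltac derive_to := (eapply is_derive_eq; [der|rewrite /=]).
Ltac cont := (eapply is_derive_continuous; der).


Lemma norm_of_sqr1 (R : realType) (z : R) : z ^+ 2 = 1 -> `|z| = 1.
Proof. by move=> h; apply/eqP; rewrite -(@eqrXn2 _ 2) // -normrX h normr1 expr1n. Qed.

Section interval_integrals.
Variable R : realType.
Notation mu := (@lebesgue_measure R).
Implicit Types (f g W G w : R -> R) (a b x : R).

Lemma segment_integrable f a b :
  (forall x, a <= x <= b -> {for x, continuous f}) ->
  mu.-integrable `[a, b] (EFin \o f).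
Proof.
move=> cf; apply: continuous_compact_integrable; first exact: segment_compact.
by apply: continuous_in_subspaceT => x; rewrite inE /= in_itv /= => /cf.
Qed.

Lemma Rintegral_primitive f W a b : a <= b ->
  (forall x, a <= x <= b -> is_derive x 1 W (f x)) ->
  (forall x, a <= x <= b -> {for x, continuous f}) ->
  \int[mu]_(x in `[a, b]) f x = W b - W a.
Proof.
rewrite le_eqVlt => /predU1P[->|ab] dW cf.
  by rewrite set_itv1 Rintegral_set1 subrr.
have cW x : a <= x <= b -> W y @[y --> x] --> W x.
  by move=> /dW h; apply/differentiable_continuous; rewrite -derivable1_diffP.
rewrite /Rintegral (@continuous_FTC2 _ f W) //.
- by apply: continuous_in_subspaceT => x; rewrite inE /= in_itv /= => /cf.
- split.
  + by move=> x; rewrite in_itv /= => /andP[/ltW ax /ltW xb];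
      apply: ex_derive; apply: dW; rewrite ax.
  + by apply: cvg_at_right_filter; apply: cW; rewrite lexx ltW.
  + by apply: cvg_at_left_filter; apply: cW; rewrite lexx ltW.
- move=> x; rewrite in_itv /= => /andP[/ltW ax /ltW xb].
  by rewrite derive1E; apply: derive_val; apply: dW; rewrite ax.
Qed.

(** Integration by parts as an inequality: W is the boundary term, w its
    derivative and G' = g dominates what is left. All oscillatory integrals
    below are bounded in this way. *)
Lemma Rintegral_comparison f w g W G a b : a <= b ->
  (forall x, a <= x <= b -> is_derive x 1 W (w x)) ->
  (forall x, a <= x <= b -> is_derive x 1 G (g x)) ->
  (forall x, a <= x <= b -> {for x, continuous f}) ->
  (forall x, a <= x <= b -> {for x, continuous w}) ->
  (forall x, a <= x <= b -> {for x, continuous g}) ->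
  (forall x, a <= x <= b -> `|f x - w x| <= g x) ->
  `|\int[mu]_(x in `[a, b]) f x| <= `|W b - W a| + (G b - G a).
Proof.
move=> ab dW dG cf cw cg fwg.
have If := segment_integrable cf; have Iw := segment_integrable cw.
have Ig := segment_integrable cg.
rewrite -(Rintegral_primitive ab dW cw) -(Rintegral_primitive ab dG cg).
rewrite -[X in `|X|](subrK (\int[mu]_(x in `[a, b]) w x)) addrC.
rewrite (le_trans (ler_normD _ _)) // lerD2l -RintegralB //.
have Ifw : mu.-integrable `[a, b] (EFin \o (fun x => f x - w x)).
  by have := integrableB _ If Iw; exact.
rewrite (le_trans (le_normr_Rintegral _ Ifw)) //.
apply: le_Rintegral => //; first by have := integrable_abse Ifw; apply.
Qed.

Lemma Rintegral_le_length f (M : R) a b : a <= b ->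
  (forall x, a <= x <= b -> {for x, continuous f}) ->
  (forall x, a <= x <= b -> `|f x| <= M) ->
  `|\int[mu]_(x in `[a, b]) f x| <= M * (b - a).
Proof.
move=> ab cf fM.
have dM x : a <= x <= b -> is_derive x 1 (fun x => M * x) M.
  by move=> _; derive_to; ring.
have key x : a <= x <= b -> `|f x - (fun=> 0) x| <= M.
  by move=> xI; rewrite subr0 fM.
have := @Rintegral_comparison f (fun=> 0) (fun=> M) (fun=> 0) (fun x => M * x) a b ab
  (fun x _ => derivable_rule_cst 0 x) dM cf (fun x _ => @cst_continuous _ _ 0 x)
  (fun x _ => @cst_continuous _ _ M x) key.
by rewrite subrr normr0 add0r -mulrBr.
Qed.

Lemma Rintegral_split f a c b : a <= c -> c <= b ->
  (forall x, a <= x <= b -> {for x, continuous f}) ->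
  \int[mu]_(x in `[a, b]) f x =
  \int[mu]_(x in `[a, c]) f x + \int[mu]_(x in `[c, b]) f x.
Proof.
move=> ac cb cf; have If := segment_integrable cf.
have := @Rintegral_itvB _ f (BLeft a) (BRight b) c If.
rewrite !bnd_simp => /(_ ac cb) /eqP; rewrite subr_eq addrC => /eqP ->.
congr (_ + _); apply: Rintegral_itv_obnd_cbnd.
apply: integrableS If => //.
by apply: subset_itvr; rewrite bnd_simp.
Qed.

Lemma primitive_exists f a : (forall x, a <= x -> {for x, continuous f}) ->
  exists F : R -> R, forall x, a < x -> is_derive x 1 F (f x).
Proof.
move=> cf; exists (fun y => \int[mu]_(x in `[a, y]) f x) => x ax.
have xx1 : x < x + 1 by rewrite ltrDl.
have If : mu.-integrable `[a, x + 1] (EFin \o f).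
  by apply: segment_integrable => y /andP[ay _]; exact: cf.
have [dF F'] := continuous_FTC1_closed xx1 If ax (cf _ (ltW ax)).
apply: DeriveDef; first exact: dF.
by rewrite -F' derive1E.
Qed.

End interval_integrals.

(** * One-dimensional oscillatory integrals *)

Section bessel.
Variable R : realType.
Notation mu := (@lebesgue_measure R).
Implicit Types x s eta nu beta : R.

Lemma atan_lipschitz_bound (y z : R) : atan y - atan z <= pi.
Proof.
have := atan_ltpi2 y; have := atan_gtNpi2 z; lra.
Qed.

(** The derivative Q = nu + 2 s sin x of the phase may vanish, so the
    integration by parts is made with Q / (Q^2 + eta^2) in place of 1/Q. The
    error is at most (eta^2 + |Q'|) / (Q^2 + eta^2). The part with |Q'|
    integrates to an arctangent and absorbs the other one where |cos x| >=
    kappa; elsewhere the other part is at most m, and the second arctangent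
    measures the set |cos x| < kappa. The numbers s1 and s2 are the signs of
    cos and sin on the interval. *)
Lemma oscillation_piece (a b nu s beta eta kappa m s1 s2 : R) :
  a <= b -> 0 < s -> 0 < eta -> kappa = eta ^+ 2 / (2 * s) -> 0 <= m ->
  s1 ^+ 2 = 1 -> s2 ^+ 2 = 1 ->
  (forall x, `|cos x| < kappa ->
     eta ^+ 2 / ((nu + 2 * s * sin x) ^+ 2 + eta ^+ 2) <= m) ->
  (forall x, a <= x <= b -> 0 <= s1 * cos x) ->
  (forall x, a <= x <= b -> 0 <= s2 * sin x) ->
  `|\int[mu]_(x in `[a, b]) cos (beta + nu * x - 2 * s * cos x)| <=
  (1 + 2 * pi) / eta + m * kappa * (b - a + 2 * pi).
Proof.
move=> ab s0 e0 kE m0 s11 s21 hm hc hs.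
have k0 : 0 < kappa by rewrite kE divr_gt0 // ?exprn_gt0 // mulr_gt0.
pose Q x := nu + 2 * s * sin x.
pose P x := beta + nu * x - 2 * s * cos x.
have dQ x : is_derive x 1 Q (2 * s * cos x).
  by rewrite /Q; derive_to; ring.
have dP x : is_derive x 1 P (Q x).
  by rewrite /P; derive_to; rewrite /Q; ring.
have D0 x : 0 < Q x ^+ 2 + eta ^+ 2 by rewrite ltr_wpDl ?sqr_ge0 // exprn_gt0.
have K0 x : 0 < kappa ^+ 2 + cos x ^+ 2 by rewrite ltr_pwDl ?sqr_ge0 // exprn_gt0.
have D1 x : Q x ^+ 2 + eta ^+ 2 != 0 by rewrite gt_eqF.
have K1 x : kappa ^+ 2 + cos x ^+ 2 != 0 by rewrite gt_eqF.
have e1 : eta != 0 by rewrite gt_eqF.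
have k1 : kappa != 0 by rewrite gt_eqF.
pose W x := sin (P x) * (Q x / (Q x ^+ 2 + eta ^+ 2)).
pose w x := cos (P x) * (Q x * (Q x / (Q x ^+ 2 + eta ^+ 2))) +
  sin (P x) * (2 * s * cos x * ((eta ^+ 2 - Q x ^+ 2) / (Q x ^+ 2 + eta ^+ 2) ^+ 2)).
pose G x := 2 * s1 / eta * atan (Q x / eta) +
  m * (kappa * x - 2 * kappa * s2 * atan (cos x / kappa)).
pose g x := 2 * (s1 * (2 * s * cos x)) / (Q x ^+ 2 + eta ^+ 2) +
  m * (kappa + 2 * kappa ^+ 2 * (s2 * sin x) / (kappa ^+ 2 + cos x ^+ 2)).
have dW x : is_derive x 1 W (w x).
  rewrite /W; derive_to => //; rewrite /w; field; exact: D1.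
have dG x : is_derive x 1 G (g x).
  rewrite /G; derive_to => //; rewrite /g; field.
  by rewrite e1 k1 K1 D1.
have cw x : {for x, continuous w} by rewrite /w; cont; rewrite ?expf_neq0.
have cg x : {for x, continuous g} by rewrite /g; cont.
have cf x : {for x, continuous (fun x => cos (P x))} by cont.
have key x : a <= x <= b -> `|cos (P x) - w x| <= g x.
  move=> xab.
  have /hc c0 := xab; have /hs sn0 := xab.
  set D := Q x ^+ 2 + eta ^+ 2.
  have cE : `|cos x| = s1 * cos x.
    by rewrite -(ger0_norm c0) normrM (norm_of_sqr1 s11) mul1r.
  have sE : `|sin x| = s2 * sin x.
    by rewrite -(ger0_norm sn0) normrM (norm_of_sqr1 s21) mul1r.
  have fwE : cos (P x) - w x = cos (P x) * (eta ^+ 2 / D) -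
     sin (P x) * (2 * s * cos x * ((eta ^+ 2 - Q x ^+ 2) / D ^+ 2)).
    by rewrite /w -/D; have := D1 x; rewrite -/D /D => ?; field.
  have b1 : `|cos (P x) - w x| <= eta ^+ 2 / D + 2 * s * `|cos x| / D.
    have Dp : 0 < D by exact: D0.
    rewrite fwE; apply: (le_trans (ler_normB _ _)); apply: lerD.
      rewrite normrM (ger0_norm (divr_ge0 (sqr_ge0 _) (ltW Dp))).
      by rewrite ler_piMl ?cos_max // divr_ge0 ?sqr_ge0 ?ltW.
    rewrite normrM -[leRHS]mul1r; apply: ler_pM; rewrite ?sin_max //.
    rewrite -mulrA normrM (ger0_norm (_ : 0 <= 2 * s)); last lra.
    rewrite -[leRHS]mulrA; apply: ler_wpM2l; first lra.
    rewrite normrM.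
    apply: ler_wpM2l => //; rewrite normrM normfV (ger0_norm (sqr_ge0 D)).
    rewrite ler_pdivrMr ?exprn_gt0 // expr2 mulrA mulVf ?mul1r ?gt_eqF //.
    rewrite ler_norml /D; have := sqr_ge0 (Q x); have := sqr_ge0 eta; lra.
  have gE : g x = 2 * (2 * s * `|cos x|) / D +
     m * (kappa + 2 * kappa ^+ 2 * `|sin x| / (kappa ^+ 2 + cos x ^+ 2)).
    by rewrite /g -/D cE sE; congr (2 * _ / _ + _); ring.
  apply: (le_trans b1); rewrite gE.
  have Dp : 0 < D by exact: D0.
  have D'0 : 0 <= D^-1 by rewrite invr_ge0 ltW.
  have e2E : eta ^+ 2 = 2 * s * kappa by rewrite kE; field; rewrite gt_eqF.
  set X := kappa + _.
  have X0 : 0 <= X.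
    by rewrite addr_ge0 ?(ltW k0) // divr_ge0 ?(ltW (K0 _)) // mulr_ge0 //
      mulr_ge0 // sqr_ge0.
  have [ck|ck] := leP kappa `|cos x|.
    rewrite (_ : 2 * (2 * s * `|cos x|) / D = 2 * s * `|cos x| / D + 2 * s * `|cos x| / D);
      last by field; rewrite gt_eqF.
    rewrite -[leLHS]addr0; apply: lerD; last by rewrite mulr_ge0.
    by rewrite lerD2r e2E ler_wpM2r // ler_wpM2l // mulr_ge0 // ltW.
  have X1 : 1 <= X.
    have [k1'|k1'] := leP 1 kappa.
      rewrite (le_trans k1') // lerDl divr_ge0 ?(ltW (K0 _)) // mulr_ge0 //.
      by rewrite mulr_ge0 // sqr_ge0.
    have c2 : `|cos x| ^+ 2 <= kappa ^+ 2 by rewrite lerXn2r ?nnegrE ?(ltW k0) // ltW.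
    have h : `|sin x| <= 2 * kappa ^+ 2 * `|sin x| / (kappa ^+ 2 + cos x ^+ 2).
      rewrite ler_pdivlMr // [leRHS]mulrC ler_wpM2l // -[cos x ^+ 2]real_normK ?num_real //.
      lra.
    have e : `|cos x| ^+ 2 + `|sin x| ^+ 2 = 1.
      by rewrite !real_normK ?num_real // cos2Dsin2.
    have := sin_max x; have : 0 <= `|sin x| by [].
    move: h c2 e; rewrite /X; set Y := _ / _; set S := `|sin x|; set C := `|cos x|.
    move=> h c2 e S0 S1; have : S ^+ 2 <= S by rewrite expr2 ler_piMr.
    have : kappa ^+ 2 <= kappa by rewrite expr2 ler_piMr ?(ltW k0) ?(ltW k1').
    lra.
  have := hm _ ck; rewrite -/(Q x) -/D => hm'.
  have : m <= m * X by rewrite ler_peMr.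
  have : 0 <= 2 * s * `|cos x| / D by rewrite !mulr_ge0 // ltW.
  rewrite -[2 * (_ * _) / D]mulrA; lra.
have := Rintegral_comparison ab (fun x _ => dW x) (fun x _ => dG x)
  (fun x _ => cf x) (fun x _ => cw x) (fun x _ => cg x) key.
move=> /le_trans; apply.
have WB x : `|W x| <= (2 * eta)^-1.
  rewrite /W normrM; apply: (@le_trans _ _ (1 * `|Q x / (Q x ^+ 2 + eta ^+ 2)|)).
    by rewrite ler_wpM2r // sin_max.
  rewrite mul1r normrM normfV (ger0_norm (ltW (D0 x))) ler_pdivrMr //.
  rewrite mulrC ler_pdivlMr; last by rewrite mulr_gt0.
  rewrite -[Q x ^+ 2]real_normK ?num_real //.
  by have := sqr_ge0 (`|Q x| - eta); rewrite sqrrB; lra.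
have AB (z c d : R) : z ^+ 2 = 1 -> z * (atan c - atan d) <= pi.
  move=> /norm_of_sqr1 z1; rewrite (le_trans (ler_norm _)) // normrM z1 mul1r ler_norml.
  have := atan_lipschitz_bound c d; have := atan_lipschitz_bound d c; lra.
have GB : G b - G a <= 2 * pi / eta + m * kappa * (b - a + 2 * pi).
  rewrite /G.
  have -> : forall A B C D, 2 * s1 / eta * A + m * (kappa * b - 2 * kappa * s2 * B) -
    (2 * s1 / eta * C + m * (kappa * a - 2 * kappa * s2 * D)) =
    2 / eta * (s1 * (A - C)) + (m * kappa * (b - a + 2 * (s2 * (D - B)))).
    by move=> A B C D; field; rewrite gt_eqF.
  apply: lerD.
    by rewrite mulrAC ler_wpM2r ?invr_ge0 ?(ltW e0) // ler_wpM2l // AB.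
  by apply: ler_wpM2l; [rewrite mulr_ge0 // ltW|rewrite lerD2l ler_wpM2l // AB].
apply: (le_trans (lerD (ler_normB _ _) GB)).
have := WB a; have := WB b.
have -> : (2 * eta)^-1 = 2^-1 / eta by field.
rewrite [X in _ <= X + _]mulrDl mul1r; lra.
Qed.

End bessel.

Section bessel4.
Variable R : realType.
Notation mu := (@lebesgue_measure R).

(** A bound for the Bessel function of order nu at 2 s that is uniform across
    the turning point |nu| = 2 s. Since |nu + 2 s sin x| is at least of
    order | |nu| - 2 s | near the zeros of cos, the scale eta = (s b)^(1/4),
    with b the maximum in the statement, balances the terms of
    [oscillation_piece]. *)
Lemma oscillation_fourth_power (nu s beta : R) : 1 <= s ->
  `|\int[mu]_(x in `[- pi, pi]) cos (beta + nu * x - 2 * s * cos x)| ^+ 4 <=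
  (4 + 28 * pi) ^+ 4 / (s * Num.max 1 `| `|nu| - 2 * s|).
Proof.
move=> s1; have s0 : 0 < s by lra.
set a := `| _ - _|; set b := Num.max 1 a.
have b1 : 1 <= b by rewrite le_max lexx.
have ab : a <= b by rewrite le_max lexx orbT.
have sb : 1 <= s * b by rewrite -[1]mulr1 ler_pM.
pose eta := Num.sqrt (Num.sqrt (s * b)).
have e4 : eta ^+ 4 = s * b by rewrite (exprM _ 2 2) !sqr_sqrtr // ?sqrtr_ge0 //; lra.
have e0 : 0 < eta by rewrite /eta !sqrtr_gt0; lra.
have e1 : 1 <= eta.
  rewrite -(@ler_pXn2r _ 4) ?nnegrE ?expr1n ?e4 // ltW //.
pose k := eta ^+ 2 / (2 * s).
have k0 : 0 <= k by rewrite divr_ge0 ?sqr_ge0 //; lra.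
(* m bounds the error near the zeros of cos, where |Q| >= a / 2 if a >= 1. *)
pose m := if a < 1 then 1 else Num.min 1 (4 * eta ^+ 2 / a ^+ 2).
have m0 : 0 <= m.
  rewrite /m; case: ifP => // _; rewrite le_min ler01 /=.
  by apply: divr_ge0; [apply: mulr_ge0|]; rewrite ?sqr_ge0.
have m1 : m <= 1 by rewrite /m; case: ifP => // _; rewrite ge_min lexx.
have e3 : m * eta ^+ 3 <= 4 * s.
  have [e3s|e3s] := leP (eta ^+ 3) s.
    have : m * eta ^+ 3 <= eta ^+ 3 by rewrite ler_piMl // exprn_ge0 // ltW.
    lra.
  have e3' : eta ^+ 4 = eta ^+ 3 * eta by rewrite -exprSr.
  have [a1|a1] := ltP a 1.
    have bE : b = 1 by apply/eqP; rewrite eq_le b1 ge_max lexx ltW.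
    move: e4; rewrite bE e3'; have : eta ^+ 3 <= eta ^+ 3 * eta by rewrite ler_peMr ?exprn_ge0 // ltW.
    lra.
  have bE : b = a by apply/eqP; rewrite eq_le ab ge_max lexx a1.
  have a0 : 0 < a by lra.
  have ea : eta < a.
    rewrite -(@ltr_pM2l _ (eta ^+ 3)) ?exprn_gt0 // -e3' e4 bE ltr_pM2r //.
  have : m <= 4 * eta ^+ 2 / a ^+ 2 by rewrite /m ltNge a1 /= ge_min lexx orbT.
  move=> /(ler_wpM2r (exprn_ge0 3 (ltW e0))) /le_trans; apply.
  have -> : 4 * eta ^+ 2 / a ^+ 2 * eta ^+ 3 = 4 * eta * (eta ^+ 4) / a ^+ 2.
    by field; rewrite gt_eqF.
  rewrite e4 bE ler_pdivrMr ?exprn_gt0 //.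
  have -> : 4 * eta * (s * a) = 4 * s * (a * eta) by ring.
  rewrite ler_pM2l; last lra.
  by rewrite expr2 ler_pM2l // ltW.
have mk : m * k <= 2 / eta.
  rewrite ler_pdivlMr //.
  have -> : m * k * eta = m * eta ^+ 3 / (2 * s) by rewrite /k; field; rewrite gt_eqF.
  by rewrite ler_pdivrMr; lra.
have hm x : `|cos x| < k -> eta ^+ 2 / ((nu + 2 * s * sin x) ^+ 2 + eta ^+ 2) <= m.
  move=> ck; set Q := nu + _.
  have DQ : 0 < Q ^+ 2 + eta ^+ 2 by rewrite ltr_wpDl ?sqr_ge0 // exprn_gt0.
  have le1 : eta ^+ 2 / (Q ^+ 2 + eta ^+ 2) <= 1.
    by rewrite ler_pdivrMr // mul1r lerDr sqr_ge0.
  rewrite /m; have [a1|a1] := ltP a 1 => //; rewrite le_min le1 /=.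
  have a0 : 0 < a by lra.
  have bE : b = a by apply/eqP; rewrite eq_le ab ge_max lexx a1.
  have Qa : a / 2 <= `|Q|.
    have c2 : `|cos x| ^+ 2 <= k ^+ 2 by rewrite lerXn2r ?nnegrE // ltW.
    have kE : 2 * s * k ^+ 2 = a / 2.
      have -> : 2 * s * k ^+ 2 = eta ^+ 4 / (2 * s) by rewrite /k; field; rewrite gt_eqF.
      by rewrite e4 bE; field; rewrite gt_eqF.
    have h1 : 1 - `|sin x| <= `|cos x| ^+ 2.
      have e : `|cos x| ^+ 2 + `|sin x| ^+ 2 = 1.
        by rewrite !real_normK ?num_real // cos2Dsin2.
      have : `|sin x| ^+ 2 <= `|sin x| by rewrite expr2 ler_piMr // sin_max.
      lra.
    have h2 : 2 * s * (1 - `|sin x|) <= a / 2.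
      rewrite -kE; apply: ler_wpM2l; [lra|exact: le_trans h1 c2].
    have h3 : `|nu| - 2 * s * `|sin x| <= `|Q|.
      have := ler_normB Q (2 * s * sin x); rewrite /Q addrK !normrM.
      rewrite (ger0_norm (ler0n _ 2)) (ger0_norm (ltW s0)); lra.
    have h4 : 2 * s * `|sin x| - `|nu| <= `|Q|.
      have := ler_normB Q nu; rewrite /Q addrAC subrr add0r !normrM.
      rewrite (ger0_norm (ler0n _ 2)) (ger0_norm (ltW s0)); lra.
    have h5 : 2 * s * `|sin x| <= 2 * s.
      by rewrite ler_piMr ?sin_max // mulr_ge0 // ltW.
    move: h2 h3 h4; rewrite /a; case: (ger0P (`|nu| - 2 * s)) => _ h2 h3 h4; lra.
  have Q2 : a ^+ 2 / 4 <= Q ^+ 2.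
    rewrite -[Q ^+ 2]real_normK ?num_real //.
    have -> : a ^+ 2 / 4 = (a / 2) ^+ 2 by field.
    by rewrite lerXn2r ?nnegrE // divr_ge0 // ltW.
  have -> : 4 * eta ^+ 2 / a ^+ 2 = eta ^+ 2 / (a ^+ 2 / 4) by field; rewrite gt_eqF.
  rewrite ler_wpM2l ?sqr_ge0 // lef_pV2 ?posrE //; last by rewrite divr_gt0 ?exprn_gt0.
  by rewrite (le_trans Q2) // lerDl sqr_ge0.
have pi2 := pihalf_02 R.
have piece x y s1' s2' : x <= y -> y - x = pi / 2 -> s1' ^+ 2 = 1 -> s2' ^+ 2 = 1 ->
  (forall z, x <= z <= y -> 0 <= s1' * cos z) ->
  (forall z, x <= z <= y -> 0 <= s2' * sin z) ->
  `|\int[mu]_(x in `[x, y]) cos (beta + nu * x - 2 * s * cos x)| <=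
    (1 + 7 * pi) / eta.
  move=> xy xyE s1E s2E hc hs.
  apply: (le_trans (@oscillation_piece _ x y nu s beta eta k m _ _ xy s0 e0 erefl m0 s1E s2E hm hc hs)).
  rewrite xyE.
  have : m * k * (pi / 2 + 2 * pi) <= 2 / eta * (pi / 2 + 2 * pi).
    by apply: ler_wpM2r => //; lra.
  have -> : 2 / eta * (pi / 2 + 2 * pi) = 5 * pi / eta by field; rewrite gt_eqF.
  rewrite !mulrDl; lra.
have cf x : {for x, continuous (fun x => cos (beta + nu * x - 2 * s * cos x))} by cont.
have sgnN (z : R) : - pi <= z <= 0 -> sin z <= 0.
  by move=> h; rewrite -[z]opprK sinN oppr_le0 sin_ge0_pi //; lra.
have cosl (z : R) : pi / 2 <= z <= pi -> cos z <= 0.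
  by move=> h; rewrite -[z](subrK (pi / 2)) cosDpihalf oppr_le0 sin_ge0_pi //; lra.
have I : `|\int[mu]_(x in `[- pi, pi]) cos (beta + nu * x - 2 * s * cos x)| <=
    (4 + 28 * pi) / eta.
  rewrite (@Rintegral_split _ _ _ 0) //; [|lra|lra].
  rewrite (@Rintegral_split _ _ _ (- (pi / 2)) 0) //; [|lra|lra].
  rewrite (@Rintegral_split _ _ _ (pi / 2) pi) //; [|lra|lra].
  apply: (le_trans (ler_normD _ _)).
  have -> : (4 + 28 * pi) / eta = ((1 + 7 * pi) / eta + (1 + 7 * pi) / eta) +
    ((1 + 7 * pi) / eta + (1 + 7 * pi) / eta) by field; rewrite gt_eqF.
  apply: lerD; (apply: (le_trans (ler_normD _ _)); apply: lerD).
  - apply: (piece _ _ (-1) (-1)); rewrite ?sqrrN ?expr1n //; [lra|lra|..] => z zI;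
      rewrite mulN1r oppr_ge0; [|by apply: sgnN; lra].
    by rewrite -cosN; apply: cosl; lra.
  - apply: (piece _ _ 1 (-1)); rewrite ?sqrrN ?expr1n //; [lra|lra|..] => z zI;
      rewrite ?mulN1r ?oppr_ge0 ?mul1r; [by apply: cos_ge0_pihalf; lra|by apply: sgnN; lra].
  - apply: (piece _ _ 1 1); rewrite ?sqrrN ?expr1n //; [lra|lra|..] => z zI;
      rewrite ?mul1r; [by apply: cos_ge0_pihalf; lra|by apply: sin_ge0_pi; lra].
  - apply: (piece _ _ (-1) 1); rewrite ?sqrrN ?expr1n //; [lra|lra|..] => z zI;
      rewrite ?mul1r ?mulN1r ?oppr_ge0; [by apply: cosl; lra|by apply: sin_ge0_pi; lra].
rewrite -e4 -expr_div_n lerXn2r ?nnegrE // divr_ge0 ?(ltW e0) //; lra.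
Qed.

End bessel4.

(** * Fresnel integrals and Glasser's substitution *)

Section fresnel.
Variable R : realType.
Notation mu := (@lebesgue_measure R).
Implicit Types p q theta Y U : R.

Definition fresnel theta Y := \int[mu]_(v in `[0, Y]) cos (v ^+ 2 + theta).

Lemma fresnel_tail theta a b : 0 < a -> a <= b ->
  `|fresnel theta b - fresnel theta a| <= a^-1.
Proof.
move=> a0 ab; rewrite /fresnel (@Rintegral_split _ _ 0 a b) ?(ltW a0) //; last by move=> x _; cont.
rewrite addrAC subrr add0r.
(* One integration by parts, with boundary term sin(v^2 + theta) / (2v). *)
pose w x := cos (x ^+ 2 + theta) - sin (x ^+ 2 + theta) / (2 * x ^+ 2).
have h := @Rintegral_comparison _ (fun v => cos (v ^+ 2 + theta)) w
  (fun x => (2 * x ^+ 2)^-1) (fun x => sin (x ^+ 2 + theta) / (2 * x))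
  (fun x => - (2 * x)^-1) a b ab.
have x0 x : a <= x <= b -> x != 0 by move=> /andP[ax _]; rewrite gt_eqF // (lt_le_trans a0).
apply: (le_trans (h _ _ _ _ _ _)).
- move=> x /x0 xx; derive_to => //; first by rewrite mulf_neq0.
  by rewrite /w; field.
- move=> x /x0 xx; derive_to => //; first by rewrite mulf_neq0.
  by field.
- by move=> x _; cont.
- by move=> x /x0 xx; rewrite /w; cont; rewrite mulf_neq0 // expf_neq0.
- by move=> x /x0 xx; cont; rewrite mulf_neq0 // expf_neq0.
- move=> x /x0 xx; rewrite /w opprB addrC subrK normrM normfV.
  have x2 : 0 <= 2 * x ^+ 2 by apply: mulr_ge0 => //; exact: sqr_ge0.
  by rewrite [X in _ / X]ger0_norm // ler_piMl ?sin_max // invr_ge0.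
have b0 : 0 < b by exact: lt_le_trans ab.
have B x : 0 < x -> `|sin (x ^+ 2 + theta) / (2 * x)| <= (2 * x)^-1.
  move=> xx; have x2 : 0 <= 2 * x by lra.
  by rewrite normrM normfV [X in _ / X]ger0_norm // ler_piMl ?sin_max // invr_ge0.
apply: (le_trans (lerD (ler_normB _ _) (lexx _))).
have := B _ a0; have := B _ b0; rewrite !invfM; lra.
Qed.

Lemma fresnel_limit theta : exists L, forall Y, 0 < Y ->
  `|fresnel theta Y - L| <= Y^-1.
Proof.
pose u n : R := fresnel theta n.+1%:R.
have cu : cvg (u @ \oo).
  apply/cauchy_cvgP/cauchy_exP => e e0.
  near \oo => N; exists (u N).
  suff : \forall n \near \oo, ball (u N) e (u n) by [].
  near=> n; rewrite /ball /= distrC.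
  have Nn : N.+1%:R <= n.+1%:R :> R by rewrite ler_nat ltnS; near: n; exists N.
  rewrite (le_lt_trans (fresnel_tail theta _ Nn)) // ?ltr0n //.
  by near: N; exact: near_infty_natSinv_lt (PosNum e0).
exists (lim (u @ \oo)) => Y Y0; apply/ler_addgt0Pr => e e0.
have /cvgrPdist_le /(_ e e0)[N _ hN] := cu.
have [M _ hM] := nbhs_infty_ger Y.
pose n := maxn N M.
have -> : fresnel theta Y - lim (u @ \oo) =
  - (u n - fresnel theta Y) - (lim (u @ \oo) - u n) by ring.
rewrite (le_trans (ler_normB _ _)) // normrN; apply: lerD.
  apply: fresnel_tail => //; apply: (@le_trans _ _ (n%:R : R)); first by apply: hM; exact: leq_maxr.
  by rewrite ler_nat.
by apply: hN; exact: leq_maxl.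
Unshelve. all: by end_near. Qed.

Lemma norm_sin_le (y : R) : `|sin y| <= `|y|.
Proof.
wlog y0 : y / 0 <= y.
  move=> h; have [y0|/ltW y0] := leP 0 y; first exact: h.
  by rewrite -normrN -sinN -(normrN y); apply: h; rewrite oppr_ge0.
have e : \int[mu]_(v in `[0, y]) cos v = sin y.
  by rewrite (@Rintegral_primitive _ _ sin) // ?sin0 ?subr0 // => v _; cont.
rewrite -e (ger0_norm y0); apply: (@le_trans _ _ (1 * (y - 0))); last by rewrite mul1r subr0.
by apply: Rintegral_le_length => // v _; [cont|exact: cos_max].
Qed.

Lemma cos_ge_parabola (x : R) : 1 - x ^+ 2 / 2 <= cos x.
Proof.
have -> : x = (x / 2) *+ 2 by rewrite -mulr_natr divfK.
rewrite cos_mulr2n -mulr_natr.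
have h : sin (x / 2) ^+ 2 <= (x / 2) ^+ 2.
  rewrite -[leLHS]real_normK ?num_real // -[leRHS]real_normK ?num_real //.
  by rewrite lerXn2r ?nnegrE // norm_sin_le.
by have := cos2Dsin2 (x / 2); lra.
Qed.

(** Up to 6/5 the integral is at least 6/5 - (6/5)^5/10, which exceeds the bound
    5/6 on the rest. Positivity of the limit makes the linear system for sin(t w)
    and cos(t w) invertible. *)
Lemma fresnel_cos_pos L :
  (forall Y, 0 < Y -> `|fresnel 0 Y - L| <= Y^-1) -> 0 < L.
Proof.
move=> hL; have a0 : 0 < 6 / 5 :> R by lra.
have := hL _ a0.
have h : 6 / 5 - (6 / 5) ^+ 5 / 10 <= fresnel 0 (6 / 5).
  pose p (v : R) := 1 - v ^+ 4 / 2.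
  have -> : 6 / 5 - (6 / 5) ^+ 5 / 10 = \int[mu]_(v in `[0, 6 / 5]) p v.
    have -> : \int[mu]_(v in `[0, 6 / 5]) p v = 6 / 5 - (6 / 5) ^+ 5 / 10 - (0 - 0 ^+ 5 / 10).
      apply: (@Rintegral_primitive _ p (fun v => v - v ^+ 5 / 10)); first exact: ltW.
      - by move=> x _; derive_to => //; rewrite /p /=; field.
      - by move=> x _; rewrite /p; cont.
    by rewrite expr0n /= mul0r !subr0.
  apply: le_Rintegral => //.
  - by apply: segment_integrable => x _; rewrite /p; cont.
  - by apply: segment_integrable => x _; cont.
  - by move=> v _; have := cos_ge_parabola (v ^+ 2); rewrite -exprM addr0 /p.
have -> : (6 / 5 : R)^-1 = 5 / 6 by field.
rewrite ler_norml => /andP[_]; move: h; rewrite !exprS expr0; lra.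
Qed.

(** The function v = p u - q/u changes sign under u -> q/(p u), so that its
    inverse satisfies u'(v) + u'(-v) = 1/p. In the proof both sides are
    differentiated with respect to the endpoint U. *)
Lemma glasser p q theta U : 0 < p -> 0 < q -> q <= p * U ^+ 2 -> 0 < U ->
  p * \int[mu]_(u in `[q / (p * U), U]) cos ((p * u - q / u) ^+ 2 + theta) =
  fresnel theta (p * U - q / U).
Proof.
move=> p0 q0 qU U0.
pose y u := p * u - q / u.
(* r is the zero of v. *)
pose r := Num.sqrt (q / p).
have r2 : r ^+ 2 = q / p by rewrite sqr_sqrtr // divr_ge0 // ltW.
have r0 : 0 < r by rewrite sqrtr_gt0 divr_gt0.
have rU : r <= U.
  by rewrite -(@ler_pXn2r _ 2) ?nnegrE ?(ltW r0) ?(ltW U0) // r2 ler_pdivrMr // mulrC.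
pose c := q / (p * U) / 2.
have c0 : 0 < c by rewrite !divr_gt0 // mulr_gt0.
have [F dF] : exists F : R -> R, forall v : R, -1 < v -> is_derive v 1 F (cos (v ^+ 2 + theta)).
  by apply: primitive_exists => x _; cont.
have [H dH] : exists H : R -> R, forall u : R, c < u -> is_derive u 1 H (cos (y u ^+ 2 + theta)).
  apply: primitive_exists => x cx; rewrite /y; cont.
  by rewrite gt_eqF // (lt_le_trans c0).
have VU : q / (p * U) <= U by rewrite ler_pdivrMr ?mulr_gt0 // mulrCA -expr2.
have V0 : 0 < q / (p * U) by rewrite divr_gt0 // mulr_gt0.
have yU : 0 <= y U by rewrite subr_ge0 ler_pdivrMr // -mulrA -expr2.
have cy x : c <= x -> {for x, continuous (fun u => cos (y u ^+ 2 + theta))}.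
  by move=> cx; rewrite /y; cont; rewrite gt_eqF // (lt_le_trans c0).
have cV : c < q / (p * U) by rewrite /c; lra.
have -> : fresnel theta (y U) = F (y U) - F 0.
  by apply: Rintegral_primitive => // x x0; [apply: dF; lra|cont].
have -> : \int[mu]_(u in `[q / (p * U), U]) cos ((p * u - q / u) ^+ 2 + theta) =
    H U - H (q / (p * U)).
  by apply: Rintegral_primitive => // x x0; [apply: dH; lra|apply: cy; lra].
pose A u := p * (H u - H (q / (p * u))) - F (y u).
have dA u : r <= u <= U -> is_derive u 1 A 0.
  move=> /andP[ru uU]; have u0 : 0 < u by exact: lt_le_trans ru.
  have un : u != 0 by rewrite gt_eqF.
  have pn : p != 0 by rewrite gt_eqF.
  have vV : q / (p * U) <= q / (p * u).
    by rewrite ler_pM2l // lef_pV2 ?posrE ?mulr_gt0 // ler_pM2l.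
  have Vu : q / (p * u) <= u.
    rewrite ler_pdivrMr ?mulr_gt0 // mulrCA -expr2 -ler_pdivrMl // mulrC -r2.
    by rewrite lerXn2r ?nnegrE ?(ltW r0) ?(ltW u0).
  have d1 := dH u (lt_le_trans cV (le_trans vV Vu)).
  have d2 := dH _ (lt_le_trans cV vV).
  have yu : 0 <= y u.
    rewrite /y subr_ge0 ler_pdivrMr // -mulrA -expr2 -ler_pdivrMl // mulrC -r2.
    by rewrite lerXn2r ?nnegrE ?(ltW r0) ?(ltW u0).
  have d3 : is_derive (y u) 1 F (cos (y u ^+ 2 + theta)) by apply: dF; lra.
  have dv : is_derive u 1 (fun u => q / (p * u)) (- q / (p * u ^+ 2)).
    by derive_to; [rewrite mulf_neq0|field; rewrite pn un].
  have dy : is_derive u 1 y (p + q / u ^+ 2).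
    by rewrite /y; derive_to => //; field.
  have yv : y (q / (p * u)) = - y u.
    by rewrite /y; field; rewrite pn un gt_eqF.
  have d4 := @is_derive1_comp _ H _ u _ _ d2 dv.
  have d5 := @is_derive1_comp _ F _ u _ _ d3 dy.
  rewrite yv sqrrN in d4.
  rewrite /A; eapply is_derive_eq.
    eapply derivable_rule_add; [|eapply derivable_rule_opp; exact: d5].
    eapply derivable_rule_mul; [exact: derivable_rule_cst|].
    by eapply derivable_rule_add; [exact: d1|eapply derivable_rule_opp; exact: d4].
  by rewrite /=; field; rewrite pn un.
have := Rintegral_primitive rU dA (fun x _ => @cst_continuous _ _ 0 x).
rewrite Rintegral_cst // mul0r /A.
have -> : q / (p * r) = r.
  by apply/(@mulIf _ r); rewrite ?gt_eqF // -expr2 r2; field; rewrite !gt_eqF.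
have -> : y r = 0.
  apply/(@mulIf _ r); rewrite ?gt_eqF // mul0r mulrBl divfK ?gt_eqF //.
  by rewrite -mulrA -expr2 r2 mulrC divfK ?gt_eqF // subrr.
rewrite subrr mulr0 sub0r => /eqP; rewrite eq_sym subr_eq0 => /eqP e.
move: e; rewrite -/(y U); lra.
Qed.


End fresnel.

(** * The non-resonant part of the chirp *)

Section low_part.
Variable R : realType.
Notation mu := (@lebesgue_measure R).

(** Box estimates for the amplitude in [low_part_bound]: T is (u/r)^4, p the
    square root of the weight, q the factor by which the derivative of the
    phase differs from that of r^4/(4u^2), and B' the derivative in T of B. *)
Lemma amplitude_bound (lam T p q B B' : R) : 0 <= lam <= 16 -> 0 <= T <= 1 / 256 ->
  p = 1 - 256 * T -> q = 1 - 4 * lam * T ->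
  B = 3 * p * q - 2048 * T * q + 16 * lam * T * p ->
  B' = 3 * (- 256 * q - 4 * lam * p) - 2048 * q + 8192 * lam * T
    + 16 * lam * p - 4096 * lam * T ->
  [/\ `|p| <= 1, `|B| <= 12 & `|5 * p * B * q +
   4 * T * ((- 256 * B + p * B') * q + 12 * lam * p * B)| <= 210].
Proof.
move=> /andP[l0 l16] /andP[T0 T1] pE qE BE B'E.
have box (a b A C : R) : 0 <= a <= A -> 0 <= b <= C -> 0 <= a * b <= A * C.
  by move=> /andP[a0 aA] /andP[b0 bC]; rewrite mulr_ge0 // ler_pM.
have nB (a M : R) : 0 <= a <= M -> `|a| <= M by move=> /andP[a0 aM]; rewrite ger0_norm.
have nM (a b M N : R) : `|a| <= M -> `|b| <= N -> `|a * b| <= M * N.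
  by move=> *; rewrite normrM ler_pM.
have lI : 0 <= lam <= 16 by rewrite l0.
have TI : 0 <= T <= 1 / 256 by rewrite T0.
have lT := box _ _ _ _ lI TI.
have p01 : 0 <= p <= 1 by rewrite pE; lra_from T0 T1.
have q01 : 0 <= q <= 1.
  by rewrite qE -mulrA; move: lT; set x := lam * T; clear; lra.
have [b1 b2] : `|B| <= 12 /\ `|B'| <= 4100.
  have pq := box _ _ _ _ p01 q01.
  have Tq := box _ _ _ _ TI q01.
  have lTp := box _ _ _ _ lT p01.
  have lp := box _ _ _ _ lI p01.
  rewrite BE B'E !ler_norml.
  have -> : 3 * p * q - 2048 * T * q + 16 * lam * T * p =
    3 * (p * q) - 2048 * (T * q) + 16 * (lam * T * p) by ring.
  have -> : 3 * (- 256 * q - 4 * lam * p) - 2048 * q + 8192 * lam * T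
    + 16 * lam * p - 4096 * lam * T = - 2816 * q + 4 * (lam * p) + 4096 * (lam * T).
    by ring.
  move: pq Tq lTp lp lT q01; clear.
  set a := p * q; set b := T * q; set c := lam * T * p; set d := lam * p.
  by set e := lam * T; lra.
have np := nB _ _ p01; have nq := nB _ _ q01.
split=> //.
have x1 : `|p * q * B| <= 1 * 1 * 12 by apply: (nM) => //; apply: (nM).
have x2 : `|q * B| <= 1 * 12 by apply: (nM).
have x3 : `|p * q * B'| <= 1 * 1 * 4100 by apply: (nM) => //; apply: (nM).
have x4 : `|lam * p * B| <= 16 * 1 * 12 by apply: (nM) => //; apply: (nM) => //; apply: (nB).
have x5 : `|T * ((- 256 * B + p * B') * q + 12 * lam * p * B)| <= 1 / 256 * 9500.
  apply: (nM); first exact: nB.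
  have -> : (- 256 * B + p * B') * q + 12 * lam * p * B =
    - 256 * (q * B) + p * q * B' + 12 * (lam * p * B) by ring.
  move: x2 x3 x4; rewrite !ler_norml; set a := q * B; set b := p * q * B'.
  by set c := lam * p * B; clear; lra.
have -> : 5 * p * B * q + 4 * T * ((- 256 * B + p * B') * q + 12 * lam * p * B) =
  5 * (p * q * B) + 4 * (T * ((- 256 * B + p * B') * q + 12 * lam * p * B)) by ring.
move: x1 x5; rewrite !ler_norml; set a := p * q * B; set b := T * _.
by clear; lra.
Qed.

(** For u <= r/4 the derivative of the phase is -r^4 q / (2u^3) with q >= 3/4,
    so each integration by parts gains a factor u^3/r^4. The weight vanishes
    to second order at r/4, which removes the boundary terms of both
    integrations at that end. *)
Lemma low_part_bound (r lam theta d : R) : 2 <= r -> 0 <= lam <= 16 ->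
  0 < d -> d <= r ^- 2 ->
  `|\int[mu]_(u in `[d, r / 4])
     ((1 - 256 * (u ^+ 4 / r ^+ 4)) ^+ 2 *
      cos (r ^+ 4 / (4 * u ^+ 2) + lam * u ^+ 2 + theta))| <= 1000 / r ^+ 3.
Proof.
move=> r2 /andP[lam0 lam16] d0 dr.
have r0 : 0 < r by lra.
have rn : r != 0 by rewrite gt_eqF.
have d14 : d <= 1 / 4.
  apply: (le_trans dr); rewrite div1r lef_pV2 ?posrE ?exprn_gt0 //; nra.
have dr4 : d <= r / 4 by lra.
pose T (u : R) : R := u ^+ 4 / r ^+ 4.
pose p (u : R) : R := 1 - 256 * T u.
pose q (u : R) : R := 1 - 4 * lam * T u.
pose B (u : R) : R := 3 * p u * q u - 2048 * T u * q u + 16 * lam * T u * p u.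
pose Psi (u : R) : R := r ^+ 4 / (4 * u ^+ 2) + lam * u ^+ 2 + theta.
(* E1 is the amplitude left after two integrations by parts, each one dividing
   by Psi' = - r^4 q / (2 u^3). *)
pose E1 (u : R) : R := 4 / r ^+ 8 * (u ^+ 5 * p u * B u / q u ^+ 3).
pose B' (u : R) : R := 3 * (- 256 * q u - 4 * lam * p u) - 2048 * q u + 8192 * lam * T u
   + 16 * lam * p u - 4096 * lam * T u.
pose X (u : R) : R := 5 * p u * B u * q u +
   4 * T u * ((- 256 * B u + p u * B' u) * q u + 12 * lam * p u * B u).
pose E1' (u : R) : R := 4 / r ^+ 8 * (u ^+ 4 * (X u / q u ^+ 4)).
pose W (u : R) : R := - (2 / r ^+ 4) * (u ^+ 3 * p u ^+ 2 / q u) * sin (Psi u) + E1 u * cos (Psi u).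
pose w (u : R) : R := p u ^+ 2 * cos (Psi u) + E1' u * cos (Psi u).
have Tb u : d <= u <= r / 4 -> 0 <= T u <= 1 / 256.
  move=> /andP[du ur]; have u0 : 0 <= u by exact: le_trans (ltW d0) du.
  rewrite divr_ge0 ?exprn_ge0 ?(ltW r0) //= ler_pdivrMr ?exprn_gt0 //.
  have -> : 1 / 256 * r ^+ 4 = (r / 4) ^+ 4 by field.
  by rewrite lerXn2r ?nnegrE // divr_ge0 // ltW.
have qb u : d <= u <= r / 4 -> 3 / 4 <= q u <= 1.
  move=> /Tb /andP[T0 T1]; rewrite /q.
  have : 4 * lam * T u <= 4 * 16 * (1 / 256).
    apply: ler_pM => //; first by rewrite mulr_ge0.
    by rewrite ler_wpM2l.
  have : 0 <= 4 * lam * T u by do 2 (apply: mulr_ge0 => //).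
  by set z := _ * T u; clear; lra.
have qn u : d <= u <= r / 4 -> q u != 0.
  by move=> /qb /andP[h _]; rewrite gt_eqF // (lt_le_trans _ h) // divr_gt0.
have un u : d <= u <= r / 4 -> u != 0.
  by move=> /andP[h _]; rewrite gt_eqF // (lt_le_trans d0).
have nz u : d <= u <= r / 4 -> r ^+ 4 - 4 * lam * u ^+ 4 != 0.
  move=> h; have -> : r ^+ 4 - 4 * lam * u ^+ 4 = q u * r ^+ 4.
    by rewrite /q /T; field.
  by rewrite mulf_neq0 ?qn ?expf_neq0.
have dT (u : R) : is_derive u 1 T (4 * u ^+ 3 / r ^+ 4).
  by rewrite /T; derive_to; rewrite /=; field.
have dp (u : R) : is_derive u 1 p (- 1024 * u ^+ 3 / r ^+ 4).
  by rewrite /p; derive_to; field.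
have dq (u : R) : is_derive u 1 q (- 16 * lam * u ^+ 3 / r ^+ 4).
  by rewrite /q; derive_to; field.
have dB (u : R) : is_derive u 1 B (B' u * (4 * u ^+ 3 / r ^+ 4)).
  rewrite /B; derive_to; rewrite /B' /p /q; field; exact: rn.
have dPsi (u : R) : d <= u <= r / 4 -> is_derive u 1 Psi (- r ^+ 4 / (2 * u ^+ 3) + 2 * lam * u).
  move=> /un u0; rewrite /Psi; derive_to; first by rewrite mulf_neq0 // expf_neq0.
  by field.
have cE1 (u : R) : d <= u <= r / 4 -> is_derive u 1 E1 (E1' u).
  move=> h; rewrite /E1; derive_to; first by rewrite expf_neq0 // qn.
  have q0 := qn _ h; have u0 := un _ h.
  by rewrite /E1' /X /T; field; rewrite rn q0.
have dW (u : R) : d <= u <= r / 4 -> is_derive u 1 W (w u).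
  move=> h; have h1 := cE1 _ h; have h2 := dPsi _ h.
  have q0 := qn _ h; have u0 := un _ h; have z0 := nz _ h.
  rewrite /W; derive_to => //.
  by rewrite /w /E1 /B /p /q /T; field; rewrite u0 rn.
pose g (u : R) : R := 2800 * u ^+ 4 / r ^+ 8.
pose G (u : R) : R := 560 * u ^+ 5 / r ^+ 8.
have dG (u : R) : is_derive u 1 G (g u).
  by rewrite /G; derive_to; rewrite /g; field.
have cw (u : R) : d <= u <= r / 4 -> {for u, continuous w}.
  move=> h; have h2 := dPsi _ h; have q0 := qn _ h; have u0 := un _ h.
  have dB' (v : R) : exists e, is_derive v 1 B' e.
    by eexists; rewrite /B'; der.
  have [e hB'] := dB' u.
  by rewrite /w /E1' /X; cont; rewrite expf_neq0.
have cf (u : R) : d <= u <= r / 4 -> {for u, continuous (fun u => p u ^+ 2 * cos (Psi u))}.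
  by move=> h; have h2 := dPsi _ h; cont.
have cg (u : R) : d <= u <= r / 4 -> {for u, continuous g} by move=> h; rewrite /g; cont.
have q4 (u : R) : d <= u <= r / 4 -> `|(q u)^-1| <= 4 / 3.
  move=> /qb /andP[q0 _]; rewrite ger0_norm ?invr_ge0; last by apply: le_trans q0; rewrite divr_ge0.
  have -> : 4 / 3 = (3 / 4)^-1 :> R by field.
  by rewrite lef_pV2 ?posrE // ?(lt_le_trans _ q0) // divr_gt0.
have key (u : R) : d <= u <= r / 4 -> `|p u ^+ 2 * cos (Psi u) - w u| <= g u.
  move=> h; have u0 : 0 <= u by move: h => /andP[h _]; exact: le_trans (ltW d0) h.
  have lb : 0 <= lam <= 16 by apply/andP.
  have [_ _ hX] := amplitude_bound lb (Tb u h) erefl erefl erefl erefl.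
  rewrite /w opprD addrA subrr add0r normrN normrM.
  apply: (@le_trans _ _ (`|E1' u| * 1)); first by rewrite ler_wpM2l // cos_max.
  rewrite mulr1 /E1' /g -/(p u) -/(q u).
  have -> : 4 / r ^+ 8 * (u ^+ 4 * (X u / q u ^+ 4)) =
    (4 * u ^+ 4 / r ^+ 8) * (X u * (q u)^-1 ^+ 4) by rewrite exprVn; field; rewrite rn qn.
  have -> : 2800 * u ^+ 4 / r ^+ 8 = (4 * u ^+ 4 / r ^+ 8) * 700 by field.
  rewrite normrM ger0_norm; last by rewrite divr_ge0 ?mulr_ge0 ?exprn_ge0 // ltW.
  apply: ler_wpM2l; first by rewrite divr_ge0 ?mulr_ge0 ?exprn_ge0 // ltW.
  rewrite normrM normrX; apply: (@le_trans _ _ (210 * (4 / 3) ^+ 4)).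
    by apply: ler_pM => //; rewrite lerXn2r ?nnegrE ?q4 // divr_ge0.
  by clear; rewrite !exprS expr0; lra.
have := Rintegral_comparison dr4 dW (fun x _ => dG x) cf cw cg key.
move=> /le_trans; apply.
have r3 : 0 < r ^+ 3 by rewrite exprn_gt0.
have G1 : G (r / 4) <= 1 / r ^+ 3.
  have -> : G (r / 4) = (560 / 1024) / r ^+ 3 by rewrite /G; field.
  by apply: ler_wpM2r; [rewrite invr_ge0 ltW|clear; lra].
have G0 : 0 <= G d.
  apply: divr_ge0; last by apply: exprn_ge0; exact: ltW.
  by apply: mulr_ge0; [rewrite ler0n|apply: exprn_ge0; exact: ltW].
have W1 : W (r / 4) = 0.
  have pz : p (r / 4) = 0 by rewrite /p /T; field.
  by rewrite /W /E1 pz expr0n /= !(mulr0, mul0r) addr0.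
have dd : d <= d <= r / 4 by rewrite lexx.
have lb : 0 <= lam <= 16 by apply/andP.
have [hp hB _] := amplitude_bound lb (Tb d dd) erefl erefl erefl erefl.
have d1 : d <= 1 by apply: (le_trans d14); clear; lra.
have dn k : d ^+ k <= 1 by rewrite exprn_ile1 // ltW.
have rk k : (r ^+ (3 + k))^-1 <= (r ^+ 3)^-1.
  rewrite lef_pV2 ?posrE ?exprn_gt0 // exprD ler_peMr ?(ltW r3) // exprn_ege1 //.
  by apply: le_trans r2; clear; lra.
have W2 : `|W d| <= 200 / r ^+ 3.
  rewrite /W; apply: (le_trans (ler_normD _ _)).
  have -> : 200 / r ^+ 3 = 3 / r ^+ 3 + 197 / r ^+ 3 by field.
  apply: lerD.
    rewrite normrM; apply: (@le_trans _ _ (`|- (2 / r ^+ 4) * (d ^+ 3 * p d ^+ 2 / q d)| * 1)).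
      by rewrite ler_wpM2l // sin_max.
    rewrite mulr1 mulNr normrN normrM ger0_norm ?divr_ge0 ?exprn_ge0 ?(ltW r0) //.
    rewrite (_ : 3 / r ^+ 3 = 2 / r ^+ 3 * (3 / 2)); last by field.
    apply: ler_pM => //; first by rewrite divr_ge0 ?exprn_ge0 ?(ltW r0).
      by rewrite ler_pM2l // (rk 1%N).
    rewrite normrM normrM (ger0_norm (exprn_ge0 3 (ltW d0))) normrX.
    apply: (@le_trans _ _ (1 * 1 * (4 / 3))); last by clear; lra.
    apply: ler_pM => //; [by rewrite mulr_ge0 ?exprn_ge0 ?(ltW d0)| |exact: q4].
    by apply: ler_pM; rewrite ?exprn_ge0 ?(ltW d0) ?dn // exprn_ile1.
  rewrite normrM; apply: (@le_trans _ _ (`|E1 d| * 1)); first by rewrite ler_wpM2l // cos_max.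
  rewrite mulr1 /E1 normrM ger0_norm ?divr_ge0 ?exprn_ge0 ?(ltW r0) //.
  rewrite (_ : 197 / r ^+ 3 = 4 / r ^+ 3 * (197 / 4)); last by field.
  apply: ler_pM => //; first by rewrite divr_ge0 ?exprn_ge0 ?(ltW r0).
    by rewrite ler_pM2l // (rk 5%N).
  have nM (a b M N : R) : `|a| <= M -> `|b| <= N -> `|a * b| <= M * N.
    by move=> *; rewrite normrM ler_pM.
  have x1 : `|d ^+ 5| <= 1 by rewrite ger0_norm ?dn // exprn_ge0 // ltW.
  have x2 : `|(q d)^-1 ^+ 3| <= (4 / 3) ^+ 3.
    rewrite normrX; apply: lerXn2r; [by rewrite nnegrE| |exact: q4].
    by rewrite nnegrE; apply: divr_ge0.
  rewrite -exprVn; apply: (le_trans ((nM) _ _ _ _ ((nM) _ _ _ _ ((nM) _ _ _ _ x1 hp) hB) x2)).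
  by clear; rewrite !exprS expr0; lra.
rewrite W1 sub0r normrN.
apply: (le_trans (lerD W2 (lerB G1 G0))).
rewrite subr0 -mulrDl; apply: ler_wpM2r; [by rewrite invr_ge0 ltW|clear; lra].
Qed.

End low_part.

(** * The resonant integral *)

Section resonance.
Variable R : realType.
Notation mu := (@lebesgue_measure R).

Lemma continuous_norm_for (f : R -> R) x : {for x, continuous f} ->
  {for x, continuous (fun y => `|f y|)}.
Proof. by move=> cf; apply: cvg_norm; exact: cf. Qed.

(** What is left of the u-integral after averaging over the cube: it peaks where
    2 u^2 meets the coordinate b of the lattice point. *)
Definition resonance (e b u : R) : R := u `^ (1 - 2 * e) / (1 + `|b - 2 * u ^+ 2|).

Lemma resonance_ge0 e b u : 0 <= resonance e b u.
Proof. by rewrite divr_ge0 ?powR_ge0 // addr_ge0. Qed.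

Lemma resonance_continuous e b u : 0 < u -> {for u, continuous (resonance e b)}.
Proof.
move=> u0; rewrite /resonance.
have c2 : {for u, continuous (fun u : R => 1 + `|b - 2 * u ^+ 2|)}.
  rewrite /prop_for /continuous_at; apply: cvgD; first exact: cvg_cst.
  by apply: (@continuous_norm_for (fun u : R => b - 2 * u ^+ 2)); cont.
rewrite /prop_for /continuous_at; apply: cvgM.
  have : {for u, continuous (fun u : R => u `^ (1 - 2 * e))} by cont.
  exact.
by apply: cvgV; [rewrite gt_eqF // ltr_pwDl|exact: c2].
Qed.

(** With M = 1 + |b - 2u^2| the left side is u (u^2)^(-e) / M; the smaller of
    u^2 and M replaces the other one, and each term has an elementary
    primitive. *)
Lemma resonance_le e b u : 0 < e -> 1 <= u ->
  resonance e b u <= u `^ (- 2 * e - 1) + u * (1 + `|b - 2 * u ^+ 2|) `^ (- e - 1).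
Proof.
move=> e0 u1; rewrite /resonance; set M := 1 + `|_|.
have u0 : 0 < u by exact: lt_le_trans u1.
have un : u != 0 by rewrite gt_eqF.
have M0 : 0 < M by rewrite /M ltr_pwDl.
have Mn : M != 0 by rewrite gt_eqF.
have uE (x : R) : u * u `^ x = u `^ (1 + x).
  by rewrite powRD ?un ?implybT // powRr1 // ltW.
have u2 : (u ^+ 2) `^ (- e) = u `^ (- 2 * e).
  by rewrite -powR_mulrn ?(ltW u0) // -powRrM; congr powR; ring.
have -> : u `^ (1 - 2 * e) = u * (u ^+ 2) `^ (- e).
  by rewrite u2 uE; congr powR; ring.
have [h|h] := leP M (u ^+ 2).
  rewrite -[leLHS]add0r; apply: lerD; first exact: powR_ge0.
  rewrite -mulrA ler_wpM2l ?(ltW u0) //.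
  rewrite powRD ?Mn ?implybT // powR_inv1 ?(ltW M0) // ler_wpM2r ?invr_ge0 ?(ltW M0) //.
  by rewrite !powRN lef_pV2 ?posrE ?powR_gt0 ?exprn_gt0 // ge0_ler_powR ?nnegrE ?(ltW e0) ?(ltW M0) ?exprn_ge0 ?(ltW u0).
rewrite -[leLHS]addr0; apply: lerD; last by rewrite mulr_ge0 ?powR_ge0 ?(ltW u0).
have -> : u `^ (- 2 * e - 1) = u * (u ^+ 2) `^ (- e) / u ^+ 2.
  rewrite u2 uE -powR_mulrn ?(ltW u0) // -powRN -powRD ?un ?implybT //.
  by congr powR; ring.
rewrite ler_wpM2l ?mulr_ge0 ?powR_ge0 ?(ltW u0) //.
by rewrite lef_pV2 ?posrE ?exprn_gt0 // ltW.
Qed.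

Lemma resonance_piece (e b a c sg : R) : 0 < e -> 1 <= a -> a <= c -> sg ^+ 2 = 1 ->
  (forall u, a <= u <= c -> 0 <= sg * (b - 2 * u ^+ 2)) ->
  `|\int[mu]_(u in `[a, c]) resonance e b u| <= e^-1.
Proof.
move=> e0 a1 ac sg2 hs.
have en : e != 0 by rewrite gt_eqF.
have sgn u : a <= u <= c -> `|b - 2 * u ^+ 2| = sg * (b - 2 * u ^+ 2).
  by move=> /hs h; rewrite -(ger0_norm h) normrM (norm_of_sqr1 sg2) mul1r.
have pos u : a <= u <= c -> 0 < u.
  by move=> /andP[au _]; rewrite (lt_le_trans _ au) // (lt_le_trans _ a1).
(* sg is the sign of b - 2 u^2 on the interval. *)
pose P (u : R) : R := 1 + sg * (b - 2 * u ^+ 2).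
have P1 u : a <= u <= c -> 1 <= P u by move=> h; rewrite /P lerDl hs.
have P0 u : a <= u <= c -> 0 < P u by move=> h; apply: lt_le_trans (P1 _ h).
pose G (u : R) : R := - (u `^ (- 2 * e)) / (2 * e) + sg * P u `^ (- e) / (4 * e).
pose g (u : R) : R := u `^ (- 2 * e - 1) + u * P u `^ (- e - 1).
have dG (u : R) : a <= u <= c -> is_derive u 1 G (g u).
  move=> h; have u0 := pos _ h; have p0 := P0 _ h.
  have dP : is_derive u 1 P (- 4 * sg * u) by rewrite /P; derive_to; ring.
  rewrite /G; derive_to => //; rewrite /g.
  transitivity (u `^ (- 2 * e - 1) + sg ^+ 2 * u * P u `^ (- e - 1)); last by rewrite sg2; ring.
  by field.
have cg (u : R) : a <= u <= c -> {for u, continuous g}.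
  move=> h; have u0 := pos _ h; have p0 := P0 _ h.
  have dP : is_derive u 1 P (- 4 * sg * u) by rewrite /P; derive_to; ring.
  by rewrite /g; cont.
have key (u : R) : a <= u <= c -> `|resonance e b u - (fun=> 0) u| <= g u.
  move=> h; rewrite subr0 ger0_norm ?resonance_ge0 //.
  have u1 : 1 <= u by move: h => /andP[/(le_trans a1)].
  by rewrite (le_trans (resonance_le _ e0 u1)) // /g /P sgn.
have cf (u : R) : a <= u <= c -> {for u, continuous (resonance e b)}.
  by move=> /pos h; exact: resonance_continuous.
have := @Rintegral_comparison _ _ (fun=> 0) g (fun=> 0) G a c ac
  (fun x _ => derivable_rule_cst 0 x) dG cf (fun x _ => @cst_continuous _ _ 0 x) cg key.
rewrite subrr normr0 add0r => /le_trans; apply.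
have pow1 (x y : R) : 1 <= x -> 0 <= y -> 0 <= x `^ (- y) <= 1.
  move=> x1 y0; rewrite powR_ge0 powRN invf_le1 ?powR_gt0 ?(lt_le_trans _ x1) //=.
  by rewrite -(powRr0 x) ler_powR.
have aI : a <= a <= c by rewrite lexx.
have cI : a <= c <= c by rewrite lexx ac.
have := pow1 a (2 * e) a1 (mulr_ge0 (ler0n _ 2) (ltW e0)).
have := pow1 c (2 * e) (le_trans a1 ac) (mulr_ge0 (ler0n _ 2) (ltW e0)).
have := pow1 _ e (P1 _ aI) (ltW e0); have := pow1 _ e (P1 _ cI) (ltW e0).
rewrite /G mulNr.
set x := P c `^ _; set y := P a `^ _; set z := c `^ _; set w := a `^ _ => hx hy hz hw.
have -> : - z / (2 * e) + sg * x / (4 * e) - (- w / (2 * e) + sg * y / (4 * e)) =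
  (2 * (w - z) + sg * (x - y)) / 4 / e by field.
rewrite -[leRHS]mul1r ler_wpM2r ?invr_ge0 ?(ltW e0) //.
have : `|sg * (x - y)| <= 1.
  rewrite normrM (norm_of_sqr1 sg2) mul1r ler_norml; lra_from hx hy.
move=> /(le_trans (ler_norm _)); move: hz hw; clear; lra.
Qed.

Lemma resonance_integral (e b N : R) : 0 < e -> 1 <= N ->
  `|\int[mu]_(u in `[1, N]) resonance e b u| <= 2 / e.
Proof.
(* The interval is cut where 2 u^2 crosses b. *)
move=> e0 N1; pose m := Num.min N (Num.max 1 (Num.sqrt (b / 2))).
have m1 : 1 <= m by rewrite le_min N1 le_max lexx.
have mN : m <= N by rewrite ge_min lexx.
rewrite (@Rintegral_split _ _ 1 m N) //; last first.
  by move=> x /andP[x1 _]; apply: resonance_continuous; apply: lt_le_trans x1.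
apply: (le_trans (ler_normD _ _)).
have -> : 2 / e = e^-1 + e^-1 by field; rewrite gt_eqF.
apply: lerD.
  have [m1'|m1'] := eqVneq m 1.
    by rewrite m1' set_itv1 Rintegral_set1 normr0 invr_ge0 ltW.
  apply: (@resonance_piece e b 1 m 1) => //; first by rewrite expr1n.
  move=> u /andP[u1 um]; rewrite mul1r subr_ge0 -ler_pdivlMl // mulrC.
  have mb : m <= Num.sqrt (b / 2).
    move: m1'; rewrite /m; have [h|h] := leP 1 (Num.sqrt (b / 2)).
      by rewrite ge_min lexx orbT.
    by rewrite (min_idPr N1) eqxx.
  have b0 : 0 <= b / 2.
    by rewrite leNgt; apply/negP => /ltW /ler0_sqrtr bz; move: (le_trans m1 mb); rewrite bz ler10.
  rewrite -(sqr_sqrtr b0) lerXn2r ?nnegrE ?sqrtr_ge0 ?(le_trans um) //.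
  exact: le_trans u1.
have [mN'|mN'] := eqVneq m N.
  by rewrite mN' set_itv1 Rintegral_set1 normr0 invr_ge0 ltW.
apply: (@resonance_piece e b m N (-1)) => //; first by rewrite sqrrN expr1n.
move=> u /andP[mu' _]; rewrite mulN1r opprB subr_ge0 -ler_pdivrMl // mulrC.
have mb : Num.sqrt (b / 2) <= m.
  move: mN'; rewrite /m; have [h|h] := leP N (Num.max 1 (Num.sqrt (b / 2))).
    by rewrite eqxx.
  by rewrite le_max lexx orbT.
have [b0|b0] := leP 0 (b / 2); last by rewrite (le_trans (ltW b0)) // sqr_ge0.
rewrite -(sqr_sqrtr b0) lerXn2r ?nnegrE ?sqrtr_ge0 ?(le_trans mb) //.
by rewrite (le_trans _ mu') // (le_trans _ m1).
Qed.

End resonance.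

(** * Finite sums and integrals over products *)

Section finite_sums.
Variable R : realType.

Lemma Rintegrable_sum d (T : measurableType d) (m : {measure set T -> \bar R}) (D : set T)
    (I : Type) (X : seq I) (f : I -> T -> R) : measurable D ->
  (forall i, m.-integrable D (EFin \o f i)) ->
  m.-integrable D (EFin \o (fun z => \sum_(i <- X) f i z)).
Proof.
move=> mD fi; have := integrable_sum mD X (fun i (_ : true) => fi i); apply: eq_integrable => // z _.
by rewrite /= sumEFin.
Qed.

Lemma Rintegral_sum d (T : measurableType d) (m : {measure set T -> \bar R}) (D : set T)
    (I : Type) (X : seq I) (f : I -> T -> R) : measurable D ->
  (forall i, m.-integrable D (EFin \o f i)) ->
  \int[m]_(z in D) (\sum_(i <- X) f i z) = \sum_(i <- X) \int[m]_(z in D) f i z.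
Proof.
move=> mD fi; elim: X => [|i X IH].
  rewrite big_nil; under eq_Rintegral do rewrite big_nil.
  by rewrite Rintegral_cst // mul0r.
rewrite big_cons -IH -RintegralD //; last exact: Rintegrable_sum.
by apply: eq_Rintegral => z _; rewrite big_cons.
Qed.

Lemma cvg_sum_seq (I : Type) (X : seq I) (f : I -> nat -> R) (l : I -> R) :
  (forall i, f i n @[n --> \oo] --> l i) ->
  (\sum_(i <- X) f i n) @[n --> \oo] --> \sum_(i <- X) l i.
Proof.
by move=> h; apply: cvg_big => // ; exact: add_continuous.
Qed.

Lemma sqr_sum (I : Type) (X : seq I) (f : I -> R) :
  (\sum_(i <- X) f i) ^+ 2 = \sum_(i <- X) \sum_(j <- X) f i * f j.
Proof. by rewrite expr2 mulr_suml; apply: eq_bigr => i _; rewrite mulr_sumr. Qed.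

Lemma odd_exp_sum_le (y : R) n : 0 <= y ->
  \sum_(0 <= j < n) y ^+ j.*2.+1 / j.*2.+1`!%:R <= expR y.
Proof.
move=> y0; apply: (@le_trans _ _ (series (exp_coeff y) n.*2)).
  elim: n => [|n IH]; first by rewrite /series /= !big_geq.
  rewrite doubleS /series /= !big_nat_recr //= -addrA; apply: lerD; first exact: IH.
  by rewrite lerDr /exp_coeff /= divr_ge0 // exprn_ge0.
rewrite /expR; apply: nondecreasing_cvgn_le; last exact: is_cvg_series_exp_coeff.
apply: nondecreasing_series => i _ _; rewrite /exp_coeff /= divr_ge0 // exprn_ge0 //.
Qed.

End finite_sums.

Lemma bounded_set_of_le (R : realType) T (D : set T) (h : T -> R) M :
  (forall x, D x -> `|h x| <= M) -> [bounded h x | x in D].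
Proof.
move=> hM; exists M; split; first exact: num_real.
by move=> N MN x /= Dx; rewrite (le_trans (hM _ Dx)) // ltW.
Qed.

Section product_integrals.
Context d1 d2 (T1 : measurableType d1) (T2 : measurableType d2) (R : realType).
Variables (m1 : {sigma_finite_measure set T1 -> \bar R})
  (m2 : {sigma_finite_measure set T2 -> \bar R}).
Variables (A : set T1) (B : set T2).
Hypotheses (mA : measurable A) (mB : measurable B).
Implicit Types f : T1 * T2 -> R.

Let mAB : measurable (A `*` B). Proof. exact: measurableX. Qed.

Let patchl f x : x \in A ->
  (fun y => ((EFin \o f) \_ (A `*` B)) (x, y)) = (fun y => (f (x, y))%:E) \_ B.
Proof.
move=> xA; apply/funext => y; rewrite !patchE.
suff -> : ((x, y) \in A `*` B) = (y \in B) by [].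
by rewrite in_setX xA.
Qed.

Let patchr f y : y \in B ->
  (fun x => ((EFin \o f) \_ (A `*` B)) (x, y)) = (fun x => (f (x, y))%:E) \_ A.
Proof.
move=> yB; apply/funext => x; rewrite !patchE.
suff -> : ((x, y) \in A `*` B) = (x \in A) by [].
by rewrite in_setX yB andbT.
Qed.

Lemma Rintegral_prod12 f :
  (m1 \x m2)%E.-integrable (A `*` B) (EFin \o f) ->
  (forall x, A x -> m2.-integrable B (fun y => (f (x, y))%:E)) ->
  \int[(m1 \x m2)%E]_(z in A `*` B) f z =
  \int[m1]_(x in A) \int[m2]_(y in B) f (x, y).
Proof.
move=> /integrable_mkcond -/(_ mAB) fi fx; rewrite /Rintegral integral_mkcond.
rewrite -integral12_prod_meas1 // [in RHS]integral_mkcond; congr fine.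
apply: eq_integral => x _; rewrite /fubini_F patchE; case: ifPn => xA.
  rewrite patchl // -integral_mkcond fineK //.
  by apply: integrable_fin_num => //; apply: fx; rewrite inE in xA.
by apply: integral0_eq => y _; rewrite patchE in_setX (negbTE xA).
Qed.

Lemma Rintegral_prod21 f :
  (m1 \x m2)%E.-integrable (A `*` B) (EFin \o f) ->
  (forall y, B y -> m1.-integrable A (fun x => (f (x, y))%:E)) ->
  \int[(m1 \x m2)%E]_(z in A `*` B) f z =
  \int[m2]_(y in B) \int[m1]_(x in A) f (x, y).
Proof.
move=> /integrable_mkcond -/(_ mAB) fi fx; rewrite /Rintegral integral_mkcond.
rewrite -integral21_prod_meas1 // [in RHS]integral_mkcond; congr fine.
apply: eq_integral => y _; rewrite /fubini_G patchE; case: ifPn => yB.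
  rewrite patchr // -integral_mkcond fineK //.
  by apply: integrable_fin_num => //; apply: fx; rewrite inE in yB.
by apply: integral0_eq => x _; rewrite patchE in_setX (negbTE yB) andbF.
Qed.

Lemma integrable_prod_mul (f : T1 -> R) (g : T2 -> R) :
  m1.-integrable A (EFin \o f) -> m2.-integrable B (EFin \o g) ->
  (m1 \x m2)%E.-integrable (A `*` B) (fun z => (f z.1 * g z.2)%:E).
Proof.
move=> fi gi.
have /integrable_mkcond -/(_ mA) fi' := fi.
have /integrable_mkcond -/(_ mB) gi' := gi.
apply/(integrable_mkcond _ mAB).
rewrite (_ : _ \_ _ = (fun z => (EFin \o f) \_ A z.1 * (EFin \o g) \_ B z.2)%E); last first.
  apply/funext => -[x y]; rewrite !patchE in_setX /=.
  by case: (x \in A); case: (y \in B); rewrite ?mule0 ?mul0e ?EFinM.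
set F := _ \_ A; set G := _ \_ B.
have mF : measurable_fun setT F by case/integrableP: fi'.
have mG : measurable_fun setT G by case/integrableP: gi'.
apply/integrable12ltyP.
  by apply: emeasurable_funM; apply: measurableT_comp.
have -> : (fun x => \int[m2]_y `|F (x, y).1 * G (x, y).2|)%E =
  (fun x => `|F x| * \int[m2]_y `|G y|)%E.
  apply/funext => x; rewrite -ge0_integralZl //.
  - by apply: eq_integral => y _; rewrite abseM.
  - exact: measurableT_comp.
have /integrableP[_ Foo] := fi'; have /integrableP[_ Goo] := gi'.
rewrite ge0_integralZr //; [|exact: measurableT_comp|exact: integral_ge0].
by rewrite lte_mul_pinfty // ?integral_ge0 // ge0_fin_numE ?integral_ge0.
Qed.

Lemma Rintegral_prod_mul (f : T1 -> R) (g : T2 -> R) :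
  m1.-integrable A (EFin \o f) -> m2.-integrable B (EFin \o g) ->
  \int[(m1 \x m2)%E]_(z in A `*` B) (f z.1 * g z.2) =
  (\int[m1]_(x in A) f x) * \int[m2]_(y in B) g y.
Proof.
move=> fi gi; rewrite Rintegral_prod12.
- rewrite -RintegralZr //; apply: eq_Rintegral => x _.
  by rewrite /= RintegralZl.
- exact: integrable_prod_mul.
- by move=> x _ /=; have := integrableZl mB (f x) gi.
Qed.

Lemma bounded_prod_integrable f M : (m1 A < +oo)%E -> (m2 B < +oo)%E ->
  measurable_fun setT f -> (forall x y, A x -> B y -> `|f (x, y)| <= M) ->
  [/\ (m1 \x m2)%E.-integrable (A `*` B) (EFin \o f),
      forall x, A x -> m2.-integrable B (fun y => (f (x, y))%:E) &
      forall y, B y -> m1.-integrable A (fun x => (f (x, y))%:E)].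
Proof.
move=> Aoo Boo mf fM; split.
- apply: measurable_bounded_integrable => //.
  + by rewrite [X in (X < _)%E]product_measure1E // lte_mul_pinfty // ge0_fin_numE.
  + exact: measurable_funTS.
  + by apply: (@bounded_set_of_le _ _ _ _ M) => -[x y] [/= Ax By]; exact: fM.
- move=> x Ax; have := @measurable_bounded_integrable _ _ _ m2 (fun y => f (x, y)) B mB Boo.
  apply; last by apply: (@bounded_set_of_le _ _ _ _ M) => y By; exact: fM.
  by apply: measurable_funTS; apply: (measurableT_comp mf); exact: measurable_pair1.
- move=> y By; have := @measurable_bounded_integrable _ _ _ m1 (fun x => f (x, y)) A mA Aoo.
  apply; last by apply: (@bounded_set_of_le _ _ _ _ M) => x Ax; exact: fM.
  by apply: measurable_funTS; apply: (measurableT_comp mf); exact: measurable_pair2.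
Qed.

Lemma Rintegral_swap f M : (m1 A < +oo)%E -> (m2 B < +oo)%E ->
  measurable_fun setT f -> (forall x y, A x -> B y -> `|f (x, y)| <= M) ->
  \int[m1]_(x in A) \int[m2]_(y in B) f (x, y) =
  \int[m2]_(y in B) \int[m1]_(x in A) f (x, y).
Proof.
move=> Aoo Boo mf fM; have [fi f1 f2] := bounded_prod_integrable Aoo Boo mf fM.
by rewrite -Rintegral_prod12 // Rintegral_prod21.
Qed.

Lemma integrable_slice_integral f M : (m1 A < +oo)%E -> (m2 B < +oo)%E ->
  measurable_fun setT f -> (forall x y, A x -> B y -> `|f (x, y)| <= M) ->
  m1.-integrable A (fun x => (\int[m2]_(y in B) f (x, y))%:E).
Proof.
move=> Aoo Boo mf fM; have [fi f1 f2] := bounded_prod_integrable Aoo Boo mf fM.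
move: fi => /integrable_mkcond -/(_ mAB) fi.
apply/(integrable_mkcond _ mA).
apply: eq_integrable (integrable_fubini_F fi) => // x _.
rewrite /fubini_F patchE; case: ifPn => xA.
  rewrite patchl // -integral_mkcond /Rintegral fineK //.
  by apply: integrable_fin_num => //; apply: f1; rewrite inE in xA.
by apply: integral0_eq => y _; rewrite patchE in_setX (negbTE xA).
Qed.

End product_integrals.

(** * Averages over the frequency cube *)

Section amplitude.
Variable R : realType.

Lemma bounded_integrable d (T : measurableType d) (m : {measure set T -> \bar R})
    (D : set T) (h : T -> R) M : measurable D -> (m D < +oo)%E ->
  measurable_fun setT h -> (forall x, D x -> `|h x| <= M) ->
  m.-integrable D (EFin \o h).
Proof.
move=> mD Doo mh hM; apply: measurable_bounded_integrable => //.
  exact: measurable_funTS.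
exact: bounded_set_of_le hM.
Qed.

Lemma measurable_cos_comp d (T : measurableType d) (f : T -> R) :
  measurable_fun setT f -> measurable_fun setT (fun x => cos (f x)).
Proof.
move=> mf; apply: measurableT_comp => //.
by apply: continuous_measurable_fun; exact: continuous_cos.
Qed.

Lemma measurable_sin_comp d (T : measurableType d) (f : T -> R) :
  measurable_fun setT f -> measurable_fun setT (fun x => sin (f x)).
Proof.
move=> mf; apply: measurableT_comp => //.
by apply: continuous_measurable_fun; exact: continuous_sin.
Qed.

(** The squared modulus of the integral of e^(i psi): unlike the integrals of
    cos and sin, it is multiplicative over products. *)
Definition amplitude d (T : measurableType d) (m : {measure set T -> \bar R})
    (D : set T) (psi : T -> R) : R :=
  (\int[m]_(x in D) cos (psi x)) ^+ 2 + (\int[m]_(x in D) sin (psi x)) ^+ 2.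

Lemma amplitude_ge0 d (T : measurableType d) (m : {measure set T -> \bar R}) D psi :
  0 <= @amplitude d T m D psi.
Proof. by rewrite addr_ge0 ?sqr_ge0. Qed.

Lemma amplitude_prod d1 d2 (T1 : measurableType d1) (T2 : measurableType d2)
    (m1 : {sigma_finite_measure set T1 -> \bar R})
    (m2 : {sigma_finite_measure set T2 -> \bar R}) (A : set T1) (B : set T2)
    (psi1 : T1 -> R) (psi2 : T2 -> R) :
  measurable A -> measurable B -> (m1 A < +oo)%E -> (m2 B < +oo)%E ->
  measurable_fun setT psi1 -> measurable_fun setT psi2 ->
  amplitude (m1 \x m2)%E (A `*` B) (fun z => psi1 z.1 + psi2 z.2) =
  amplitude m1 A psi1 * amplitude m2 B psi2.
Proof.
move=> mA mB Aoo Boo mp1 mp2.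
have c1 := bounded_integrable mA Aoo (measurable_cos_comp mp1) (fun x _ => cos_max _).
have s1 := bounded_integrable mA Aoo (measurable_sin_comp mp1) (fun x _ => sin_max _).
have c2 := bounded_integrable mB Boo (measurable_cos_comp mp2) (fun x _ => cos_max _).
have s2 := bounded_integrable mB Boo (measurable_sin_comp mp2) (fun x _ => sin_max _).
have mAB : measurable (A `*` B) by exact: measurableX.
rewrite /amplitude.
under eq_Rintegral do rewrite cosD.
under [X in _ + X ^+ 2]eq_Rintegral do rewrite sinD.
rewrite RintegralB //; last 2 first.
- exact: (integrable_prod_mul mA mB c1 c2).
- exact: (integrable_prod_mul mA mB s1 s2).
rewrite RintegralD //; last 2 first.
- exact: (integrable_prod_mul mA mB s1 c2).
- exact: (integrable_prod_mul mA mB c1 s2).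
rewrite (Rintegral_prod_mul mA mB c1 c2) (Rintegral_prod_mul mA mB s1 s2).
rewrite (Rintegral_prod_mul mA mB s1 c2) (Rintegral_prod_mul mA mB c1 s2).
ring.
Qed.

End amplitude.

Section cube.
Variable R : realType.
Notation mu := (@lebesgue_measure R).
Notation RR := (measurableTypeR R).
Notation R4 := (RR * RR * (RR * RR))%type.

Let I : set RR := `[- pi, pi]%classic.

Lemma segment_pi_lt_oo : (mu I < +oo)%E.
Proof. by rewrite /I lebesgue_measure_itv /=; case: ifP => _; rewrite -?EFinB ltry. Qed.

Lemma square_pi_lt_oo : (lebesgue2 (I `*` I) < +oo)%E.
Proof.
have mI : measurable I by exact: measurable_itv.
rewrite [X in (X < _)%E]product_measure1E //.
apply: lte_mul_pinfty => //; last exact: segment_pi_lt_oo.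
by rewrite ge0_fin_numE // segment_pi_lt_oo.
Qed.

Lemma freq_cubeE : @freq_cube R = (I `*` I) `*` (I `*` I).
Proof.
apply/seteqP; split => xi /=.
  move=> h; have h0 := h (@Ordinal 4 0 erefl); have h1 := h (@Ordinal 4 1 erefl).
  have h2 := h (@Ordinal 4 2 erefl); have h3 := h (@Ordinal 4 3 erefl).
  by split; split; rewrite /I /= in_itv /=; [exact: h0|exact: h1|exact: h2|exact: h3].
rewrite /I /= => -[[h0 h1] [h2 h3]]; rewrite !in_itv /= in h0 h1 h2 h3.
by case=> -[|[|[|[|//]]]] j4; rewrite /freq_coord /tnth /=.
Qed.

Lemma freq_cube_lt_oo : (lebesgue4 (@freq_cube R) < +oo)%E.
Proof.
have mI : measurable I by exact: measurable_itv.
have mII : measurable (I `*` I) by exact: measurableX.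
rewrite freq_cubeE [X in (X < _)%E]product_measure1E //.
apply: lte_mul_pinfty => //; last exact: square_pi_lt_oo.
by rewrite ge0_fin_numE // square_pi_lt_oo.
Qed.

Lemma amplitude_cube (psi : 'I_4 -> R -> R) : (forall j, measurable_fun setT (psi j)) ->
  amplitude lebesgue4 (@freq_cube R) (fun xi => \sum_(j < 4) psi j (freq_coord xi j)) =
  \prod_(j < 4) amplitude mu I (psi j).
Proof.
move=> mpsi.
pose j0 := @Ordinal 4 0 erefl; pose j1 := @Ordinal 4 1 erefl.
pose j2 := @Ordinal 4 2 erefl; pose j3 := @Ordinal 4 3 erefl.
have sumE (F : 'I_4 -> R) : \sum_(j < 4) F j = (F j0 + F j1) + (F j2 + F j3).
  rewrite !big_ord_recr big_ord0 /= add0r -!addrA.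
  by congr (F _ + (F _ + (F _ + F _))); apply: val_inj.
have prodE (F : 'I_4 -> R) : \prod_(j < 4) F j = (F j0 * F j1) * (F j2 * F j3).
  rewrite !big_ord_recr big_ord0 /= mul1r -!mulrA.
  by congr (F _ * (F _ * (F _ * F _))); apply: val_inj.
have mI : measurable I by exact: measurable_itv.
have mII : measurable (I `*` I) by exact: measurableX.
have m2 a b : measurable_fun setT (fun z : RR * RR => psi a z.1 + psi b z.2).
  apply: measurable_funD; (apply: measurableT_comp; first exact: mpsi).
    exact: measurable_fst.
  exact: measurable_snd.
rewrite prodE.
rewrite -(amplitude_prod mI mI segment_pi_lt_oo segment_pi_lt_oo (mpsi j0) (mpsi j1)).
rewrite -(amplitude_prod mI mI segment_pi_lt_oo segment_pi_lt_oo (mpsi j2) (mpsi j3)).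
rewrite freq_cubeE.
rewrite -(@amplitude_prod _ _ _ _ _ (@lebesgue2 R) (@lebesgue2 R) _ _ _ _ mII mII
  square_pi_lt_oo square_pi_lt_oo (m2 j0 j1) (m2 j2 j3)).
congr amplitude; apply/funext => xi; rewrite sumE.
by rewrite /freq_coord !(tnth_nth 0).
Qed.

End cube.

Section cube_oscillation.
Variable R : realType.
Notation mu := (@lebesgue_measure R).
Notation RR := (measurableTypeR R).
Notation R4 := (RR * RR * (RR * RR))%type.

Lemma omega_sqr (xi : R4) : omega xi ^+ 2 = \sum_(j < 4) (2 - 2 * cos (freq_coord xi j)).
Proof.
rewrite sqr_sqrtr //; apply: sumr_ge0 => j _.
have := cos_le1 (freq_coord xi j); lra.
Qed.

Lemma omega_ge0 (xi : R4) : 0 <= omega xi. Proof. exact: sqrtr_ge0. Qed.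

Lemma omega_sqr_le (xi : R4) : omega xi ^+ 2 <= 16.
Proof.
rewrite omega_sqr; apply: (@le_trans _ _ (\sum_(j < 4) 4)).
  by apply: ler_sum => j _; have := cos_geN1 (freq_coord xi j); lra.
by rewrite sumr_const card_ord -mulr_natr; clear; lra.
Qed.

Lemma measurable_omega_sqr : measurable_fun setT (fun xi : R4 => omega xi ^+ 2).
Proof. by apply: measurable_funX; exact: measurable_omega. Qed.

Definition bessel_const : R := (4 + 28 * pi) ^+ 4.

Lemma bessel_const_gt0 : 0 < bessel_const.
Proof. by rewrite exprn_gt0 // ltr_pwDl // mulr_ge0 // pi_ge0. Qed.

(** The integral of sin is that of cos with beta shifted by pi/2, so both parts
    are covered by [oscillation_fourth_power]. *)
Lemma amplitude_bessel (nu s beta : R) : 1 <= s ->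
  amplitude mu `[- pi, pi] (fun y => beta + nu * y - 2 * s * cos y) ^+ 2 <=
  8 * bessel_const / (s * (1 + `| `|nu| - 2 * s|)).
Proof.
move=> s1; rewrite /amplitude.
have s0 : 0 < s by lra.
have b1 := oscillation_fourth_power nu beta s1.
have b2 := oscillation_fourth_power nu (beta - pi / 2) s1.
have e : \int[mu]_(y in `[- pi, pi]) sin (beta + nu * y - 2 * s * cos y) =
  \int[mu]_(y in `[- pi, pi]) cos (beta - pi / 2 + nu * y - 2 * s * cos y).
  apply: eq_Rintegral => y _; rewrite -cosBpihalf; congr cos; ring.
rewrite e; move: b1 b2; rewrite -/bessel_const; set C := Rintegral _ _ _; set S := Rintegral _ _ _.
set a := `| _ - _ |; set M := Num.max 1 a.
have a0 : 0 <= a by exact: normr_ge0.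
have M0 : 0 < M by rewrite lt_max ltr01.
have aM : 1 + a <= 2 * M.
  have : 1 <= M by rewrite le_max lexx.
  have : a <= M by rewrite le_max lexx orbT.
  by clear; lra.
have K0 := bessel_const_gt0.
move=> b1 b2.
have h : bessel_const / (s * M) <= 2 * bessel_const / (s * (1 + a)).
  rewrite ler_pdivrMr ?mulr_gt0 // mulrAC ler_pdivlMr; last by rewrite mulr_gt0 // ltr_pwDl.
  rewrite [leRHS](_ : _ = bessel_const * (s * (2 * M))); last by ring.
  by rewrite ler_pM2l // ler_pM2l.
have -> : 8 * bessel_const / (s * (1 + a)) = 4 * (2 * bessel_const / (s * (1 + a))).
  by field; rewrite !gt_eqF // ltr_pwDl.
move: h b1 b2; set X := bessel_const / _; set Y := 2 * _ / _.
have n4 (z : R) : `|z| ^+ 4 = (z ^+ 2) ^+ 2 by rewrite (exprM _ 2 2) real_normK ?num_real.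
rewrite !n4; clear => h b1 b2.
have := sqr_ge0 (C ^+ 2 - S ^+ 2); rewrite sqrrB sqrrD; lra.
Qed.

(** The phase is a sum of functions of one coordinate each, so the amplitude is
    a product of four factors. The arithmetic-geometric mean inequality
    separates the coordinates of x. *)
Lemma cube_oscillation (x : lattice) (s beta : R) : 1 <= s ->
  `|\int[lebesgue4]_(xi in @freq_cube R) cos (beta + phase x xi + s * omega xi ^+ 2)| <=
  \sum_(j < 4) (2 * bessel_const / (s * (1 + `| `|(x ord0 j)%:~R| - 2 * s|))).
Proof.
move=> s1.
(* The constant beta + 8 s is attached to one of the coordinates. *)
pose psi (j : 'I_4) (y : R) : R := (if j == ord0 then beta + 8 * s else 0) +
  (x ord0 j)%:~R * y - 2 * s * cos y.
have mpsi j : measurable_fun setT (psi j : RR -> RR).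
  apply: measurable_funB; first by apply: measurable_funD => //; exact: measurable_funM.
  by apply: measurable_funM => //; exact: measurable_cos_comp.
have E xi : beta + phase x xi + s * omega xi ^+ 2 =
    \sum_(j < 4) psi j (freq_coord xi j).
  rewrite omega_sqr /phase !big_ord_recl !big_ord0 /psi /=; ring.
have := amplitude_cube mpsi.
have ab j := amplitude_bessel (x ord0 j)%:~R (if j == ord0 then beta + 8 * s else 0) s1.
set A := amplitude _ _ _ => AE.
have CA : (\int[lebesgue4]_(xi in @freq_cube R) cos (beta + phase x xi + s * omega xi ^+ 2)) ^+ 2 <= A.
  rewrite /A /amplitude; under eq_Rintegral do rewrite E.
  by rewrite lerDl sqr_ge0.
move: CA; set C := Rintegral _ _ _ => CA.
pose a j := amplitude mu `[- pi, pi]%classic (psi j).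
have a0 j : 0 <= a j by exact: amplitude_ge0.
have {}AE : A = \prod_(j < 4) a j by [].
apply: (@le_trans _ _ (\sum_(j < 4) (a j ^+ 2 / 4))); last first.
  apply: ler_sum => j _; have := ab j; rewrite -/(a j) => h.
  rewrite ler_pdivrMr //; apply: (le_trans h).
  rewrite le_eqVlt; apply/orP; left; apply/eqP; field.
  by rewrite !gt_eqF // ?ltr_pwDl //; lra.
rewrite -(@ler_pXn2r _ 2) ?nnegrE //; last by apply: sumr_ge0 => j _; rewrite divr_ge0 // sqr_ge0.
rewrite real_normK ?num_real // (le_trans CA) // AE !big_ord_recl !big_ord0.
set a1 := a _; set a2 := a _; set a3 := a _; set a4 := a _.
have h (p q : R) : 0 <= p -> 0 <= q -> p * q <= ((p + q) / 2) ^+ 2.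
  by move=> p0 q0; have := sqr_ge0 (p - q); rewrite sqrrB expr_div_n sqrrD; lra.
rewrite mulr1 addr0 mulrA.
have h12 : 0 <= a1 * a2 by apply: mulr_ge0; exact: a0.
have h34 : 0 <= a3 * a4 by apply: mulr_ge0; exact: a0.
apply: (le_trans (h _ _ h12 h34)).
rewrite lerXn2r ?nnegrE //.
- by rewrite divr_ge0 // addr_ge0.
- by rewrite !addr_ge0 // divr_ge0 // sqr_ge0.
- have := sqr_ge0 (a1 - a2); have := sqr_ge0 (a3 - a4); rewrite !sqrrB; clear; lra.
Qed.

Lemma Rintegral_cos_multiple (n : int) (beta : R) : n != 0 ->
  \int[mu]_(y in `[- pi, pi]) cos (beta + n%:~R * y) = 0.
Proof.
move=> n0; have n0' : n%:~R != 0 :> R by rewrite intr_eq0.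
have pi0 := @pi_gt0 R.
rewrite (_ : Rintegral _ _ _ = sin (beta + n%:~R * pi) / n%:~R -
   sin (beta + n%:~R * - pi) / n%:~R); last first.
  apply: (@Rintegral_primitive _ _ (fun y => sin (beta + n%:~R * y) / n%:~R)); first by lra.
    by move=> y _; derive_to; field.
  by move=> y _; cont.
have per (m : nat) (z : R) : sin (z + pi *+ 2 *+ m) = sin z.
  by elim: m z => [|m ih] z; rewrite ?addr0 // mulrSr addrA sinD2pi ih.
suff -> : sin (beta + n%:~R * pi) = sin (beta + n%:~R * - pi) by rewrite subrr.
case: n n0 n0' => m _ _.
  have <- := per m (beta + (Posz m)%:~R * - pi).
  by congr sin; rewrite -mulr_natr -(mulr_natr pi) -[(Posz m)%:~R]/(m%:R : R); ring.
have <- := per m.+1 (beta + (Negz m)%:~R * pi).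
by congr sin; rewrite NegzE mulrNz -mulr_natr -(mulr_natr pi) -[(Posz m.+1)%:~R]/(m.+1%:R : R); ring.
Qed.

Lemma amplitude_linear (n : int) : n != 0 ->
  amplitude mu `[- pi, pi] (fun y => n%:~R * y) = 0.
Proof.
move=> n0; rewrite /amplitude.
have -> : \int[mu]_(y in `[- pi, pi]) cos (n%:~R * y) = 0.
  rewrite -(Rintegral_cos_multiple 0 n0); apply: eq_Rintegral => y _.
  by rewrite add0r.
have -> : \int[mu]_(y in `[- pi, pi]) sin (n%:~R * y) = 0.
  rewrite -(Rintegral_cos_multiple (- (pi / 2)) n0); apply: eq_Rintegral => y _.
  by rewrite addrC cosBpihalf.
by rewrite expr0n /= addr0.
Qed.

(** A nonzero coordinate of x contributes an integral over full periods. *)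
Lemma cube_orthogonality (x : lattice) : x != 0 ->
  \int[lebesgue4]_(xi in @freq_cube R) cos (phase x xi) = 0.
Proof.
move=> x0.
have [j xj] : exists j, x ord0 j != 0.
  apply/existsP; apply: contraNT x0 => /existsPn h; apply/eqP/matrixP => i j.
  by rewrite mxE ord1; have := h j; rewrite negbK => /eqP.
pose psi (j : 'I_4) (y : R) : R := (x ord0 j)%:~R * y.
have mpsi i : measurable_fun setT (psi i : RR -> RR) by exact: measurable_funM.
have := amplitude_cube mpsi; rewrite (bigD1 j) //= amplitude_linear // mul0r.
rewrite /amplitude => /eqP; rewrite paddr_eq0 ?sqr_ge0 // => /andP[+ _].
by rewrite expf_eq0 => /andP[_ /eqP].
Qed.

Lemma cube_volume : fine (lebesgue4 (@freq_cube R)) = (2 * pi) ^+ 4.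
Proof.
pose I : set RR := `[- pi, pi]%classic.
have mI : measurable I by exact: measurable_itv.
have mII : measurable (I `*` I) by exact: measurableX.
have pi0 := @pi_gt0 R.
have E1 : mu I = (2 * pi)%:E.
  rewrite lebesgue_measure_itv /= lte_fin ifT; last by lra.
  by rewrite -EFinB; congr EFin; ring.
have E2 : lebesgue2 (I `*` I) = ((2 * pi) * (2 * pi))%:E.
  rewrite [LHS]product_measure1E // EFinM.
  transitivity (mu I * mu I)%E; first by [].
  by rewrite E1.
rewrite freq_cubeE (_ : lebesgue4 _ = ((2 * pi) * (2 * pi) * ((2 * pi) * (2 * pi)))%:E).
  by rewrite /=; ring.
rewrite [LHS]product_measure1E // EFinM.
transitivity (lebesgue2 (I `*` I) * lebesgue2 (I `*` I))%E; first by [].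
by rewrite E2.
Qed.

End cube_oscillation.

(** * Integrability of the inverse square of omega *)

Section omega_inverse.
Variable R : realType.
Notation mu := (@lebesgue_measure R).
Notation RR := (measurableTypeR R).
Notation R4 := (RR * RR * (RR * RR))%type.

Lemma sin_ge_cubic (y : R) : 0 <= y -> y - y ^+ 3 / 6 <= sin y.
Proof.
move=> y0.
have <- : \int[mu]_(v in `[0, y]) cos v = sin y.
  by rewrite (@Rintegral_primitive _ _ sin) // ?sin0 ?subr0 // => v _; cont.
have <- : \int[mu]_(v in `[0, y]) (1 - v ^+ 2 / 2) = y - y ^+ 3 / 6.
  transitivity (y - y ^+ 3 / 6 - (0 - 0 ^+ 3 / 6)); last by rewrite expr0n /= mul0r !subr0.
  apply: (@Rintegral_primitive _ _ (fun v => v - v ^+ 3 / 6)) => // v _; last by cont.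
  by derive_to => //=; field.
apply: le_Rintegral => //.
- by apply: segment_integrable => v _; cont.
- by apply: segment_integrable => v _; cont.
- by move=> v _; exact: cos_ge_parabola.
Qed.

Lemma one_minus_cos_ge (z : R) : - pi <= z <= pi -> z ^+ 2 <= 9 * (2 - 2 * cos z).
Proof.
move=> zp.
have -> : cos z = 1 - 2 * sin (z / 2) ^+ 2.
  have -> : cos z = cos ((z / 2) *+ 2) by congr cos; rewrite -mulr_natr divfK.
  rewrite cos_mulr2n -mulr_natr; have := cos2Dsin2 (z / 2); lra.
(* On [0, 2] the cubic lower bound for sin y is at least y/3, whence 9. *)
have h : `|z / 2| / 3 <= `|sin (z / 2)|.
  have h1 (y : R) : 0 <= y <= 2 -> y / 3 <= sin y.
    move=> /andP[y0 y2]; apply: (le_trans _ (sin_ge_cubic y0)).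
    have : y ^+ 3 <= y * 4.
      rewrite exprS ler_wpM2l // (_ : 4 = 2 ^+ 2) ?lerXn2r ?nnegrE //.
      by rewrite expr2; clear; lra.
    by clear; lra.
  have p2 := pihalf_02 R.
  have [z0|z0] := leP 0 z.
    rewrite [X in X / 3]ger0_norm; last by lra.
    by apply: le_trans (ler_norm _); apply: h1; lra.
  rewrite -normrN -[leRHS]normrN -sinN [X in X / 3]ger0_norm; last by lra.
  by apply: le_trans (ler_norm _); apply: h1; lra.
have h2 : (z / 2) ^+ 2 / 9 <= sin (z / 2) ^+ 2.
  rewrite -[leRHS]real_normK ?num_real // (_ : _ / 9 = (`|z / 2| / 3) ^+ 2).
    by rewrite lerXn2r ?nnegrE // divr_ge0.
  by rewrite [RHS]expr_div_n real_normK ?num_real //; congr (_ / _); ring.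
by move: h2; rewrite expr_div_n; lra.
Qed.

Lemma omega_sqr_ge (xi : R4) : @freq_cube R xi ->
  \sum_(j < 4) (freq_coord xi j) ^+ 2 <= 9 * omega xi ^+ 2.
Proof.
move=> cxi; rewrite omega_sqr mulr_sumr; apply: ler_sum => j _.
exact: one_minus_cos_ge.
Qed.

Lemma cube_prod_integrable (f : 'I_4 -> R -> R) :
  (forall j, mu.-integrable `[- pi, pi] (EFin \o f j)) ->
  lebesgue4.-integrable (@freq_cube R) (fun xi => (\prod_(j < 4) f j (freq_coord xi j))%:E) /\
  \int[lebesgue4]_(xi in @freq_cube R) (\prod_(j < 4) f j (freq_coord xi j)) =
  \prod_(j < 4) \int[mu]_(y in `[- pi, pi]) f j y.
Proof.
move=> fi.
pose j0 := @Ordinal 4 0 erefl; pose j1 := @Ordinal 4 1 erefl.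
pose j2 := @Ordinal 4 2 erefl; pose j3 := @Ordinal 4 3 erefl.
have prodE (F : 'I_4 -> R) : \prod_(j < 4) F j = (F j0 * F j1) * (F j2 * F j3).
  rewrite !big_ord_recr big_ord0 /= mul1r -!mulrA.
  by congr (F _ * (F _ * (F _ * F _))); apply: val_inj.
pose I : set RR := `[- pi, pi]%classic.
have mI : measurable I by exact: measurable_itv.
have mII : measurable (I `*` I) by exact: measurableX.
have E (xi : R4) : \prod_(j < 4) f j (freq_coord xi j) =
    (f j0 xi.1.1 * f j1 xi.1.2) * (f j2 xi.2.1 * f j3 xi.2.2).
  by rewrite prodE /freq_coord !(tnth_nth 0).
have i01 := integrable_prod_mul mI mI (fi j0) (fi j1).
have i23 := integrable_prod_mul mI mI (fi j2) (fi j3).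
split.
  have := @integrable_prod_mul _ _ _ _ _ (@lebesgue2 R) (@lebesgue2 R) _ _ mII mII _ _ i01 i23.
  by rewrite freq_cubeE; under [X in _ -> _.-integrable _ X]eq_fun do rewrite E.
rewrite prodE -(Rintegral_prod_mul mI mI (fi j0) (fi j1)).
rewrite -(Rintegral_prod_mul mI mI (fi j2) (fi j3)).
under eq_Rintegral do rewrite E.
rewrite freq_cubeE.
exact: (@Rintegral_prod_mul _ _ _ _ _ (@lebesgue2 R) (@lebesgue2 R) _ _ mII mII _ _ i01 i23).
Qed.

End omega_inverse.

Section omega_inverse2.
Variable R : realType.
Notation mu := (@lebesgue_measure R).
Notation RR := (measurableTypeR R).
Notation R4 := (RR * RR * (RR * RR))%type.

(** By the arithmetic-geometric mean inequality |xi|^-2 is at most a constant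
    times the product over the four coordinates of |xi_j|^(-1/2), each of
    which is integrable; r removes the singularity. *)
Let phi (r y : R) : R := (`|y| + r) `^ (- 2^-1).

Lemma root_singularity_continuous (r y : R) : 0 < r -> {for y, continuous (phi r)}.
Proof.
move=> r0; rewrite /phi.
have c1 : {for y, continuous (fun y : R => `|y| + r)}.
  rewrite /prop_for /continuous_at; apply: cvgD; last exact: cvg_cst.
  by apply: cvg_norm; exact: cvg_id.
have c2 : {for (`|y| + r), continuous (fun z : R => z `^ (- 2^-1))}.
  by cont; rewrite ltr_wpDl.
by have := @continuous_comp _ _ _ (fun y : R => `|y| + r) (fun z : R => z `^ (- 2^-1)) y c1 c2.
Qed.

Lemma root_singularity_integral (r : R) : 0 < r <= 1 ->
  0 <= \int[mu]_(y in `[- pi, pi]) phi r y <= 4 * (pi + 1).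
Proof.
move=> /andP[r0 r1].
have pi2 := pihalf_02 R; have pi0 := @pi_gt0 R.
have h1 (z : R) : 0 < z -> z <= pi + 1 -> 0 <= 2 * z `^ 2^-1 <= 2 * (pi + 1).
  move=> z0 z1; rewrite mulr_ge0 ?powR_ge0 //= ler_wpM2l //.
  apply: (@le_trans _ _ ((pi + 1) `^ 2^-1)).
    by rewrite ge0_ler_powR ?nnegrE ?(ltW z0) //; lra.
  rewrite -[leRHS]powRr1; last by lra.
  by rewrite ler_powR; lra.
have piece (a b sg : R) : a <= b -> sg ^+ 2 = 1 ->
  (forall y, a <= y <= b -> `|y| = sg * y) ->
  (forall y, a <= y <= b -> `|y| <= pi) ->
  `|\int[mu]_(y in `[a, b]) phi r y| <= 2 * (pi + 1).
  move=> ab sg2 hs hb.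
  have pos (y : R) : a <= y <= b -> 0 < sg * y + r.
    by move=> /hs <-; rewrite ltr_wpDl.
  pose G (y : R) : R := 2 * (sg * (sg * y + r) `^ 2^-1).
  pose g (y : R) : R := (sg * y + r) `^ (- 2^-1).
  have dG (y : R) : a <= y <= b -> is_derive y 1 G (g y).
    move=> /pos p0; rewrite /G; derive_to => //; rewrite /g.
    transitivity (sg ^+ 2 * (sg * y + r) `^ (2^-1 - 1)); first by field.
    by rewrite sg2 mul1r; congr powR; field.
  have cg (y : R) : a <= y <= b -> {for y, continuous g}.
    by move=> /pos p0; rewrite /g; cont.
  have key (y : R) : a <= y <= b -> `|phi r y - (fun=> 0) y| <= g y.
    by move=> h; rewrite subr0 ger0_norm ?powR_ge0 // /phi hs.
  have := @Rintegral_comparison _ _ (fun=> 0) g (fun=> 0) G a b ab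
    (fun x _ => derivable_rule_cst 0 x) dG (fun x _ => @root_singularity_continuous r x r0)
    (fun x _ => @cst_continuous _ _ 0 x) cg key.
  rewrite subrr normr0 add0r => /le_trans; apply.
  have B (y : R) : a <= y <= b -> 0 <= 2 * (sg * y + r) `^ 2^-1 <= 2 * (pi + 1).
    by move=> h; apply: h1; [exact: pos|rewrite -hs // lerD // hb].
  have aI : a <= a <= b by rewrite lexx.
  have bI : a <= b <= b by rewrite lexx ab.
  rewrite /G; have := B _ aI; have := B _ bI.
  set x := 2 * (sg * b + r) `^ _; set y := 2 * (sg * a + r) `^ _ => hx hy.
  have -> : 2 * (sg * (sg * b + r) `^ 2^-1) - 2 * (sg * (sg * a + r) `^ 2^-1) = sg * (x - y).
    by rewrite /x /y; ring.
  apply: (le_trans (ler_norm _)); rewrite normrM (norm_of_sqr1 sg2) mul1r.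
  by rewrite ler_norml; lra_from hx hy.
apply/andP; split; first by apply: Rintegral_ge0 => y _; exact: powR_ge0.
apply: (le_trans (ler_norm _)).
rewrite (@Rintegral_split _ _ _ 0 _); [|lra|lra|]; last first.
  by move=> y _; exact: root_singularity_continuous.
apply: (le_trans (ler_normD _ _)).
have -> : 4 * (pi + 1) = 2 * (pi + 1) + 2 * (pi + 1) :> R by ring.
apply: lerD.
  apply: (piece _ _ (-1)); [lra|by rewrite sqrrN expr1n|..] => y yI.
    by rewrite ler0_norm ?mulN1r //; lra.
  by rewrite ler0_norm; lra.
apply: (piece _ _ 1); [lra|by rewrite expr1n|..] => y yI.
  by rewrite ger0_norm ?mul1r //; lra.
by rewrite ger0_norm; lra.
Qed.

Lemma measurable_inv_comp d (T : measurableType d) (f : T -> R) :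
  (forall x, 0 <= f x) -> measurable_fun setT f -> measurable_fun setT (fun x => (f x)^-1).
Proof.
move=> f0 mf; have -> : (fun x => (f x)^-1) = (fun x => f x `^ (-1)).
  by apply/funext => x; rewrite powR_inv1.
exact: (measurableT_comp (measurable_powR _)).
Qed.

Lemma measurable_omega_reg (r : R) :
  measurable_fun setT (fun xi : R4 => (9 * omega xi ^+ 2 + 4 * r ^+ 2)^-1).
Proof.
apply: measurable_inv_comp => [xi|].
  by rewrite addr_ge0 // mulr_ge0 // sqr_ge0.
by apply: measurable_funD => //; apply: measurable_funM => //; exact: measurable_omega_sqr.
Qed.

Definition omega_const : R := 9 / 2 * (4 * (pi + 1)) ^+ 4.

Lemma omega_reg_integral (r : R) : 0 < r <= 1 ->
  (\int[lebesgue4]_(xi in @freq_cube R) ((9 * omega xi ^+ 2 + 4 * r ^+ 2)^-1)%:E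
    <= (omega_const / 9)%:E)%E.
Proof.
move=> rI; have /andP[r0 r1] := rI.
have ip (j : 'I_4) : mu.-integrable `[- pi, pi] (EFin \o phi r).
  by apply: segment_integrable => y _; exact: root_singularity_continuous.
have [Pi PE] := cube_prod_integrable ip.
have pw (xi : R4) : @freq_cube R xi ->
    (9 * omega xi ^+ 2 + 4 * r ^+ 2)^-1 <= 2^-1 * \prod_(j < 4) phi r (freq_coord xi j).
  move=> cxi; have := omega_sqr_ge cxi.
  pose p j := (`|freq_coord xi j| + r) `^ 2^-1.
  have q0 j : 0 < `|freq_coord xi j| + r by rewrite ltr_wpDl.
  have p0 j : 0 < p j by rewrite powR_gt0.
  have p2 j : p j ^+ 2 = `|freq_coord xi j| + r.
    by rewrite -powR_mulrn ?powR_ge0 // -powRrM mulVf // powRr1 // ltW.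
  have -> : \prod_(j < 4) phi r (freq_coord xi j) = (\prod_(j < 4) p j)^-1.
    by rewrite -prodfV; apply: eq_bigr => j _; rewrite /phi powRN.
  have p4 j : p j ^+ 4 <= 2 * (freq_coord xi j ^+ 2 + r ^+ 2).
    rewrite (exprM _ 2 2) p2 -[freq_coord xi j ^+ 2]real_normK ?num_real //.
    by have := sqr_ge0 (`|freq_coord xi j| - r); rewrite sqrrB sqrrD; lra_from r0.
  have P0 : 0 < \prod_(j < 4) p j by apply: prodr_gt0 => j _.
  have PS : \prod_(j < 4) p j <= 2^-1 * \sum_(j < 4) (freq_coord xi j ^+ 2 + r ^+ 2).
    apply: (@le_trans _ _ (\sum_(j < 4) (p j ^+ 4 / 4))).
      rewrite !big_ord_recl !big_ord0; set a1 := p _; set a2 := p _; set a3 := p _; set a4 := p _.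
      have h (a b : R) : a * b <= (a ^+ 2 + b ^+ 2) / 2.
        by have := sqr_ge0 (a - b); rewrite sqrrB; clear; lra.
      rewrite mulr1 addr0 mulrA; apply: (le_trans (h _ _)).
      rewrite !exprMn.
      have := h (a1 ^+ 2) (a2 ^+ 2); have := h (a3 ^+ 2) (a4 ^+ 2).
      by rewrite -!exprM /=; clear; lra.
    rewrite mulr_sumr; apply: ler_sum => j _; have := p4 j.
    by clear; lra.
  move=> hS.
  have D0 : 0 < 9 * omega xi ^+ 2 + 4 * r ^+ 2.
    by apply: ltr_wpDl; [apply: mulr_ge0 => //; exact: sqr_ge0|rewrite mulr_gt0 ?exprn_gt0].
  rewrite -invfM lef_pV2 ?posrE //; last by rewrite mulr_gt0.
  have : \sum_(j < 4) (freq_coord xi j ^+ 2 + r ^+ 2) =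
    \sum_(j < 4) (freq_coord xi j ^+ 2) + 4 * r ^+ 2.
    by rewrite big_split /= sumr_const card_ord; congr (_ + _); rewrite -[LHS]mulr_natl.
  move: PS hS; clear; lra.
have mcube := @measurable_freq_cube R.
apply: (@le_trans _ _ (\int[lebesgue4]_(xi in @freq_cube R)
    (2^-1 * \prod_(j < 4) phi r (freq_coord xi j))%:E)%E).
  apply: ge0_le_integral => //.
  - by move=> xi _; rewrite lee_fin invr_ge0 addr_ge0 // mulr_ge0 // sqr_ge0.
  - by apply: measurable_funTS; apply/measurable_EFinP; exact: measurable_omega_reg.
  - have := integrableZl mcube 2^-1 Pi.
    by case/integrableP => + _; exact.
have := PE; rewrite /Rintegral.
have -> : (\int[lebesgue4]_(xi in @freq_cube R) (2^-1 * \prod_(j < 4) phi r (freq_coord xi j))%:E)%E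
  = (2^-1 * \int[lebesgue4]_(xi in @freq_cube R) \prod_(j < 4) phi r (freq_coord xi j))%:E.
  rewrite -RintegralZl // /Rintegral fineK //.
  apply: integrable_fin_num => //.
  have := integrableZl mcube 2^-1 Pi; exact.
move=> _; rewrite lee_fin PE /omega_const.
have [J0 J1] := andP (root_singularity_integral rI).
have -> : 9 / 2 * (4 * (pi + 1)) ^+ 4 / 9 = 2^-1 * (4 * (pi + 1)) ^+ 4 :> R by field.
rewrite ler_wpM2l // big_const_ord iter_mulr_1 lerXn2r ?nnegrE //.
exact: le_trans J1.
Qed.

(** Fatou's lemma as the regularization tends to zero. *)
Lemma omega_inv_sqr_le : (\int[lebesgue4]_(xi in @freq_cube R) ((omega xi ^+ 2)^-1)%:E
    <= omega_const%:E)%E.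
Proof.
have mcube := @measurable_freq_cube R.
pose r n : R := n.+1%:R^-1.
have r0 n : 0 < r n <= 1.
  by rewrite invr_gt0 ltr0n /= invf_le1 ?ltr0n // ler1n.
(* The factor (omega xi != 0) matches the convention 0^-1 = 0. *)
pose g n (xi : R4) : \bar R := (9 * (9 * omega xi ^+ 2 + 4 * r n ^+ 2)^-1 *
  (omega xi != 0)%:R)%:E.
have g0 n xi : (0 <= g n xi)%E.
  by rewrite lee_fin !mulr_ge0 // invr_ge0 addr_ge0 // mulr_ge0 // sqr_ge0.
have mg n : measurable_fun (@freq_cube R) (g n).
  apply: measurable_funTS; apply/measurable_EFinP; apply: measurable_funM.
    by apply: measurable_funM => //; exact: measurable_omega_reg.
  have -> : (fun xi : R4 => (omega xi != 0)%:R : R) = \1_((@omega R) @^-1` ~` [set 0]).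
    apply/funext => xi; rewrite indicE; congr (_%:R); congr nat_of_bool.
    by apply/idP/idP; rewrite inE /=; move/eqP.
  apply: measurable_indic; rewrite -[_ @^-1` _]setTI; apply: measurable_omega => //.
  exact: measurableC.
have gl xi : limn_einf (g ^~ xi) = ((omega xi ^+ 2)^-1)%:E.
  have cg : g n xi @[n --> \oo] --> ((omega xi ^+ 2)^-1)%:E.
    apply: cvg_EFin; first by near=> n.
    rewrite /g /=; have [->|w0] := eqVneq (omega xi) 0.
      rewrite expr0n /= invr0; under eq_fun do rewrite mulr0; exact: cvg_cst.
    have -> : (omega xi ^+ 2)^-1 = 9 * (9 * omega xi ^+ 2 + 4 * 0 ^+ 2)^-1 * 1.
      by field.
    apply: cvgM; last exact: cvg_cst.
    apply: cvgM; first exact: cvg_cst.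
    apply: cvgV; first by rewrite expr0n /= mulr0 addr0 mulf_neq0 // expf_neq0.
    apply: cvgD; first exact: cvg_cst.
    apply: cvgM; first exact: cvg_cst.
    have rl : r n @[n --> \oo] --> (0 : R) by exact: cvg_harmonic.
    rewrite expr2; apply: (cvgM rl rl).
  by rewrite is_cvg_limn_einfE ?(cvg_lim _ cg) //; apply/cvg_ex; eexists; exact: cg.
have := fatou lebesgue4 mcube mg (fun n xi _ => g0 n xi).
under eq_integral do rewrite gl.
move=> /le_trans; apply.
rewrite limn_einf_lim; apply: lime_le; first exact: is_cvg_einfs.
near=> n; apply: (@le_trans _ _ (\int[lebesgue4]_(xi in @freq_cube R) g n xi)%E).
  by apply: ereal_inf_lbound; exists n => //=.
apply: (@le_trans _ _ (\int[lebesgue4]_(xi in @freq_cube R)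
   (9%:E * ((9 * omega xi ^+ 2 + 4 * r n ^+ 2)^-1)%:E))%E).
  apply: ge0_le_integral => //.
    by apply: measurable_funTS; apply/measurable_EFinP; apply: measurable_funM => //;
      exact: measurable_omega_reg.
  move=> xi _; rewrite -EFinM lee_fin ler_piMr //; last by case: (_ != _).
  by rewrite mulr_ge0 // invr_ge0 addr_ge0 // mulr_ge0 // sqr_ge0.
rewrite ge0_integralZl //; last 2 first.
- by apply: measurable_funTS; apply/measurable_EFinP; exact: measurable_omega_reg.
- by move=> xi _; rewrite lee_fin invr_ge0 addr_ge0 // mulr_ge0 // sqr_ge0.
apply: (le_trans (lee_wpmul2l _ (omega_reg_integral (r0 n)))) => //.
by rewrite -EFinM lee_fin mulrC divfK.
Unshelve. all: by end_near. Qed.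

Lemma measurable_omega_inv_sqr : measurable_fun setT (fun xi : R4 => (omega xi ^+ 2)^-1).
Proof.
by apply: measurable_inv_comp => [xi|]; [exact: sqr_ge0|exact: measurable_omega_sqr].
Qed.

Lemma omega_inv_sqr_integrable :
  lebesgue4.-integrable (@freq_cube R) (fun xi => ((omega xi ^+ 2)^-1)%:E).
Proof.
apply/integrableP; split.
  by apply: measurable_funTS; apply/measurable_EFinP; exact: measurable_omega_inv_sqr.
under eq_integral do rewrite gee0_abs ?lee_fin ?invr_ge0 ?sqr_ge0 //.
by apply: (le_lt_trans omega_inv_sqr_le); rewrite ltry.
Qed.

Lemma omega_neq0_ae : {ae (@lebesgue4 R), forall xi, @freq_cube R xi -> omega xi != 0}.
Proof.
pose Z : set RR := [set (0 : R)]; pose N1 : set (RR * RR) := Z `*` [set: RR].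
have mZ : measurable Z by exact: measurable_set1.
have mN1 : measurable N1 by exact: (measurableX mZ (@measurableT _ RR)).
exists (N1 `*` [set: RR * RR]); split.
- exact: (measurableX mN1 (@measurableT _ (RR * RR)%type)).
- rewrite [LHS]product_measure1E //.
  transitivity (lebesgue2 N1 * @lebesgue2 R [set: RR * RR])%E; first by [].
  rewrite (_ : lebesgue2 N1 = 0%E) ?mul0e //.
  rewrite [LHS]product_measure1E //.
  transitivity (mu Z * mu [set: RR])%E; first by [].
  by rewrite lebesgue_measure_set1 mul0e.
- move=> xi /= /not_implyP[cxi /negP]; rewrite negbK => /eqP w0.
  have := omega_sqr_ge cxi; rewrite w0 expr0n /= mulr0 => h.
  have : freq_coord xi ord0 ^+ 2 <= 0.
    by apply: le_trans h; rewrite big_ord_recl /= lerDl sumr_ge0 // => j _; exact: sqr_ge0.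
  by rewrite le_eqVlt ltNge sqr_ge0 orbF expf_eq0 => /andP[_ /eqP h0]; split.
Qed.

End omega_inverse2.

(** * Chirps and the wave multiplier *)

Section chirp.
Variable R : realType.
Notation mu := (@lebesgue_measure R).
Implicit Types r theta lam N w : R.

Lemma Rintegral_change_left (f : R -> R) (a b c : R) : a <= c -> b <= c ->
  (forall x, a <= x <= c -> {for x, continuous f}) ->
  (forall x, b <= x <= c -> {for x, continuous f}) ->
  (forall x, `|f x| <= 1) ->
  `|\int[mu]_(x in `[a, c]) f x - \int[mu]_(x in `[b, c]) f x| <= `|a - b|.
Proof.
wlog ab : a b / a <= b.
  move=> h ac bc fa fb f1; have [ab|/ltW ba] := leP a b; first exact: h.
  by rewrite distrC (distrC a); apply: h.
move=> ac bc fa fb f1.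
rewrite (@Rintegral_split _ f a b c) // addrK (distrC a) [leRHS]ger0_norm ?subr_ge0 // -[b - a]mul1r.
apply: Rintegral_le_length => // x /andP[ax xb]; apply: fa.
by rewrite ax (le_trans xb).
Qed.

Lemma fresnel_le2 theta Y : 0 <= Y -> `|fresnel theta Y| <= 2.
Proof.
move=> Y0.
have h Z : 0 <= Z -> Z <= 1 -> `|fresnel theta Z| <= 1.
  move=> Z0 Z1; apply: (@le_trans _ _ (1 * (Z - 0))); last by rewrite mul1r subr0.
  by apply: Rintegral_le_length => // x _; [cont|exact: cos_max].
have [Y1|/ltW Y1] := leP Y 1.
  by apply: (le_trans (h _ Y0 Y1)); rewrite ler1n.
rewrite -[fresnel _ _](subrK (fresnel theta 1)) (le_trans (ler_normD _ _)) //.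
have -> : 2 = 1^-1 + 1 :> R by rewrite invr1.
by apply: lerD; [exact: fresnel_tail|exact: h].
Qed.

Lemma fresnel_addition theta Y : 0 <= Y ->
  fresnel theta Y = cos theta * fresnel 0 Y - sin theta * fresnel (- (pi / 2)) Y.
Proof.
move=> Y0; rewrite /fresnel.
have i1 : mu.-integrable `[0, Y] (EFin \o (fun v => cos (v ^+ 2 + 0))).
  by apply: segment_integrable => v _; cont.
have i2 : mu.-integrable `[0, Y] (EFin \o (fun v => cos (v ^+ 2 + - (pi / 2)))).
  by apply: segment_integrable => v _; cont.
rewrite -RintegralZl // -[X in _ - X]RintegralZl //.
rewrite -RintegralB //; last 2 first.
- by apply: segment_integrable => v _; cont.
- by apply: segment_integrable => v _; cont.
apply: eq_Rintegral => v _; rewrite cosBpihalf addr0 cosD; ring.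
Qed.

Definition chirp_phase r lam u : R := r ^+ 4 / (4 * u ^+ 2) + lam * u ^+ 2.

(** With t = r^2 and lam = w^2 the phase is (w u - t/(2u))^2 + t w + theta. *)
Definition chirp r theta lam N : R :=
  \int[mu]_(u in `[N^-1, N]) cos (chirp_phase r lam u + theta).

Lemma chirp_continuous r theta lam u : u != 0 ->
  {for u, continuous (fun u => cos (chirp_phase r lam u + theta))}.
Proof. by move=> u0; rewrite /chirp_phase; cont; rewrite mulf_neq0 // expf_neq0. Qed.

Lemma chirp_fresnel r theta w N : 0 < r -> 0 < w -> 1 <= N ->
  r ^+ 2 / 2 <= w * N ^+ 2 ->
  `|chirp r theta (w ^+ 2) N - w^-1 * fresnel (theta + r ^+ 2 * w) (w * N - r ^+ 2 / 2 / N)|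
    <= N^-1 * (1 + r ^+ 2 / w).
Proof.
move=> r0 w0 N1 hN.
have N0 : 0 < N by exact: lt_le_trans N1.
have q0 : 0 < r ^+ 2 / 2 by rewrite divr_gt0 ?exprn_gt0.
have wn : w != 0 by rewrite gt_eqF.
have Nn : N != 0 by rewrite gt_eqF.
rewrite -(glasser (theta + r ^+ 2 * w) w0 q0 hN N0) mulrA mulVf // mul1r.
set V := r ^+ 2 / 2 / (w * N).
have V0 : 0 < V by rewrite divr_gt0 // mulr_gt0.
have VN : V <= N by rewrite ler_pdivrMr ?mulr_gt0 // mulrCA -expr2.
have N'0 : 0 < N^-1 by rewrite invr_gt0.
have N'N : N^-1 <= N by rewrite (@le_trans _ _ 1) // invf_le1.
have e : \int[mu]_(u in `[V, N]) cos ((w * u - r ^+ 2 / 2 / u) ^+ 2 + (theta + r ^+ 2 * w)) =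
    \int[mu]_(u in `[V, N]) cos (chirp_phase r (w ^+ 2) u + theta).
  apply: eq_Rintegral => u; rewrite inE /= in_itv /= => /andP[Vu _].
  have un : u != 0 by rewrite gt_eqF // (lt_le_trans V0).
  by congr cos; rewrite /chirp_phase; field.
rewrite e; apply: (@le_trans _ _ `|N^-1 - V|).
  apply: Rintegral_change_left => // [u /andP[h _]|u /andP[h _]|u]; last exact: cos_max.
    by apply: chirp_continuous; rewrite gt_eqF // (lt_le_trans N'0).
  by apply: chirp_continuous; rewrite gt_eqF // (lt_le_trans V0).
apply: (le_trans (ler_normB _ _)); rewrite !gtr0_norm // /V.
rewrite mulrDr mulr1 lerD2l.
have -> : r ^+ 2 / 2 / (w * N) = 2^-1 * (N^-1 * (r ^+ 2 / w)) by field; rewrite wn Nn.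
by rewrite ler_piMl ?invf_le1 ?ler1n // mulr_ge0 ?(ltW N'0) // divr_ge0 ?sqr_ge0 // ltW.
Qed.

(** The bound does not depend on N and is integrable over the cube when w =
    omega, which is what dominated convergence needs. *)
Lemma chirp_bound r theta w N : 1 <= r -> 0 < w -> 1 <= N ->
  `|chirp r theta (w ^+ 2) N| <= (4 + r ^+ 2) * (1 + (w ^+ 2)^-1).
Proof.
move=> r1 w0 N1; have r0 : 0 < r by exact: lt_le_trans r1.
have N0 : 0 < N by exact: lt_le_trans N1.
have w'0 : 0 < w^-1 by rewrite invr_gt0.
have ww : w^-1 <= 1 + (w ^+ 2)^-1.
  by rewrite -exprVn; have := sqr_ge0 (w^-1 - 1); rewrite sqrrB; lra_from w'0.
have ww1 : 1 <= 1 + (w ^+ 2)^-1 by rewrite lerDl invr_ge0 sqr_ge0.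
suff : `|chirp r theta (w ^+ 2) N| <= 1 + (3 + r ^+ 2) * w^-1.
  move=> /le_trans; apply.
  have -> : 4 + r ^+ 2 = 1 + (3 + r ^+ 2) by ring.
  by rewrite [leRHS]mulrDl mul1r lerD // ler_wpM2l // addr_ge0 // sqr_ge0.
have [hN|hN] := leP (r ^+ 2 / 2) (w * N ^+ 2).
  have h := chirp_fresnel theta r0 w0 N1 hN.
  have Y0 : 0 <= w * N - r ^+ 2 / 2 / N.
    by rewrite subr_ge0 ler_pdivrMr // -[leRHS]mulrA -expr2.
  have h2 := fresnel_le2 (theta + r ^+ 2 * w) Y0.
  rewrite -[chirp r theta (w ^+ 2) N](subrK (w^-1 * fresnel (theta + r ^+ 2 * w) (w * N - r ^+ 2 / 2 / N))).
  apply: (le_trans (ler_normD _ _)).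
  have h3 : `|w^-1 * fresnel (theta + r ^+ 2 * w) (w * N - r ^+ 2 / 2 / N)| <= w^-1 * 2.
    by rewrite normrM gtr0_norm // ler_wpM2l // ltW.
  have h4 : N^-1 * (1 + r ^+ 2 / w) <= 1 + r ^+ 2 / w.
    by rewrite ler_piMl ?invf_le1 // addr_ge0 // divr_ge0 ?sqr_ge0 // ltW.
  rewrite mulrDl; lra_from h h3 h4 w'0.
apply: (@le_trans _ _ (1 * (N - N^-1))).
  apply: Rintegral_le_length => [|u /andP[h _]|u _]; last exact: cos_max.
    by rewrite (@le_trans _ _ 1) // invf_le1.
  by apply: chirp_continuous; rewrite gt_eqF // (lt_le_trans _ h) // invr_gt0.
rewrite mul1r; have h1 : N <= N ^+ 2 by rewrite expr2 ler_peMr // ltW.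
have h2 : N ^+ 2 <= r ^+ 2 / 2 * w^-1 by rewrite ler_pdivlMr // mulrC ltW.
have h3 : 0 < N^-1 by rewrite invr_gt0.
have h4 : 0 <= r ^+ 2 * w^-1 by rewrite mulr_ge0 ?sqr_ge0 // ltW.
rewrite mulrDl; move: h1 h2; rewrite mulrAC; move: (ltW w'0) h3 h4; clear; lra.
Qed.

Lemma chirp_limit r theta w L (N : R ^nat) : 1 <= r -> 0 < w ->
  (forall Y, 0 < Y -> `|fresnel (theta + r ^+ 2 * w) Y - L| <= Y^-1) ->
  (forall n, n%:R + 1 <= N n) ->
  chirp r theta (w ^+ 2) (N n) @[n --> \oo] --> w^-1 * L.
Proof.
move=> r1 w0 hL hN.
have r0 : 0 < r by exact: lt_le_trans r1.
have N1 n : 1 <= N n by apply: le_trans (hN n); rewrite lerDr.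
have N0 n : 0 < N n by exact: lt_le_trans (N1 n).
pose K := 1 + r ^+ 2 / w + 2 / w ^+ 2.
have K0 : 0 < K.
  by rewrite !ltr_pwDl // ?divr_ge0 ?sqr_ge0 ?exprn_ge0 // ltW.
have key n : r ^+ 2 / w <= n%:R ->
    `|w^-1 * L - chirp r theta (w ^+ 2) (N n)| <= K / (n%:R + 1).
  move=> hn.
  have nN : n%:R <= N n by apply: le_trans (hN n); rewrite lerDl.
  have h1 : r ^+ 2 <= w * N n by rewrite -ler_pdivrMl // mulrC (le_trans hn).
  have h2 : w * N n <= w * N n ^+ 2 by rewrite ler_wpM2l ?(ltW w0) // expr2 ler_peMr // ltW.
  have h3 : r ^+ 2 / 2 <= w * N n ^+ 2.
    by move: (sqr_ge0 r) h1 h2; clear; lra.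
  have h := chirp_fresnel theta r0 w0 (N1 n) h3.
  set Y := _ - _ / N n in h.
  have Yw : w * N n / 2 <= Y.
    have : r ^+ 2 / 2 / N n <= r ^+ 2 / 2.
      by rewrite ler_piMr ?invf_le1 // divr_ge0 ?sqr_ge0.
    by rewrite /Y; move: h1; clear; lra.
  have Y0 : 0 < Y by apply: lt_le_trans Yw; rewrite divr_gt0 // mulr_gt0.
  have h4 : Y^-1 <= 2 / w / N n.
    have -> : 2 / w / N n = (w * N n / 2)^-1 by field; rewrite !gt_eqF.
    by rewrite lef_pV2 ?posrE // divr_gt0 // mulr_gt0.
  have h5 := le_trans (hL _ Y0) h4.
  rewrite distrC -[chirp r theta (w ^+ 2) (N n)](subrK (w^-1 * fresnel (theta + r ^+ 2 * w) Y)) -addrA -mulrBr.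
  apply: (le_trans (ler_normD _ _)).
  have h6 : `|w^-1 * (fresnel (theta + r ^+ 2 * w) Y - L)| <= w^-1 * (2 / w / N n).
    by rewrite normrM gtr0_norm ?invr_gt0 // ler_wpM2l // invr_ge0 ltW.
  apply: (le_trans (lerD h h6)).
  apply: (@le_trans _ _ (K / N n)).
    rewrite le_eqVlt; apply/orP; left; apply/eqP; rewrite /K; field.
    by rewrite !gt_eqF.
  by rewrite ler_wpM2l ?(ltW K0) // lef_pV2 ?posrE // ltr_wpDl.
apply/cvgrPdist_le => e e0; near=> n.
apply: (le_trans (key n _)).
  by near: n; exact: nbhs_infty_ger.
rewrite ler_pdivrMr ?ltr_wpDl // -ler_pdivrMl // mulrC.
rewrite (@le_trans _ _ n%:R) ?lerDl //; near: n; exact: nbhs_infty_ger.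
Unshelve. all: by end_near. Qed.

End chirp.

(** * Dispersive decay of the kernel *)

Section product_sigma_finite.
Context d1 d2 (T1 : measurableType d1) (T2 : measurableType d2) (R : realType).
Variables (m1 : {sigma_finite_measure set T1 -> \bar R})
  (m2 : {sigma_finite_measure set T2 -> \bar R}).

Lemma product_sigma_finite : sigma_finite setT (m1 \x m2)%E.
Proof.
have /sigma_finiteP[F [TF ndF Foo]] := sigma_finiteT m1.
have /sigma_finiteP[G [TG ndG Goo]] := sigma_finiteT m2.
exists (fun n => F n `*` G n).
  rewrite -setXTT TF TG predeqE => -[x y]; split.
    move=> [/= [n _ Fnx] [k _ Gky]]; exists (maxn n k) => //; split.
    - by move: x Fnx; exact/subsetPset/ndF/leq_maxl.
    - by move: y Gky; exact/subsetPset/ndG/leq_maxr.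
  by move=> [n _ []/= ? ?]; split; exists n.
move=> k; have [? ?] := Foo k; have [? ?] := Goo k.
split; first exact: measurableX.
by rewrite [X in (X < _)%E]product_measure1E// lte_mul_pinfty// ge0_fin_numE.
Qed.

End product_sigma_finite.

Lemma lebesgue4_sigma_finite (R : realType) : sigma_finite setT (@lebesgue4 R).
Proof. exact: (product_sigma_finite lebesgue2 lebesgue2). Qed.

HB.instance Definition _ (R : realType) := Measure_isSigmaFinite.Build _ _ _
  (@lebesgue4 R) (lebesgue4_sigma_finite R).

Section kernel_approximation.
Variable R : realType.
Notation mu := (@lebesgue_measure R).
Notation RR := (measurableTypeR R).
Notation R4 := (RR * RR * (RR * RR))%type.
Implicit Types (x : lattice) (xi : R4).

Let V : R := (2 * pi) ^+ 4.

Lemma cube_integrable_bounded (h : R4 -> R) M : measurable_fun setT h ->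
  (forall xi, @freq_cube R xi -> `|h xi| <= M) ->
  lebesgue4.-integrable (@freq_cube R) (EFin \o h).
Proof.
by move=> mh hM; apply: (bounded_integrable _ (@freq_cube_lt_oo R) mh hM);
  exact: measurable_freq_cube.
Qed.

Lemma cube_integral_le_integrable (h : R4 -> R) M :
  lebesgue4.-integrable (@freq_cube R) (EFin \o h) ->
  (forall xi, @freq_cube R xi -> `|h xi| <= M) ->
  `|\int[lebesgue4]_(xi in @freq_cube R) h xi| <= M * V.
Proof.
move=> hi hM; have mc := @measurable_freq_cube R.
apply: (le_trans (le_normr_Rintegral mc hi)).
rewrite /V -cube_volume -(@Rintegral_cst _ _ _ lebesgue4 _ mc).
apply: le_Rintegral => //; first exact: integrable_abse hi.
by apply: (@cube_integrable_bounded (fun=> M) `|M|) => // xi _.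
Qed.

Lemma cube_integral_le (h : R4 -> R) M : measurable_fun setT h ->
  (forall xi, @freq_cube R xi -> `|h xi| <= M) ->
  `|\int[lebesgue4]_(xi in @freq_cube R) h xi| <= M * V.
Proof.
move=> mh hM; apply: cube_integral_le_integrable => //.
exact: cube_integrable_bounded hM.
Qed.

Lemma measurable_cos_phase x : measurable_fun setT (fun xi : R4 => cos (phase x xi)).
Proof. by apply: measurable_cos_comp; exact: measurable_phase. Qed.

Lemma phase_opp x xi : phase (- x) xi = - phase x xi.
Proof.
by rewrite /phase -sumrN; apply: eq_bigr => j _; rewrite mxE mulrNz mulNr.
Qed.

Lemma phase0 xi : phase 0 xi = 0.
Proof. by rewrite /phase big1 // => j _; rewrite mxE mul0r. Qed.

Lemma measurable_chirp (r theta : R) : measurable_fun [set: R4 * RR]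
  (fun z : R4 * RR => cos (chirp_phase r (omega z.1 ^+ 2) z.2 + theta)).
Proof.
have m2 : measurable_fun [set: R4 * RR] (fun z => z.2 ^+ 2 : R).
  by apply: measurable_funX; exact: measurable_snd.
apply: measurable_cos_comp; apply: measurable_funD => //; apply: measurable_funD.
  apply: measurable_funM => //; apply: measurable_inv_comp.
    by move=> z; rewrite mulr_ge0 // sqr_ge0.
  by apply: measurable_funM.
apply: measurable_funM => //.
exact: (measurableT_comp (@measurable_omega_sqr R) (@measurable_fst _ _ R4 RR)).
Qed.

Lemma measurable_chirp_density x (r theta : R) (rho : R -> R) :
  measurable_fun setT (rho : RR -> RR) ->
  measurable_fun [set: R4 * RR] (fun z : R4 * RR => cos (phase x z.1) *
    (rho z.2 * cos (chirp_phase r (omega z.1 ^+ 2) z.2 + theta))).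
Proof.
move=> mrho; apply: measurable_funM.
  exact: (measurableT_comp (measurable_cos_phase x) (@measurable_fst _ _ R4 RR)).
apply: measurable_funM; last exact: measurable_chirp.
exact: (measurableT_comp mrho (@measurable_snd _ _ R4 RR)).
Qed.

(** At fixed u the phase of the chirp is u^2 omega^2 up to a constant in xi, and
    the product of cosines splits into the oscillations of x and of -x. *)
Lemma cube_chirp_slice x (r theta u : R) : 1 <= u ->
  `|\int[lebesgue4]_(xi in @freq_cube R)
     (cos (phase x xi) * cos (chirp_phase r (omega xi ^+ 2) u + theta))| <=
  \sum_(j < 4) (2 * bessel_const R / (u ^+ 2 * (1 + `| `|(x ord0 j)%:~R| - 2 * u ^+ 2|))).
Proof.
move=> u1; have s1 : 1 <= u ^+ 2 by rewrite exprn_ege1.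
pose b := r ^+ 4 / (4 * u ^+ 2) + theta.
have mc := @measurable_freq_cube R.
have mi y : lebesgue4.-integrable (@freq_cube R)
    (EFin \o (fun xi => cos (b + phase y xi + u ^+ 2 * omega xi ^+ 2))).
  apply: (@cube_integrable_bounded _ 1); last by move=> xi _; exact: cos_max.
  apply: measurable_cos_comp; apply: measurable_funD.
    by apply: measurable_funD => //; exact: measurable_phase.
  by apply: measurable_funM => //; exact: measurable_omega_sqr.
rewrite (_ : Rintegral _ _ _ = 2^-1 *
  (\int[lebesgue4]_(xi in @freq_cube R) cos (b + phase x xi + u ^+ 2 * omega xi ^+ 2) +
   \int[lebesgue4]_(xi in @freq_cube R) cos (b + phase (- x) xi + u ^+ 2 * omega xi ^+ 2))); last first.
  rewrite -RintegralD // -RintegralZl //; last by have := integrableD mc (mi x) (mi (- x)); exact.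
  apply: eq_Rintegral => xi _; rewrite phase_opp.
  rewrite (_ : chirp_phase r (omega xi ^+ 2) u + theta = b + u ^+ 2 * omega xi ^+ 2); last first.
    by rewrite /chirp_phase /b; ring.
  set p := phase x xi; set q := u ^+ 2 * _.
  rewrite (_ : b + p + q = (b + q) + p); last by ring.
  rewrite (_ : b + - p + q = (b + q) - p); last by ring.
  by move: (b + q) => z; rewrite cosD cosB; field.
have B1 := cube_oscillation x b s1; have B2 := cube_oscillation (- x) b s1.
move: B2; under eq_bigr do rewrite mxE mulrNz normrN.
move=> B2; rewrite normrM ger0_norm ?invr_ge0 //.
have := ler_normD (\int[lebesgue4]_(xi in @freq_cube R) cos (b + phase x xi + u ^+ 2 * omega xi ^+ 2))
  (\int[lebesgue4]_(xi in @freq_cube R) cos (b + phase (- x) xi + u ^+ 2 * omega xi ^+ 2)).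
move: B1 B2; clear; lra.
Qed.

Lemma cube_chirp_piece x (r theta a b : R) (rho g : R -> R) :
  0 < a -> a <= b -> measurable_fun setT (rho : RR -> RR) ->
  (forall u, a <= u <= b -> `|rho u| <= 1) ->
  (forall u, a <= u <= b -> {for u, continuous g}) ->
  (forall u, a <= u <= b -> `|rho u| * `|\int[lebesgue4]_(xi in @freq_cube R)
     (cos (phase x xi) * cos (chirp_phase r (omega xi ^+ 2) u + theta))| <= g u) ->
  `|\int[lebesgue4]_(xi in @freq_cube R) (cos (phase x xi) *
     \int[mu]_(u in `[a, b]) (rho u * cos (chirp_phase r (omega xi ^+ 2) u + theta)))| <=
  \int[mu]_(u in `[a, b]) g u.
Proof.
move=> a0 ab mrho rho1 cg hg.
have mc := @measurable_freq_cube R.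
have mI : measurable (`[a, b] : set RR) by exact: measurable_itv.
have Ioo : (mu (`[a, b] : set RR) < +oo)%E.
  by rewrite lebesgue_measure_itv /=; case: ifP => _; rewrite -?EFinB ltry.
have mchirp := measurable_chirp r theta.
pose f (z : R4 * RR) : R := cos (phase x z.1) *
   (rho z.2 * cos (chirp_phase r (omega z.1 ^+ 2) z.2 + theta)).
have mf : measurable_fun setT f := measurable_chirp_density x r theta mrho.
have f1 xi u : @freq_cube R xi -> (`[a, b]%classic : set RR) u -> `|f (xi, u)| <= 1.
  move=> _ uI; have r1 : `|rho u| <= 1 by apply: rho1; move: uI; rewrite /= in_itv.
  have h (p q : R) : `|p| <= 1 -> `|q| <= 1 -> `|p * q| <= 1.
    by move=> p1 q1; rewrite normrM mulr_ile1.
  by apply: (h) => //=; [exact: cos_max|apply: (h) => //; exact: cos_max].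
have mslice2 xi : measurable_fun setT (fun u => f (xi, u)).
  exact: (measurableT_comp mf (measurable_pair1 xi)).
have mslice1 u : measurable_fun setT (fun xi => f (xi, u)).
  exact: (measurableT_comp mf (measurable_pair2 u)).
rewrite (_ : Rintegral _ _ _ = \int[lebesgue4]_(xi in @freq_cube R)
    \int[mu]_(u in `[a, b]) f (xi, u)); last first.
  apply: eq_Rintegral => xi _; rewrite /f -RintegralZl //.
  apply: (bounded_integrable mI Ioo (M := 1)).
    apply: measurable_funM => //.
    exact: (measurableT_comp mchirp (measurable_pair1 xi)).
  move=> u; rewrite /= in_itv /= => uI.
  by rewrite normrM mulr_ile1 // ?cos_max // rho1.
rewrite (Rintegral_swap mc mI (@freq_cube_lt_oo R) Ioo mf f1).
have pw u : a <= u <= b ->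
    `|\int[lebesgue4]_(xi in @freq_cube R) f (xi, u)| <= g u.
  move=> uI; apply: le_trans (hg _ uI); rewrite -normrM -RintegralZl //.
    rewrite le_eqVlt; apply/orP; left; apply/eqP; congr `|_|.
    by apply: eq_Rintegral => xi _; rewrite /f /=; ring.
  apply: (@cube_integrable_bounded _ 1).
    apply: measurable_funM; first exact: measurable_cos_phase.
    exact: (measurableT_comp mchirp (measurable_pair2 u)).
  by move=> xi _; rewrite normrM mulr_ile1 // ?cos_max.
have Fi : mu.-integrable `[a, b] (fun u => (\int[lebesgue4]_(xi in @freq_cube R) f (xi, u))%:E).
  apply: (@integrable_slice_integral _ _ _ _ _ mu lebesgue4 _ _ mI mc (fun z => f (z.2, z.1)) 1) => //.
  - exact: freq_cube_lt_oo.
  - by apply: (measurableT_comp mf); apply: measurable_fun_pair;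
      [exact: measurable_snd|exact: measurable_fst].
  - by move=> u xi uI cxi; exact: f1.
apply: (le_trans (le_normr_Rintegral mI Fi)).
apply: le_Rintegral => //; first exact: integrable_abse Fi.
- exact: segment_integrable.
Qed.

End kernel_approximation.

Section kernel_decay.
Variable R : realType.
Notation mu := (@lebesgue_measure R).
Notation RR := (measurableTypeR R).
Notation R4 := (RR * RR * (RR * RR))%type.
Implicit Types (x : lattice) (xi : R4).

Let V : R := (2 * pi) ^+ 4.

Lemma cube_chirp_integrable x (r theta a b : R) (rho : R -> R) :
  measurable_fun setT (rho : RR -> RR) -> (forall u, a <= u <= b -> `|rho u| <= 1) ->
  lebesgue4.-integrable (@freq_cube R) (EFin \o (fun xi => cos (phase x xi) *
     \int[mu]_(u in `[a, b]) (rho u * cos (chirp_phase r (omega xi ^+ 2) u + theta)))).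
Proof.
move=> mrho rho1.
have mc := @measurable_freq_cube R.
have mI : measurable (`[a, b] : set RR) by exact: measurable_itv.
have Ioo : (mu (`[a, b] : set RR) < +oo)%E.
  by rewrite lebesgue_measure_itv /=; case: ifP => _; rewrite -?EFinB ltry.
have mf := measurable_chirp_density x r theta mrho.
have mchirp := measurable_chirp r theta.
have h (p q : R) : `|p| <= 1 -> `|q| <= 1 -> `|p * q| <= 1.
  by move=> p1 q1; rewrite normrM mulr_ile1.
have r1 u : (`[a, b]%classic : set RR) u -> `|rho u| <= 1.
  by move=> uI; apply: rho1; move: uI; rewrite /= in_itv.
apply: eq_integrable (@integrable_slice_integral _ _ _ _ _ lebesgue4 mu _ _ mc mI _ 1
   (@freq_cube_lt_oo R) Ioo mf _) => //.
  move=> xi _ /=; rewrite RintegralZl //.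
  apply: (bounded_integrable mI Ioo (M := 1)).
    by apply: measurable_funM => //; exact: (measurableT_comp mchirp (measurable_pair1 xi)).
  by move=> u uI; apply: (h); [exact: r1|exact: cos_max].
move=> xi u _ uI; apply: (h); first exact: cos_max.
by apply: (h); [exact: r1|exact: cos_max].
Qed.

Let low_weight (r u : R) : R := (1 - 256 * (u ^+ 4 / r ^+ 4)) ^+ 2.

Lemma low_weight_bounds (r u : R) : 0 < r -> 0 <= u <= r / 4 ->
  [/\ 0 <= low_weight r u <= 1 & `|1 - low_weight r u| <= 512 * (u ^+ 4 / r ^+ 4)].
Proof.
move=> r0 /andP[u0 ur].
have S0 : 0 <= u ^+ 4 / r ^+ 4 by rewrite divr_ge0 ?exprn_ge0 // ltW.
have S1 : u ^+ 4 / r ^+ 4 <= 256^-1.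
  have -> : 256^-1 = (r / 4) ^+ 4 / r ^+ 4 by field; rewrite gt_eqF.
  rewrite ler_wpM2r ?invr_ge0 ?exprn_ge0 ?(ltW r0) //.
  by rewrite lerXn2r ?nnegrE // (le_trans u0).
rewrite /low_weight; move: (u ^+ 4 / r ^+ 4) S0 S1; clear => T T0 T1.
have T2 : 0 <= T ^+ 2 by exact: sqr_ge0.
have T3 : T ^+ 2 <= 256^-1 * T by rewrite expr2 ler_wpM2r.
have T4 : 0 <= (1 - 256 * T) ^+ 2 by exact: sqr_ge0.
have e : (1 - 256 * T) ^+ 2 = 1 - 512 * T + 256 * (256 * T ^+ 2) by ring.
by split; rewrite ?ler_norml ?T4 /= e; lra.
Qed.

Lemma Rintegral_weighted_sum4_le (c M a b : R) (f : 'I_4 -> R -> R) : 0 <= c -> a <= b ->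
  (forall j u, a <= u <= b -> {for u, continuous (f j)}) ->
  (forall j, \int[mu]_(u in `[a, b]) f j u <= M) ->
  (forall u, a <= u <= b -> {for u, continuous (fun u => c * \sum_(j < 4) f j u)}) /\
  \int[mu]_(u in `[a, b]) (c * \sum_(j < 4) f j u) <= c * (4 * M).
Proof.
move=> c0 ab cf fM; have fi j := segment_integrable (cf j); split.
  move=> u uI; rewrite /prop_for /continuous_at; apply: cvgM; first exact: cvg_cst.
  by apply: cvg_big => [|j _]; [exact: add_continuous|exact: cf].
rewrite RintegralZl //; last exact: Rintegrable_sum.
rewrite ler_wpM2l // Rintegral_sum //.
apply: (le_trans (ler_sum _ (fun j _ => fM j))).
by rewrite sumr_const card_ord mulr_natl.
Qed.

(** The integral over u is cut at r/4. Below r/4 the part with low_weight has no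
    stationary point and is of size r^-3 for each xi. The complementary
    weight is O((u/r)^4): on [1/N, 1] this is enough, and beyond u = 1 the
    average over the cube is taken first. There min(1, (u/r)^4) is at most a
    constant times (u/r)^(3-2e), so that r^-(3-2e) comes out and the
    integral of [resonance] remains. *)
Lemma cube_chirp_decay (e : R) : 0 < e < 3 / 2 -> exists2 C : R, 0 < C &
  forall x (r theta N : R), 4 <= r -> r ^+ 2 <= N ->
  `|\int[lebesgue4]_(xi in @freq_cube R) (cos (phase x xi) * chirp r theta (omega xi ^+ 2) N)|
   <= C * r `^ (- (3 - 2 * e)).
Proof.
move=> /andP[e0 e32].
pose K : R := bessel_const R.
have K0 : 0 < K := bessel_const_gt0 R.
have V0 : 0 < V by rewrite exprn_gt0 // mulr_gt0 // pi_gt0.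
(* Of the constants 1000 and 512 only the stated properties matter below. *)
have [c1 c10 lowb] : exists2 c1 : R, 0 < c1 & forall r lam theta d : R,
    2 <= r -> 0 <= lam <= 16 -> 0 < d -> d <= r ^- 2 ->
    `|\int[mu]_(u in `[d, r / 4]) (low_weight r u *
       cos (r ^+ 4 / (4 * u ^+ 2) + lam * u ^+ 2 + theta))| <= c1 / r ^+ 3.
  by exists 1000; [rewrite ltr0n|exact: low_part_bound].
(* The last property, 1 <= c2 / 4^3, serves the part u >= r/4 with weight 1. *)
have [c2 c20 [highb c2_64]] : exists2 c2 : R, 0 < c2 & (forall r u : R, 0 < r ->
    0 <= u <= r / 4 -> `|1 - low_weight r u| <= c2 * (u ^+ 4 / r ^+ 4)) /\
    1 <= c2 * 4^-1 `^ 3.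
  exists 512; first by rewrite ltr0n.
  split; first by move=> r u r0 /(low_weight_bounds r0)[].
  by rewrite powR_mulrn ?invr_ge0 // !exprS expr0; lra.
exists (c1 * V + c2 * V + 2 * c2 * K * (4 * (2 / e))).
  have p4 : 0 < 4 * (2 / e) by rewrite mulr_gt0 // divr_gt0.
  have p2 : 0 < 2 :> R by [].
  exact: (addr_gt0 (addr_gt0 (mulr_gt0 c10 V0) (mulr_gt0 c20 V0))
    (mulr_gt0 (mulr_gt0 (mulr_gt0 p2 c20) K0) p4)).
move=> x r theta N r4 rN.
have r0 : 0 < r by apply: lt_le_trans r4.
have r1 : 1 <= r by apply: le_trans r4; rewrite ler1n.
have r41 : 1 <= r / 4 by rewrite ler_pdivlMr // mul1r.
have rrN : r / 4 <= N.
  by apply: le_trans rN; rewrite ler_pdivrMr // expr2 -mulrA ler_peMr ?(ltW r0) // mulr_ege1 ?ler1n.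
have N1 : 1 <= N by exact: le_trans rrN.
have N0 : 0 < N by exact: lt_le_trans N1.
have N'1 : N^-1 <= 1 by rewrite invf_le1.
have N'0 : 0 < N^-1 by rewrite invr_gt0.
have N'r : N^-1 <= r / 4 by exact: le_trans r41.
pose e' := 3 - 2 * e.
have e'0 : 0 < e' by rewrite /e'; lra_from e32.
have e'3 : e' <= 3 by rewrite /e'; lra_from e0.
pose q := r `^ (- e').
have q0 : 0 < q by rewrite powR_gt0.
have rq : (r ^+ 3)^-1 <= q.
  by rewrite /q -powR_mulrn ?(ltW r0) // -powRN ler_powR // lerN2.
pose ph xi u := cos (chirp_phase r (omega xi ^+ 2) u + theta).
have cph xi u : 0 < u -> {for u, continuous (ph xi)}.
  by move=> u0; apply: chirp_continuous; rewrite gt_eqF.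
have cw u : {for u, continuous (low_weight r)} by rewrite /low_weight; cont.
have cw1 u : {for u, continuous (fun u => 1 - low_weight r u)} by rewrite /low_weight; cont.
have mw : measurable_fun setT (low_weight r : RR -> RR).
  by apply: continuous_measurable_fun => u; exact: cw.
have mw1 : measurable_fun setT ((fun u => 1 - low_weight r u) : RR -> RR).
  by apply: continuous_measurable_fun => u; exact: cw1.
have split4 xi : chirp r theta (omega xi ^+ 2) N =
   \int[mu]_(u in `[N^-1, r / 4]) (low_weight r u * ph xi u) +
   (\int[mu]_(u in `[N^-1, 1]) ((1 - low_weight r u) * ph xi u) +
    (\int[mu]_(u in `[1, r / 4]) ((1 - low_weight r u) * ph xi u) +
     \int[mu]_(u in `[r / 4, N]) (1 * ph xi u))).
  rewrite /chirp -/(ph xi) (@Rintegral_split _ _ (N^-1) (r / 4) N) //; last first.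
    by move=> u /andP[h _]; apply: cph; exact: lt_le_trans h.
  rewrite [in RHS]addrA [in RHS]addrA; congr (_ + _); last first.
    by apply: eq_Rintegral => u _; rewrite mul1r.
  have cl u : N^-1 <= u <= r / 4 -> {for u, continuous (fun u => low_weight r u * ph xi u)}.
    move=> /andP[h _]; rewrite /prop_for /continuous_at; apply: cvgM; first exact: cw.
    by apply: cph; exact: lt_le_trans h.
  have cl1 u : N^-1 <= u <= r / 4 -> {for u, continuous (fun u => (1 - low_weight r u) * ph xi u)}.
    move=> /andP[h _]; rewrite /prop_for /continuous_at; apply: cvgM; first exact: cw1.
    by apply: cph; exact: lt_le_trans h.
  rewrite -addrA -(@Rintegral_split _ _ _ 1 _ N'1 r41 cl1).
  rewrite -(@RintegralD _ _ _ mu `[N^-1, r / 4] (fun u => low_weight r u * ph xi u)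
    (fun u => (1 - low_weight r u) * ph xi u) (measurable_itv _)
    (segment_integrable cl) (segment_integrable cl1)).
  by apply: eq_Rintegral => u _; rewrite -[RHS]mulrDl [X in _ = X * _]addrC subrK mul1r.
have wI u : N^-1 <= u <= r / 4 -> 0 <= u <= r / 4.
  by move=> /andP[h1 h2]; rewrite h2 andbT (le_trans _ h1) // ltW.
have w1 u : N^-1 <= u <= r / 4 -> `|low_weight r u| <= 1.
  by move=> /wI /(low_weight_bounds r0)[/andP[h1 h2] _]; rewrite ger0_norm.
have w2 u : N^-1 <= u <= r / 4 -> `|1 - low_weight r u| <= 1.
  by move=> /wI /(low_weight_bounds r0)[/andP[h1 h2] _]; rewrite ger0_norm ?subr_ge0 // lerBlDr lerDl.
have i1 := cube_chirp_integrable x r theta mw w1.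
have i2 := @cube_chirp_integrable x r theta N^-1 1 _ mw1 _.
have i3 := @cube_chirp_integrable x r theta 1 (r / 4) _ mw1 _.
have i4 := @cube_chirp_integrable x r theta (r / 4) N (fun=> 1) _ _.
have {}i2 : lebesgue4.-integrable (@freq_cube R) (EFin \o (fun xi => cos (phase x xi) *
     \int[mu]_(u in `[N^-1, 1]) ((1 - low_weight r u) * ph xi u))).
  by apply: i2 => u /andP[h1 h2]; apply: w2; rewrite h1 (le_trans h2).
have {}i3 : lebesgue4.-integrable (@freq_cube R) (EFin \o (fun xi => cos (phase x xi) *
     \int[mu]_(u in `[1, r / 4]) ((1 - low_weight r u) * ph xi u))).
  by apply: i3 => u /andP[h1 h2]; apply: w2; rewrite h2 (le_trans _ h1).
have {}i4 : lebesgue4.-integrable (@freq_cube R) (EFin \o (fun xi => cos (phase x xi) *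
     \int[mu]_(u in `[r / 4, N]) (1 * ph xi u))).
  by apply: i4 => // u _; rewrite normr1.
have mc := @measurable_freq_cube R.
under eq_Rintegral do rewrite split4 2!mulrDr [in X in _ + (_ + X)]mulrDr.
have i34 := integrableD mc i3 i4.
have i234 := integrableD mc i2 i34.
rewrite RintegralD // RintegralD // RintegralD //.
have c0 : 0 <= 2 * c2 * K * q.
  by apply: mulr_ge0 (ltW q0); apply: mulr_ge0 (ltW K0); apply: mulr_ge0 (ltW c20).
pose rs (j : 'I_4) := resonance e `|(x ord0 j)%:~R|.
pose g (u : R) : R := 2 * c2 * K * q * \sum_(j < 4) rs j u.
have crs j u : 1 <= u <= N -> {for u, continuous (rs j)}.
  by move=> /andP[h _]; apply: resonance_continuous; apply: lt_le_trans h.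
have rsM j : \int[mu]_(u in `[1, N]) rs j u <= 2 / e.
  exact: (le_trans (ler_norm _) (resonance_integral _ e0 N1)).
have [cg gI] := Rintegral_weighted_sum4_le c0 N1 crs rsM.
have slice u rr : 1 <= u -> 0 <= rr -> rr <= c2 * (u / r) `^ e' ->
   rr * `|\int[lebesgue4]_(xi in @freq_cube R) (cos (phase x xi) * ph xi u)| <= g u.
  move=> u1 rr0 hrr.
  have u0 : 0 < u by exact: lt_le_trans u1.
  have un : u != 0 by rewrite gt_eqF.
  apply: (le_trans (ler_pM rr0 (normr_ge0 _) hrr (cube_chirp_slice x r theta u1))).
  rewrite /g !mulr_sumr; apply: ler_sum => j _; rewrite /rs /resonance -/K.
  set M := 1 + _.
  have M0 : 0 < M by rewrite ltr_pwDl.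
  rewrite powRM ?invr_ge0 ?(ltW r0) ?(ltW u0) //.
  have -> : r^-1 `^ e' = q by rewrite -powR_inv1 ?(ltW r0) // -powRrM /q; congr powR; ring.
  have -> : u `^ e' = u `^ (1 - 2 * e) * u ^+ 2.
    rewrite -[u ^+ 2]powR_mulrn ?(ltW u0) // -powRD ?un ?implybT //.
    by congr powR; rewrite /e'; ring.
  by rewrite le_eqVlt; apply/orP; left; apply/eqP; field; rewrite un gt_eqF.
have b1 : `|\int[lebesgue4]_(xi in @freq_cube R) (cos (phase x xi) *
     \int[mu]_(u in `[N^-1, r / 4]) (low_weight r u * ph xi u))| <= c1 * V * q.
  apply: (le_trans (cube_integral_le_integrable (M := c1 * q) i1 _)); last first.
    by rewrite mulrAC.
  move=> xi _; rewrite normrM; apply: (@le_trans _ _ (1 * (c1 / r ^+ 3))).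
    apply: ler_pM => //; first exact: cos_max.
    apply: (lowb) => //.
    - by apply: le_trans r4; rewrite ler_nat.
    - by rewrite sqr_ge0 omega_sqr_le.
    - by rewrite lef_pV2 ?posrE ?exprn_gt0.
  by rewrite mul1r ler_wpM2l // ltW.
have b2 : `|\int[lebesgue4]_(xi in @freq_cube R) (cos (phase x xi) *
     \int[mu]_(u in `[N^-1, 1]) ((1 - low_weight r u) * ph xi u))| <= c2 * V * q.
  have h := @cube_chirp_piece _ x r theta (N^-1) 1 (fun u => 1 - low_weight r u)
     (fun=> c2 * V * q) N'0 N'1 mw1 _ _ _.
  apply: (le_trans (h _ _ _)).
  - by move=> u /andP[h1 h2]; apply: w2; rewrite h1 (le_trans h2).
  - by move=> u _; exact: cst_continuous.
  - move=> u /andP[h1 h2].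
    have u0 : 0 <= u by apply: le_trans h1; exact: ltW.
    have uI : 0 <= u <= r / 4 by rewrite u0 (le_trans h2).
    have hw := highb _ _ r0 uI.
    have hV : `|\int[lebesgue4]_(xi in @freq_cube R) (cos (phase x xi) * ph xi u)| <= V.
      rewrite -[V]mul1r; apply: cube_integral_le.
        have := measurable_chirp_density x r theta (@measurable_cst _ _ RR RR setT 1).
        move=> /measurableT_comp /(_ (measurable_pair2 u)).
        by apply: eq_measurable_fun => xi _ /=; rewrite mul1r.
      by move=> xi _; rewrite normrM mulr_ile1 // cos_max.
    rewrite mulrAC; apply: ler_pM => //; apply: (le_trans hw).
    rewrite ler_wpM2l ?(ltW c20) // (le_trans _ rq) //.
    have -> : u ^+ 4 / r ^+ 4 = (u ^+ 4 / r) * (r ^+ 3)^-1 by field; rewrite gt_eqF.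
    apply: ler_piMl; first by rewrite invr_ge0 exprn_ge0 // ltW.
    by rewrite ler_pdivrMr // mul1r (le_trans _ r1) // exprn_ile1.
  have vol : fine (mu `[N^-1, 1]) <= 1.
    rewrite lebesgue_measure_itv /=; case: ifP => _ //=.
    by rewrite lerBlDr lerDl ltW.
  rewrite Rintegral_cst //; apply: ler_piMr vol.
  exact: (mulr_ge0 (mulr_ge0 (ltW c20) (ltW V0)) (ltW q0)).
have b34 : `|\int[lebesgue4]_(xi in @freq_cube R) (cos (phase x xi) *
     \int[mu]_(u in `[1, r / 4]) ((1 - low_weight r u) * ph xi u))| +
   `|\int[lebesgue4]_(xi in @freq_cube R) (cos (phase x xi) *
     \int[mu]_(u in `[r / 4, N]) (1 * ph xi u))| <= 2 * c2 * K * q * (4 * (2 / e)).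
  apply: (@le_trans _ _ (\int[mu]_(u in `[1, r / 4]) g u + \int[mu]_(u in `[r / 4, N]) g u)).
    apply: lerD.
      apply: cube_chirp_piece => //.
      - by move=> u /andP[h1 h2]; apply: w2; rewrite h2 (le_trans _ h1).
      - by move=> u /andP[h1 h2]; apply: cg; rewrite h1 (le_trans h2).
      - move=> u /andP[h1 h2]; have u0 : 0 < u by apply: lt_le_trans h1.
        have uI : 0 <= u <= r / 4 by rewrite (ltW u0).
        have hw := highb _ _ r0 uI.
        apply: slice => //; apply: (le_trans hw); rewrite ler_wpM2l ?(ltW c20) //.
        rewrite -expr_div_n -powR_mulrn ?divr_ge0 ?(ltW u0) ?(ltW r0) //.
        apply: ger_powR; first by rewrite divr_gt0 //= ler_pdivrMr // mul1r (le_trans h2) // ler_piMr ?(ltW r0) // invf_le1 // ler1n.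
        by apply: (le_trans e'3); rewrite ler_nat.
    apply: cube_chirp_piece => //.
    - by rewrite divr_gt0.
    - by move=> u _; rewrite normr1.
    - by move=> u /andP[h1 h2]; apply: cg; rewrite h2 (le_trans r41).
    - move=> u /andP[h1 h2]; rewrite normr1.
      apply: slice => //; first exact: le_trans h1.
      have h3 : 4^-1 `^ 3 <= 4^-1 `^ e' :> R by apply: ger_powR => //; rewrite invr_gt0 ltr0n invf_le1 ?ler1n.
      have h4 : 4^-1 `^ e' <= (u / r) `^ e'.
        rewrite ge0_ler_powR ?nnegrE ?(ltW e'0) ?invr_ge0 ?divr_ge0 ?(ltW r0) //.
          by apply: le_trans h1; rewrite divr_ge0 // ltW.
        by rewrite ler_pdivlMr // mulrC.
      by apply: (le_trans c2_64); rewrite ler_wpM2l ?(ltW c20) // (le_trans h3).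
  by rewrite -Rintegral_split.
move: b1 b2 b34; set X1 := Rintegral _ _ _; set X2 := Rintegral _ _ _.
set X3 := Rintegral _ _ _; set X4 := Rintegral _ _ _ => b1 b2 b34.
rewrite -/e' -/q.
apply: (le_trans (ler_normD _ _)).
have -> : (c1 * V + c2 * V + 2 * c2 * K * (4 * (2 / e))) * q =
  c1 * V * q + (c2 * V * q + 2 * c2 * K * q * (4 * (2 / e))) by ring.
apply: lerD => //; apply: (le_trans (ler_normD _ _)).
by apply: lerD => //; apply: (le_trans (ler_normD _ _)).
Qed.

End kernel_decay.

Section kernel_decay_final.
Variable R : realType.
Notation mu := (@lebesgue_measure R).
Notation RR := (measurableTypeR R).
Notation R4 := (RR * RR * (RR * RR))%type.
Local Notation green := (@Defs.kernel R).
Implicit Types (x : lattice) (xi : R4).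

Lemma multiplier_le (t : R) xi : `|sin (t * omega xi) / omega xi| <= `|t|.
Proof.
have [->|w0] := eqVneq (omega xi) 0; first by rewrite invr0 mulr0 normr0.
by rewrite normrM normfV ler_pdivrMr ?normr_gt0 // -normrM norm_sin_le.
Qed.

Lemma measurable_kernel_integrand x (t : R) :
  measurable_fun setT (fun xi : R4 => cos (phase x xi) * (sin (t * omega xi) / omega xi)).
Proof.
by apply: measurable_funM; [exact: measurable_cos_phase|exact: measurable_multiplier].
Qed.

Lemma kernel_integrand_le x (t : R) xi :
  `|cos (phase x xi) * (sin (t * omega xi) / omega xi)| <= `|t|.
Proof.
rewrite normrM -[leRHS]mul1r; apply: ler_pM => //; first exact: cos_max.
exact: multiplier_le.
Qed.

Lemma kernel_integrand_integrable x (t : R) : lebesgue4.-integrable (@freq_cube R)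
  (EFin \o (fun xi => cos (phase x xi) * (sin (t * omega xi) / omega xi))).
Proof.
apply: (@cube_integrable_bounded _ _ `|t|); first exact: measurable_kernel_integrand.
by move=> xi _; exact: kernel_integrand_le.
Qed.

Lemma kernel_le x (t : R) : `|green x t| <= `|t|.
Proof.
have V0 : 0 < (2 * pi) ^+ 4 :> R by rewrite exprn_gt0 // mulr_gt0 // pi_gt0.
rewrite /Defs.kernel normrM normfV (gtr0_norm V0) mulrC ler_pdivrMr //.
apply: cube_integral_le; first exact: measurable_kernel_integrand.
by move=> xi _; exact: kernel_integrand_le.
Qed.

Lemma kernelN x (t : R) : green x (- t) = - green x t.
Proof.
rewrite /Defs.kernel -mulrN -mulN1r; congr (_ * _).
rewrite -RintegralZl; [|exact: measurable_freq_cube|exact: kernel_integrand_integrable].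
by apply: eq_Rintegral => xi _; rewrite mulNr sinN; ring.
Qed.

Lemma eq0_of_inv_bound (a K : R) : (forall Y, 0 < Y -> `|a| <= K / Y) -> a = 0.
Proof.
move=> h; apply/eqP; rewrite -normr_le0; apply/ler_addgt0Pr => e e0; rewrite add0r.
have K0 : 0 < `|K| + 1 by rewrite ltr_wpDl.
apply: (le_trans (h ((`|K| + 1) / e) _)); first by rewrite divr_gt0.
rewrite invf_div mulrCA ler_piMr ?(ltW e0) // ler_pdivrMr // mul1r.
by rewrite (le_trans (ler_norm _)) // lerDl.
Qed.

(** FC and FS are the limits of the Fresnel integrals with phase 0 and -pi/2.
    The combination f_ of two chirps with these coefficients tends to (FC^2
    + FS^2) sin(t omega) / omega, where t = r^2, and FC is positive; the
    decay of the chirps is passed to the limit by dominated convergence. *)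
Lemma kernel_decay_large (e : R) : 0 < e < 3 / 2 -> exists2 C : R, 0 < C &
  forall x (r : R), 4 <= r -> `|green x (r ^+ 2)| <= C * r `^ (- (3 - 2 * e)).
Proof.
move=> eI; have [C C0 hC] := cube_chirp_decay eI.
have [FC hFC] := fresnel_limit (0 : R).
have [FS hFS] := fresnel_limit (- (pi / 2) : R).
have FC0 := fresnel_cos_pos hFC.
pose A0 := FC ^+ 2 + FS ^+ 2.
have A00 : 0 < A0 by rewrite ltr_pwDl ?sqr_ge0 // exprn_gt0.
pose V : R := (2 * pi) ^+ 4.
have V0 : 0 < V by rewrite exprn_gt0 // mulr_gt0 // pi_gt0.
pose S := `|FC| + `|FS|.
have S0 : 0 < S by rewrite ltr_pwDl // normr_gt0 gt_eqF.
(* The limit for a general phase shift, by the addition formula. *)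
have hL theta : forall Y, 0 < Y -> `|fresnel theta Y - (cos theta * FC - sin theta * FS)| <= Y^-1.
  have [L hL] := fresnel_limit theta.
  suff -> : cos theta * FC - sin theta * FS = L by [].
  apply/eqP; rewrite -subr_eq0; apply/eqP; apply: (@eq0_of_inv_bound _ 3) => Y Y0.
  have h1 := hL _ Y0; have h2 := hFC _ Y0; have h3 := hFS _ Y0.
  rewrite (_ : _ - L = (fresnel theta Y - L) - (cos theta * (fresnel 0 Y - FC) -
    sin theta * (fresnel (- (pi / 2)) Y - FS))); last first.
    by rewrite (fresnel_addition theta (ltW Y0)); ring.
  have h4 : `|cos theta * (fresnel 0 Y - FC)| <= 1 * Y^-1.
    by rewrite normrM ler_pM // cos_max.
  have h5 : `|sin theta * (fresnel (- (pi / 2)) Y - FS)| <= 1 * Y^-1.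
    by rewrite normrM ler_pM // sin_max.
  apply: (le_trans (ler_normB _ _)); have := ler_normB (cos theta * (fresnel 0 Y - FC))
    (sin theta * (fresnel (- (pi / 2)) Y - FS)).
  move: h1 h4 h5; clear; lra.
exists (S * C / A0 / V); first by rewrite !divr_gt0 // mulr_gt0.
move=> x r r4; pose t := r ^+ 2.
have r1 : 1 <= r by apply: le_trans r4; rewrite ler1n.
have t1 : 1 <= t by rewrite exprn_ege1.
pose N n : R := t + n%:R.
have hN n : n%:R + 1 <= N n by rewrite addrC lerD2r.
have N1 n : 1 <= N n by rewrite (le_trans t1) // lerDl.
have tN n : r ^+ 2 <= N n by rewrite lerDl.
pose c theta n (xi : R4) := cos (phase x xi) * chirp r theta (omega xi ^+ 2) (N n).
pose f_ n (xi : R4) := FC * c (- (pi / 2)) n xi - FS * c 0 n xi.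
pose f (xi : R4) := A0 * (cos (phase x xi) * (sin (t * omega xi) / omega xi)).
have mc := @measurable_freq_cube R.
have norm1_le1 : `|1 : R| <= 1 by rewrite normr1.
have ic theta n : lebesgue4.-integrable (@freq_cube R) (EFin \o c theta n).
  have h := @cube_chirp_integrable R x r theta (N n)^-1 (N n) (fun=> 1) (@measurable_cst _ _ RR RR setT 1).
  have h1 := h (fun u _ => norm1_le1).
  apply: eq_integrable h1 => // xi _ /=; rewrite /c; congr (_ * _)%:E.
  by apply: eq_Rintegral => u _; rewrite mul1r.
have iFc theta n F : lebesgue4.-integrable (@freq_cube R) (EFin \o (fun xi => F * c theta n xi)).
  by have := integrableZl mc F (ic theta n); exact.
have if_ n : lebesgue4.-integrable (@freq_cube R) (EFin \o f_ n).
  by have := integrableB mc (iFc (- (pi / 2)) n FC) (iFc 0 n FS); exact.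
have If_ n : `|\int[lebesgue4]_(xi in @freq_cube R) f_ n xi| <= S * C * r `^ (- (3 - 2 * e)).
  rewrite /f_ RintegralB // RintegralZl // RintegralZl //.
  apply: (le_trans (ler_normB _ _)); rewrite !normrM (_ : S * C * _ = `|FC| * (C * r `^ (- (3 - 2 * e))) +
    `|FS| * (C * r `^ (- (3 - 2 * e)))); last by rewrite /S; ring.
  by apply: lerD; rewrite ler_wpM2l //; exact: hC.
pose g (xi : R4) : R := S * (4 + r ^+ 2) + S * (4 + r ^+ 2) * (omega xi ^+ 2)^-1.
have ig : lebesgue4.-integrable (@freq_cube R) (EFin \o g).
  have i1 : lebesgue4.-integrable (@freq_cube R) (EFin \o (fun=> S * (4 + r ^+ 2))).
    by apply: (@cube_integrable_bounded _ _ `|S * (4 + r ^+ 2)|).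
  have i2 := integrableZl mc (S * (4 + r ^+ 2)) (omega_inv_sqr_integrable R).
  by have := integrableD mc i1 i2; exact.
have chirp_le theta n xi : omega xi != 0 -> `|c theta n xi| <= (4 + r ^+ 2) * (1 + (omega xi ^+ 2)^-1).
  move=> w0; have w1 : 0 < omega xi by rewrite lt_neqAle eq_sym w0 omega_ge0.
  rewrite normrM -[leRHS]mul1r; apply: ler_pM => //; first exact: cos_max.
  exact: chirp_bound.
have dom n xi : omega xi != 0 -> `|f_ n xi| <= g xi.
  move=> w0; have h1 := chirp_le (- (pi / 2)) n xi w0; have h2 := chirp_le 0 n xi w0.
  apply: (le_trans (ler_normB _ _)); rewrite (normrM FC) (normrM FS) (_ : g xi = `|FC| * ((4 + r ^+ 2) * (1 + (omega xi ^+ 2)^-1)) +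
    `|FS| * ((4 + r ^+ 2) * (1 + (omega xi ^+ 2)^-1))); last by rewrite /g /S; ring.
  by apply: lerD; apply: ler_wpM2l.
have lim xi : omega xi != 0 -> f_ n xi @[n --> \oo] --> f xi.
  move=> w0; have w1 : 0 < omega xi by rewrite lt_neqAle eq_sym w0 omega_ge0.
  pose a := t * omega xi.
  have l1 := @chirp_limit _ r (- (pi / 2)) (omega xi) _ N r1 w1 (hL _) hN.
  have l2 := @chirp_limit _ r 0 (omega xi) _ N r1 w1 (hL _) hN.
  have fE : f xi = FC * (cos (phase x xi) * ((omega xi)^-1 *
      (cos (- (pi / 2) + a) * FC - sin (- (pi / 2) + a) * FS))) -
      FS * (cos (phase x xi) * ((omega xi)^-1 * (cos (0 + a) * FC - sin (0 + a) * FS))).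
    rewrite add0r [_ + a]addrC cosBpihalf sinBpihalf /f /A0 -/a; ring.
  rewrite fE; apply: cvgB; (apply: cvgM; first exact: cvg_cst);
    (apply: cvgM; first exact: cvg_cst); [exact: l1|exact: l2].
have mf_ n : measurable_fun (@freq_cube R) (EFin \o f_ n) by case/integrableP: (if_ n).
have mf : measurable_fun (@freq_cube R) (EFin \o f).
  apply: measurable_funTS; apply/measurable_EFinP; apply: measurable_funM => //.
  exact: measurable_kernel_integrand.
have [fi _ cf] : [/\ lebesgue4.-integrable (@freq_cube R) (EFin \o f),
    [sequence (\int[lebesgue4]_(xi in @freq_cube R) `|(EFin \o f_ n) xi - (EFin \o f) xi|)%E]_n @ \oo --> 0%E &
    [sequence (\int[lebesgue4]_(xi in @freq_cube R) (EFin \o f_ n) xi)%E]_n @ \oo -->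
      (\int[lebesgue4]_(xi in @freq_cube R) (EFin \o f) xi)%E].
  apply: (@dominated_convergence _ _ _ lebesgue4 _ mc (fun n => EFin \o f_ n) (EFin \o f) (EFin \o g)) => //.
  - apply: filterS (omega_neq0_ae R) => xi h cxi; apply: cvg_EFin; first by near=> n.
    exact: (lim _ (h cxi)).
  - apply: filterS (omega_neq0_ae R) => xi h n cxi.
    by rewrite /= lee_fin; exact: (dom _ _ (h cxi)).
have fB : `|\int[lebesgue4]_(xi in @freq_cube R) f xi| <= S * C * r `^ (- (3 - 2 * e)).
  have cf' : \int[lebesgue4]_(xi in @freq_cube R) f_ n xi @[n --> \oo] -->
      \int[lebesgue4]_(xi in @freq_cube R) f xi.
    apply: fine_cvg; rewrite /= fineK; first exact: cf.
    exact: integrable_fin_num.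
  apply/ler_addgt0Pr => d d0.
  have /cvgrPdist_le /(_ d d0)[n _ hn] := cf'.
  have := hn n (leqnn n); set I := Rintegral _ _ _; set J := Rintegral _ _ _ => h.
  rewrite -[I](subrK J) addrC (le_trans (ler_normD _ _)) // lerD //.
  exact: If_.
move: fB; rewrite /f RintegralZl //; last exact: kernel_integrand_integrable.
rewrite normrM (gtr0_norm A00) => fB.
rewrite /Defs.kernel normrM normfV (gtr0_norm V0).
rewrite -/t -/V mulrC ler_pdivrMr //.
rewrite (_ : S * C / A0 / V * _ * V = S * C * r `^ (- (3 - 2 * e)) / A0); last first.
  by field; rewrite !gt_eqF.
by rewrite ler_pdivlMr // mulrC.
Unshelve. all: by end_near. Qed.

(** Times below 16 are covered by |G(x,t)| <= |t|. *)
Lemma kernel_decay (e : R) : 0 < e < 3 / 2 -> exists2 C : R, 0 < C &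
  forall x (t : R), `|green x t| <= C * (1 + `|t|) `^ (- (3 / 2 - e)).
Proof.
move=> eI; have [C C0 hC] := kernel_decay_large eI.
pose b := 3 / 2 - e; have b0 : 0 < b by move/andP: eI => [_ h]; rewrite subr_gt0.
have p0 (y : R) : 0 < 1 + `|y| by rewrite ltr_pwDl.
exists (C * 2 `^ b + 16 * 17 `^ b).
  by rewrite addr_gt0 ?mulr_gt0 // powR_gt0.
move=> x t; wlog t0 : t / 0 <= t.
  move=> h; have [t0|/ltW t0] := leP 0 t; first exact: h.
  by have := h (- t); rewrite kernelN !normrN oppr_ge0; exact.
rewrite (ger0_norm t0) -/b mulrDl.
have q0 : 0 < (1 + t) `^ (- b) by rewrite powR_gt0 // ltr_pwDl.
have [t16|t16] := leP 16 t; last first.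
  rewrite -[leLHS]add0r; apply: lerD; first by rewrite !mulr_ge0 ?powR_ge0 // ltW.
  apply: (le_trans (kernel_le x t)); rewrite (ger0_norm t0) -mulrA.
  apply: (@le_trans _ _ (16 * 1)); first by rewrite mulr1 ltW.
  rewrite ler_wpM2l // powRN ler_pdivlMr ?powR_gt0 ?ltr_pwDl // mul1r.
  by rewrite ge0_ler_powR ?nnegrE ?(ltW b0) //; lra_from t0 t16.
rewrite -[leLHS]addr0; apply: lerD; last by rewrite !mulr_ge0 ?powR_ge0.
pose r := Num.sqrt t; have r2 : r ^+ 2 = t by rewrite sqr_sqrtr.
have r4 : 4 <= r.
  by rewrite -(@ler_pXn2r _ 2) ?nnegrE ?sqrtr_ge0 // r2 (le_trans _ t16) // -natrX.
have r0 : 0 <= r by exact: sqrtr_ge0.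
rewrite -r2; apply: (le_trans (hC x r r4)).
rewrite -mulrA ler_wpM2l ?(ltW C0) //.
have -> : r `^ (- (3 - 2 * e)) = t `^ (- b).
  by rewrite -r2 -powR_mulrn // -powRrM; congr powR; rewrite /b; field.
rewrite r2 !powRN ler_pdivlMr ?powR_gt0 ?ltr_pwDl // mulrC.
rewrite ler_pdivrMr ?powR_gt0 ?(lt_le_trans _ t16) //.
rewrite -powRM //; apply: ge0_ler_powR; rewrite ?nnegrE ?(ltW b0) ?mulr_ge0 //; lra_from t0 t16.
Qed.

End kernel_decay_final.

(** * The l^2 and l^1 norms of the kernel *)

Section kernel_summation.
Variable R : realType.
Notation RR := (measurableTypeR R).
Notation R4 := (RR * RR * (RR * RR))%type.
Local Notation green := (@Defs.kernel R).
Local Notation V := ((2 * pi) ^+ 4 : R).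
Implicit Types (x y : lattice) (xi : R4) (X : seq lattice).

Lemma cube_volume_gt0 : 0 < V.
Proof. by rewrite exprn_gt0 // mulr_gt0 // pi_gt0. Qed.

Lemma sin_lipschitz (a b : R) : `|sin a - sin b| <= `|a - b|.
Proof.
pose u := (a + b) / 2; pose v := (a - b) / 2.
have ea : a = u + v by rewrite /u /v; field.
have eb : b = u - v by rewrite /u /v; field.
have -> : sin a - sin b = 2 * cos u * sin v.
  by rewrite [in LHS]ea [in LHS]eb sinD sinB; ring.
have -> : a - b = 2 * v by rewrite /v; field.
rewrite -mulrA (normrM 2) (normrM 2 v) ler_wpM2l // normrM.
by rewrite -[leRHS]mul1r; apply: ler_pM => //; [exact: cos_max|exact: norm_sin_le].
Qed.

Lemma kernel_lipschitz x (t s : R) : `|green x t - green x s| <= `|t - s|.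
Proof.
have V0 := cube_volume_gt0.
rewrite /Defs.kernel -mulrBr normrM normfV (gtr0_norm V0) mulrC ler_pdivrMr //.
rewrite -RintegralB; try exact: kernel_integrand_integrable; last exact: measurable_freq_cube.
apply: cube_integral_le.
  by apply: measurable_funB; exact: measurable_kernel_integrand.
move=> xi _; rewrite -mulrBr -mulrBl normrM.
have [->|w0] := eqVneq (omega xi) 0; first by rewrite invr0 !mulr0 normr0 mulr0.
rewrite -[leRHS]mul1r; apply: ler_pM => //; first exact: cos_max.
rewrite normrM normfV ler_pdivrMr ?normr_gt0 // -normrM mulrBl.
exact: sin_lipschitz.
Qed.

Lemma kernel_continuous x : continuous (green x).
Proof.
move=> t; apply/cvgrPdist_le => e e0; near=> s.
apply: (le_trans (kernel_lipschitz x t s)).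
near: s; apply: (@cvgr_dist_le _ _ _ (nbhs t) _ id t) => //; exact: cvg_id.
Unshelve. all: by end_near. Qed.

Lemma phaseD x y xi : phase (x + y) xi = phase x xi + phase y xi.
Proof.
by rewrite /phase -big_split; apply: eq_bigr => j _; rewrite /= mxE intrD mulrDl.
Qed.

(** Bessel's inequality: the multiplier is compared with the cosine polynomial
    built from its Fourier coefficients. Adding the square of the corresponding
    sine polynomial turns all products into cos((x-y).xi), whose integrals
    vanish unless x = y. *)
Lemma kernel_sum_sqr_le : exists2 C : R, 0 < C &
  forall (t : R) X, uniq X -> \sum_(x <- X) green x t ^+ 2 <= C ^+ 2.
Proof.
have V0 := cube_volume_gt0.
have mc := @measurable_freq_cube R.
pose J := \int[lebesgue4]_(xi in @freq_cube R) (omega xi ^+ 2)^-1.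
have J0 : 0 <= J by apply: Rintegral_ge0 => xi _; rewrite invr_ge0 sqr_ge0.
exists (Num.sqrt (V^-1 * J + 1)); first by rewrite sqrtr_gt0 ltr_wpDl // mulr_ge0 // invr_ge0 ltW.
move=> t X uX; rewrite sqr_sqrtr; last by rewrite addr_ge0 // mulr_ge0 // invr_ge0 ltW.
apply: (@le_trans _ _ (V^-1 * J)); last by rewrite lerDl.
pose m xi := sin (t * omega xi) / omega xi.
pose c x := green x t.
pose p (z : lattice * lattice) xi := c z.1 * c z.2 * cos (phase (z.1 - z.2) xi).
pose q x xi := c x * (cos (phase x xi) * m xi).
have ip z : lebesgue4.-integrable (@freq_cube R) (EFin \o p z).
  apply: (@cube_integrable_bounded _ _ `|c z.1 * c z.2|).
    by apply: measurable_funM => //; exact: measurable_cos_phase.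
  by move=> xi _; rewrite normrM ler_piMr // cos_max.
have iq x : lebesgue4.-integrable (@freq_cube R) (EFin \o q x).
  by have := integrableZl mc (c x) (kernel_integrand_integrable x t); exact.
have Iq x : \int[lebesgue4]_(xi in @freq_cube R) q x xi = V * c x ^+ 2.
  rewrite RintegralZl //; last exact: kernel_integrand_integrable.
  have -> : \int[lebesgue4]_(xi in @freq_cube R) (cos (phase x xi) * m xi) = V * c x.
    by rewrite /c /Defs.kernel mulrA mulfV ?gt_eqF // mul1r.
  by ring.
pose P xi := \sum_(z <- allpairs pair X X) p z xi.
pose Q xi := \sum_(x <- X) q x xi.
have iP : lebesgue4.-integrable (@freq_cube R) (EFin \o P) by exact: Rintegrable_sum.
have iQ : lebesgue4.-integrable (@freq_cube R) (EFin \o Q) by exact: Rintegrable_sum.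
have IQ : \int[lebesgue4]_(xi in @freq_cube R) Q xi = V * \sum_(x <- X) c x ^+ 2.
  by rewrite Rintegral_sum // mulr_sumr; apply: eq_bigr => x _; rewrite Iq.
have IP : \int[lebesgue4]_(xi in @freq_cube R) P xi = V * \sum_(x <- X) c x ^+ 2.
  rewrite Rintegral_sum // big_allpairs_dep /= mulr_sumr; apply: eq_big_seq => x xX.
  rewrite (bigD1_seq x) //= big1 ?addr0; last first.
    move=> y yx; rewrite /p /= RintegralZl //; last first.
      apply: (@cube_integrable_bounded _ _ 1) => [|xi _]; [exact: measurable_cos_phase|exact: cos_max].
    by rewrite cube_orthogonality ?mulr0 // subr_eq0 eq_sym.
  rewrite /p /= subrr (@eq_Rintegral _ _ _ _ _ (fun=> c x * c x)); last first.
    by move=> xi _; rewrite phase0 cos0 mulr1.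
  by rewrite Rintegral_cst // cube_volume expr2 mulrC.
have PE xi : P xi = (\sum_(x <- X) c x * cos (phase x xi)) ^+ 2 + (\sum_(x <- X) c x * sin (phase x xi)) ^+ 2.
  rewrite /P big_allpairs_dep /= !sqr_sum -big_split; apply: eq_bigr => x _ /=.
  rewrite -big_split; apply: eq_bigr => y _ /=.
  by rewrite /p /= phaseD phase_opp cosB; ring.
have QE xi : Q xi = m xi * \sum_(x <- X) c x * cos (phase x xi).
  by rewrite mulr_sumr; apply: eq_bigr => x _; rewrite /q; ring.
have key xi : 2 * Q xi - P xi <= (omega xi ^+ 2)^-1.
  apply: (@le_trans _ _ (m xi ^+ 2)).
    rewrite PE QE; set a := \sum_(x <- X) _; set b := \sum_(x <- X) _.
    have := sqr_ge0 (m xi - a); have := sqr_ge0 b; clear; nra.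
  have s1 : sin (t * omega xi) ^+ 2 <= 1 by rewrite -(cos2Dsin2 (t * omega xi)) lerDr sqr_ge0.
  have w0 : 0 <= (omega xi ^+ 2)^-1 by rewrite invr_ge0 sqr_ge0.
  by rewrite /m exprMn exprVn; exact: ler_piMl.
have i2Q : lebesgue4.-integrable (@freq_cube R) (EFin \o (fun xi => 2 * Q xi)).
  by have := integrableZl mc 2 iQ; exact.
have h : \int[lebesgue4]_(xi in @freq_cube R) (2 * Q xi - P xi) <= J.
  apply: le_Rintegral => //; last exact: omega_inv_sqr_integrable.
  by have := integrableB mc i2Q iP; exact.
rewrite RintegralB // RintegralZl // IQ IP in h.
rewrite ler_pdivlMl //; apply: le_trans h; rewrite -/c.
by rewrite mulrA -mulrBl [leRHS](_ : _ = V * \sum_(x <- X) c x ^+ 2) //; ring.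
Qed.

(** Up to a sign and a factorial, the coefficient of t^(2j+1) in the kernel. *)
Definition moment j x : R :=
  V^-1 * \int[lebesgue4]_(xi in @freq_cube R) (cos (phase x xi) * (omega xi ^+ 2) ^+ j).

Lemma moment_integrable j x : lebesgue4.-integrable (@freq_cube R)
  (EFin \o (fun xi => cos (phase x xi) * (omega xi ^+ 2) ^+ j)).
Proof.
apply: (@cube_integrable_bounded _ _ (16 ^+ j)).
  apply: measurable_funM; first exact: measurable_cos_phase.
  by apply: measurable_funX; exact: measurable_omega_sqr.
move=> xi _; rewrite normrM -[leRHS]mul1r; apply: ler_pM => //; first exact: cos_max.
rewrite ger0_norm ?exprn_ge0 ?omega_ge0 //.
by apply: lerXn2r; rewrite ?nnegrE ?sqr_ge0 ?omega_sqr_le ?ler0n.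
Qed.

Lemma moment0 x : moment 0 x = (x == 0)%:R.
Proof.
rewrite /moment; under eq_Rintegral do rewrite expr0 mulr1.
have [->|x0] := eqVneq x 0; last by rewrite cube_orthogonality ?mulr0.
rewrite (@eq_Rintegral _ _ _ _ _ (fun=> 1)); last first.
  by move=> xi _; rewrite phase0 cos0.
rewrite Rintegral_cst ?cube_volume ?mul1r ?mulVf ?gt_eqF ?cube_volume_gt0 //.
exact: measurable_freq_cube.
Qed.

Definition unit_step (m : 'I_4) : lattice := delta_mx 0 m.

Lemma phase_step m xi : phase (unit_step m) xi = freq_coord xi m.
Proof.
rewrite /phase (bigD1 m) //= big1 ?addr0 => [|j jm]; first by rewrite mxE !eqxx mul1r.
by rewrite mxE eqxx (negbTE jm) mul0r.
Qed.

(** Multiplication by omega^2 is minus the discrete Laplacian. *)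
Lemma momentS j x : moment j.+1 x =
  8 * moment j x - \sum_(m < 4) (moment j (x + unit_step m) + moment j (x - unit_step m)).
Proof.
have mc := @measurable_freq_cube R.
pose g y xi := cos (phase y xi) * (omega xi ^+ 2) ^+ j.
have ig y : lebesgue4.-integrable (@freq_cube R) (EFin \o g y) by exact: moment_integrable.
pose s xi := \sum_(m < 4) (g (x + unit_step m) xi + g (x - unit_step m) xi).
have ig2 m : lebesgue4.-integrable (@freq_cube R)
    (EFin \o (fun xi => g (x + unit_step m) xi + g (x - unit_step m) xi)).
  by have := integrableD mc (ig (x + unit_step m)) (ig (x - unit_step m)); exact.
have is_ : lebesgue4.-integrable (@freq_cube R) (EFin \o s) by exact: Rintegrable_sum.
have ig8 : lebesgue4.-integrable (@freq_cube R) (EFin \o (fun xi => 8 * g x xi)).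
  by have := integrableZl mc 8 (ig x); exact.
have E xi : cos (phase x xi) * (omega xi ^+ 2) ^+ j.+1 = 8 * g x xi - s xi.
  rewrite /s; transitivity (8 * g x xi - \sum_(m < 4) (2 * cos (freq_coord xi m)) * g x xi); last first.
    congr (_ - _); apply: eq_bigr => m _.
    by rewrite /g !phaseD phase_opp phase_step cosD cosB; ring.
  rewrite exprSr mulrA -/(g x xi) [in X in _ * X]omega_sqr sumrB -mulr_suml mulrBr.
  by congr (_ - _); [rewrite sumr_const card_ord; ring|ring].
rewrite /moment (@eq_Rintegral _ _ _ _ _ (fun xi => 8 * g x xi - s xi)); last by move=> xi _; exact: E.
rewrite RintegralB // RintegralZl // /s Rintegral_sum // mulrBr; congr (_ - _); first by ring.
by rewrite mulr_sumr; apply: eq_bigr => m _; rewrite RintegralD // mulrDr.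
Qed.

Lemma moment_sum_le j X : uniq X -> \sum_(x <- X) `|moment j x| <= 16 ^+ j.
Proof.
elim: j X => [|j IH] X uX.
  under eq_bigr do rewrite moment0 normr_nat.
  have [X0|X0] := boolP (0 \in X).
    rewrite (bigD1_seq 0) //= eqxx big1 ?addr0 // => y; by move=> /negbTE ->.
  by rewrite big_seq big1 // => y yX; case: eqP => // y0; rewrite -y0 yX in X0.
have sh (y : lattice) : \sum_(x <- X) `|moment j (x + y)| <= 16 ^+ j.
  have -> : \sum_(x <- X) `|moment j (x + y)| = \sum_(x <- [seq x + y | x <- X]) `|moment j x|.
    by rewrite big_map.
  by apply: IH; rewrite map_inj_uniq //; exact: addIr.
apply: (@le_trans _ _ (\sum_(x <- X) (8 * `|moment j x| +
    \sum_(m < 4) (`|moment j (x + unit_step m)| + `|moment j (x - unit_step m)|)))).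
  apply: ler_sum => x _; rewrite momentS (le_trans (ler_normB _ _)) //.
  apply: lerD; first by rewrite normrM normr_nat.
  by apply: (le_trans (ler_norm_sum _ _ _)); apply: ler_sum => m _; exact: ler_normD.
rewrite big_split /= -mulr_sumr exchange_big /= exprS.
have -> : 16 * 16 ^+ j = 8 * 16 ^+ j + \sum_(m < 4) (16 ^+ j + 16 ^+ j) :> R.
  by rewrite sumr_const card_ord -mulr_natr; ring.
apply: lerD; first by apply: ler_wpM2l => //; exact: IH.
by apply: ler_sum => m _; rewrite big_split; apply: lerD; exact: sh.
Qed.

(** The partial sums of the power series in t are combinations of moments, so
    their l^1 norms are bounded by the exponential series; dominated
    convergence identifies their limit with the kernel. *)
Lemma kernel_sum_norm_le (t : R) X : uniq X -> \sum_(x <- X) `|green x t| <= expR (4 * `|t|).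
Proof.
move=> uX; have mc := @measurable_freq_cube R; have V0 := cube_volume_gt0.
pose c j : R := (-1) ^+ j * t ^+ j.*2.+1 / j.*2.+1`!%:R.
pose f_ n xi := \sum_(0 <= j < n) c j * (cos (phase 0 xi) * (omega xi ^+ 2) ^+ j).
have cB n : \sum_(0 <= j < n) `|c j| * 16 ^+ j <= expR (4 * `|t|).
  apply: le_trans (@odd_exp_sum_le _ (4 * `|t|) n _); last by rewrite mulr_ge0.
  apply: ler_sum => j _; rewrite /c !normrM normrX normrN1 expr1n mul1r normfV normr_nat normrX.
  rewrite mulrAC ler_wpM2r ?invr_ge0 // exprMn [leRHS]mulrC ler_wpM2l ?exprn_ge0 //.
  rewrite (_ : 16 = 4 ^+ 2 :> R) -?exprM ?mul2n; last by rewrite -natrX.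
  by rewrite ler_weXn2l // ler1n.
pose G n x := \sum_(0 <= j < n) c j * moment j x.
have GB n : \sum_(x <- X) `|G n x| <= expR (4 * `|t|).
  apply: le_trans (cB n).
  apply: (@le_trans _ _ (\sum_(x <- X) \sum_(0 <= j < n) `|c j| * `|moment j x|)).
    apply: ler_sum => x _; apply: (le_trans (ler_norm_sum _ _ _)).
    by apply: ler_sum => j _; rewrite normrM.
  rewrite exchange_big /=; apply: ler_sum => j _; rewrite -mulr_sumr ler_wpM2l //.
  exact: moment_sum_le.
suff Gcvg x : G n x @[n --> \oo] --> green x t.
  have cs : (\sum_(x <- X) `|G n x|) @[n --> \oo] --> \sum_(x <- X) `|green x t|.
    by apply: cvg_sum_seq => x; apply: cvg_norm; exact: Gcvg.
  rewrite -(cvg_lim _ cs) //; apply: limr_le; first by apply/cvg_ex; eexists; exact: cs.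
  by near=> n; exact: GB.
pose h_ n xi := \sum_(0 <= j < n) c j * (cos (phase x xi) * (omega xi ^+ 2) ^+ j).
pose h xi := cos (phase x xi) * (sin (t * omega xi) / omega xi).
have i1 j : lebesgue4.-integrable (@freq_cube R)
    (EFin \o (fun xi => c j * (cos (phase x xi) * (omega xi ^+ 2) ^+ j))).
  by have := integrableZl mc (c j) (moment_integrable j x); exact.
have ih n : lebesgue4.-integrable (@freq_cube R) (EFin \o h_ n) by exact: Rintegrable_sum.
have GE n : G n x = V^-1 * \int[lebesgue4]_(xi in @freq_cube R) h_ n xi.
  rewrite /h_ Rintegral_sum // mulr_sumr; apply: eq_bigr => j _.
  by rewrite RintegralZl //; [rewrite /moment; ring|exact: moment_integrable].
have dom n xi : `|h_ n xi| <= expR (4 * `|t|).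
  apply: le_trans (cB n); apply: (le_trans (ler_norm_sum _ _ _)).
  apply: ler_sum => j _; rewrite normrM ler_wpM2l //.
  rewrite normrM -[leRHS]mul1r; apply: ler_pM => //; first exact: cos_max.
  rewrite ger0_norm ?exprn_ge0 ?omega_ge0 //.
  by apply: lerXn2r; rewrite ?nnegrE ?sqr_ge0 ?omega_sqr_le ?ler0n.
have lim xi : omega xi != 0 -> h_ n xi @[n --> \oo] --> h xi.
  move=> w0; have cs := @cvg_sin_coeff' R (t * omega xi).
  have -> : (fun n => h_ n xi) = (fun n => cos (phase x xi) * ((series (sin_coeff' (t * omega xi)) n) / omega xi)).
    apply/funext => n; rewrite /h_ /series /= mulr_suml mulr_sumr; apply: eq_bigr => j _.
    rewrite /sin_coeff' /c -exprnP (exprMn j.*2.+1 t (omega xi)) -exprM mul2n [omega xi ^+ j.*2.+1]exprS.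
    by field; rewrite w0 pnatr_eq0 -lt0n fact_gt0.
  by apply: cvgM; [exact: cvg_cst|apply: cvgM; [exact: cs|exact: cvg_cst]].
have mh n : measurable_fun (@freq_cube R) (EFin \o h_ n) by case/integrableP: (ih n).
have mh0 : measurable_fun (@freq_cube R) (EFin \o h) by case/integrableP: (kernel_integrand_integrable x t).
pose B := expR (4 * `|t|).
have iB : lebesgue4.-integrable (@freq_cube R) (EFin \o (fun=> B)).
  by apply: (@cube_integrable_bounded _ _ `|B|).
have [hi _ ch] : [/\ lebesgue4.-integrable (@freq_cube R) (EFin \o h),
    [sequence (\int[lebesgue4]_(xi in @freq_cube R) `|(EFin \o h_ n) xi - (EFin \o h) xi|)%E]_n @ \oo --> 0%E &
    [sequence (\int[lebesgue4]_(xi in @freq_cube R) (EFin \o h_ n) xi)%E]_n @ \oo -->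
      (\int[lebesgue4]_(xi in @freq_cube R) (EFin \o h) xi)%E].
  apply: (@dominated_convergence _ _ _ lebesgue4 _ mc (fun n => EFin \o h_ n) (EFin \o h) (EFin \o (fun=> B))) => //.
  - apply: filterS (omega_neq0_ae R) => xi h' cxi; apply: cvg_EFin; first by near=> n.
    exact: (lim _ (h' cxi)).
  - by apply: aeW => xi n _; rewrite /= lee_fin; exact: dom.
have -> : (fun n => G n x) = (fun n => V^-1 * \int[lebesgue4]_(xi in @freq_cube R) h_ n xi).
  by apply/funext.
rewrite /Defs.kernel; apply: cvgM; first exact: cvg_cst.
apply: fine_cvg; rewrite /= fineK; first exact: ch.
exact: integrable_fin_num.
Unshelve. all: by end_near. Qed.

End kernel_summation.

(** * Sums over the lattice *)

Section lattice_sums.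
Variable R : realType.
Local Notation nu := (@counting lattice R).
Implicit Types (x y : lattice) (h : lattice -> R) (X : seq lattice).

(** The l^1 and l^2 norms are bounded through all finite sums: these pass to
    pointwise limits and combine with finite-sum inequalities. *)
Definition sum_norm_le h (B : R) : Prop :=
  forall X, uniq X -> \sum_(x <- X) `|h x| <= B.

Definition sum_sqr_le h (B : R) : Prop :=
  forall X, uniq X -> \sum_(x <- X) h x ^+ 2 <= B ^+ 2.

Lemma sum_norm_le_point h B x : sum_norm_le h B -> `|h x| <= B.
Proof. by move=> /(_ [:: x] isT); rewrite big_seq1. Qed.

Lemma sum_norm_le_ge0 h B : sum_norm_le h B -> 0 <= B.
Proof. by move=> /(_ [::] isT); rewrite big_nil. Qed.

Lemma sum_sqr_le_point h B x : 0 <= B -> sum_sqr_le h B -> `|h x| <= B.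
Proof.
move=> B0 /(_ [:: x] isT); rewrite big_seq1 -real_normK ?num_real //.
by rewrite ler_pXn2r // nnegrE.
Qed.

Lemma sum_norm_le_scale h g (c B : R) : (forall x, `|g x| <= c * `|h x|) -> 0 <= c ->
  sum_norm_le h B -> sum_norm_le g (c * B).
Proof.
move=> gh c0 hB X uX; apply: (@le_trans _ _ (\sum_(x <- X) c * `|h x|)).
  by apply: ler_sum => x _; exact: gh.
by rewrite -mulr_sumr ler_wpM2l // hB.
Qed.

Lemma sum_norm_le_reflect h B x : sum_norm_le h B -> sum_norm_le (fun y => h (x - y)) B.
Proof.
move=> hB X uX; have -> : \sum_(y <- X) `|h (x - y)| = \sum_(y <- [seq x - y | y <- X]) `|h y|.
  by rewrite big_map.
by apply: hB; rewrite map_inj_uniq // => a b /addrI /oppr_inj.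
Qed.

Lemma sum_sqr_le_shift h B y : sum_sqr_le h B -> sum_sqr_le (fun x => h (x - y)) B.
Proof.
move=> hB X uX; have -> : \sum_(x <- X) h (x - y) ^+ 2 = \sum_(x <- [seq x - y | x <- X]) h x ^+ 2.
  by rewrite big_map.
by apply: hB; rewrite map_inj_uniq //; exact: addIr.
Qed.

Lemma lattice_measurable (A : set lattice) : measurable A. Proof. by []. Qed.

Lemma lattice_measurable_fun d (T : measurableType d) (D : set lattice) (h : lattice -> T) :
  measurable_fun D h.
Proof. by move=> _ Y _; exact: lattice_measurable. Qed.

Lemma counting_set1 x : nu [set x] = 1%:E.
Proof.
have fx : finite_set [set x] by exact: finite_set1.
by rewrite /= /counting asboolT // (@fset_set1 lattice) finmap.cardfs1.
Qed.

(** Summation over X as an integral against the counting measure: the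
    restriction of h to X as a sum of point masses. *)
Definition finite_part X h (y : lattice) : R := \sum_(x <- X) h x * \1_[set x] y.

Lemma finite_partE X h y : uniq X -> finite_part X h y = if y \in X then h y else 0.
Proof.
move=> uX; have E x : x != y -> h x * \1_[set x] y = 0.
  by move=> xy; rewrite indicE memNset ?mulr0 // => /= e; rewrite e eqxx in xy.
case: ifPn => yX.
  rewrite /finite_part (bigD1_seq y) //= big1 ?addr0 => [|x xy]; last exact: E.
  by rewrite indicE mem_set ?mulr1.
rewrite /finite_part big_seq big1 // => x xX; apply: E.
by apply: contraNneq yX => <-.
Qed.

Lemma point_mass_integrable h x : nu.-integrable setT (EFin \o (fun y => h x * \1_[set x] y)).
Proof.
have i1 : nu.-integrable setT (EFin \o (\1_[set x] : lattice -> R)).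
  apply/integrableP; split; first exact: lattice_measurable_fun.
  under eq_integral do rewrite /= ger0_norm //.
  by rewrite integral_indic // setIT [X in (X < _)%E](counting_set1 x) ltry.
by have := integrableZl measurableT (h x) i1; exact.
Qed.

Lemma finite_part_integrable X h : nu.-integrable setT (EFin \o finite_part X h).
Proof. by apply: Rintegrable_sum => // x; exact: point_mass_integrable. Qed.

Lemma integral_finite_part X h : (\int[nu]_y (finite_part X h y)%:E = (\sum_(x <- X) h x)%:E)%E.
Proof.
have E : \int[nu]_y finite_part X h y = \sum_(x <- X) h x.
  rewrite /finite_part Rintegral_sum //; last by move=> x; exact: point_mass_integrable.
  apply: eq_bigr => x _; rewrite RintegralZl //; last first.
    have := point_mass_integrable (fun=> 1) x; apply: eq_integrable => // y _.
    by rewrite /= mul1r.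
  rewrite /Rintegral integral_indic // setIT.
  by rewrite (_ : fine _ = 1) ?mulr1 //; exact: (congr1 fine (counting_set1 x)).
rewrite -E /Rintegral fineK //.
by apply: integrable_fin_num => //; exact: finite_part_integrable.
Qed.

Definition enumeration n : seq lattice := pmap (@pickle_inv 'rV[int]_4) (iota 0 n).

Lemma enumeration_uniq n : uniq (enumeration n).
Proof. by apply: (pmap_uniq (@pickle_invK _)); exact: iota_uniq. Qed.

Lemma mem_enumeration n x : (x \in enumeration n) = (pickle x < n)%N.
Proof.
rewrite mem_pmap; apply/mapP/idP => [[i]|xn].
  rewrite mem_iota add0n => /andP[_ i_n] e.
  by have := @pickle_invK 'rV[int]_4 i; rewrite -e /= => ->.
by exists (pickle x); rewrite ?mem_iota // pickleK_inv.
Qed.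

Lemma finite_part_cvg h y : finite_part (enumeration n) h y @[n --> \oo] --> h y.
Proof.
apply: cvg_near_cst; near=> n; rewrite finite_partE ?enumeration_uniq // mem_enumeration.
by rewrite ifT //; near: n; exact: nbhs_infty_gt.
Unshelve. all: by end_near. Qed.

(** Monotone convergence along an enumeration of the lattice. *)
Lemma integral_norm_le h B : sum_norm_le h B -> (\int[nu]_y `|h y|%:E <= B%:E)%E.
Proof.
move=> hB; pose g n y := (finite_part (enumeration n) (fun x => `|h x|) y)%:E.
have gE n y : g n y = if y \in enumeration n then `|h y|%:E else 0%E.
  by rewrite /g finite_partE ?enumeration_uniq //; case: ifP.
have g0 n y : (0 <= g n y)%E by rewrite gE; case: ifP.
have gn y : nondecreasing_seq (g ^~ y).
  move=> m n mn; rewrite !gE !mem_enumeration; case: ltnP => [ym|_].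
    by rewrite (leq_trans ym mn).
  by case: ifP.
have -> : (\int[nu]_y `|h y|%:E = \int[nu]_y limn (g ^~ y))%E.
  apply: eq_integral => y _; apply/esym/cvg_lim => //.
  by apply: cvg_EFin; [near=> n|exact: (@finite_part_cvg (fun x => `|h x|))].
have c := @cvg_monotone_convergence _ _ _ nu _ measurableT g
  (fun n => @lattice_measurable_fun _ _ _ _) (fun n y _ => g0 n y) (fun y _ => gn y).
rewrite -(cvg_lim _ c) //; apply: lime_le; first by apply/cvg_ex; eexists; exact: c.
near=> n; rewrite integral_finite_part lee_fin; apply: hB; exact: enumeration_uniq.
Unshelve. all: by end_near. Qed.

Lemma sum_norm_le_integrable h B : sum_norm_le h B -> nu.-integrable setT (EFin \o h).
Proof.
move=> hB; apply/integrableP; split; first exact: lattice_measurable_fun.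
by apply: (le_lt_trans (integral_norm_le hB)); rewrite ltry.
Qed.

Lemma sum_norm_le_integral h B : sum_norm_le h B -> `|\int[nu]_y h y| <= B.
Proof.
move=> hB; have hi := sum_norm_le_integrable hB.
rewrite -lee_fin; apply: le_trans (integral_norm_le hB).
rewrite EFin_normr_Rintegral //.
by apply: le_abse_integral => //; exact: lattice_measurable_fun.
Qed.

Lemma integral_norm_sum_le h B : (\int[nu]_y `|h y|%:E <= B%:E)%E -> sum_norm_le h B.
Proof.
move=> hB X uX; rewrite -lee_fin; apply: le_trans hB.
rewrite -(integral_finite_part X (fun x => `|h x|)).
apply: ge0_le_integral => //; try by move=> *; exact: lattice_measurable_fun.
  by move=> y _; rewrite lee_fin finite_partE //; case: ifP.
by move=> y _; rewrite lee_fin finite_partE //; case: ifP.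
Qed.

Lemma finite_sums_cvg h : nu.-integrable setT (EFin \o h) ->
  (\sum_(x <- enumeration n) h x) @[n --> \oo] --> \int[nu]_y h y.
Proof.
move=> hi; pose g n y := finite_part (enumeration n) h y.
have habs : nu.-integrable setT (EFin \o (fun y => `|h y|)).
  by have := integrable_abse hi; apply: eq_integrable.
have [_ _ c] : [/\ nu.-integrable setT (EFin \o h),
    [sequence (\int[nu]_(y in setT) `|(EFin \o g n) y - (EFin \o h) y|)%E]_n @ \oo --> 0%E &
    [sequence (\int[nu]_(y in setT) (EFin \o g n) y)%E]_n @ \oo -->
      (\int[nu]_(y in setT) (EFin \o h) y)%E].
  apply: (@dominated_convergence _ _ _ nu _ measurableT (fun n => EFin \o g n) (EFin \o h)
    (EFin \o (fun y => `|h y|))) => //.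
  - apply: (@aeW _ _ _ nu) => y _; apply: cvg_EFin; [by near=> n|exact: finite_part_cvg].
  - apply: (@aeW _ _ _ nu) => y n _; rewrite /= lee_fin /g finite_partE ?enumeration_uniq //.
    by case: ifP => // _; rewrite normr0.
have -> : (fun n => \sum_(x <- enumeration n) h x) = (fun n => \int[nu]_y g n y).
  by apply/funext => n; rewrite /Rintegral integral_finite_part.
apply: fine_cvg; rewrite /= fineK; first exact: c.
exact: integrable_fin_num.
Unshelve. all: by end_near. Qed.

End lattice_sums.

Section minkowski.
Variable R : realType.

(** Minkowski's integral inequality by duality: with c_i the integral of h_i, the
    sum of the c_i^2 is the integral of sum_i c_i h_i, to which the
    Cauchy-Schwarz inequality is applied pointwise. *)
Lemma minkowski_integral d (T : measurableType d) (m : {measure set T -> \bar R}) (D : set T)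
    (I : Type) (X : seq I) (h : I -> T -> R) (S : T -> R) : measurable D ->
  (forall i, m.-integrable D (EFin \o h i)) -> m.-integrable D (EFin \o S) ->
  (forall z, D z -> 0 <= S z) ->
  (forall z, D z -> \sum_(i <- X) h i z ^+ 2 <= S z ^+ 2) ->
  \sum_(i <- X) (\int[m]_(z in D) h i z) ^+ 2 <= (\int[m]_(z in D) S z) ^+ 2.
Proof.
move=> mD hi Si S0 hS; pose c i := \int[m]_(z in D) h i z.
pose N := \sum_(i <- X) c i ^+ 2; have N0 : 0 <= N by apply: sumr_ge0 => i _; exact: sqr_ge0.
have IS0 : 0 <= \int[m]_(z in D) S z by exact: Rintegral_ge0.
have [NZ|Npos] : N = 0 \/ 0 < N.
- by move: N0; rewrite le_eqVlt => /predU1P[<-|]; [left|right].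
- by rewrite -/N NZ sqr_ge0.
pose n := Num.sqrt N; have n0 : 0 < n by rewrite sqrtr_gt0.
have n2 : n ^+ 2 = N by rewrite sqr_sqrtr.
have ich i : m.-integrable D (EFin \o (fun z => c i * h i z)).
  by have := integrableZl mD (c i) (hi i); exact.
have NE : N = \int[m]_(z in D) (\sum_(i <- X) c i * h i z).
  by rewrite Rintegral_sum //; apply: eq_bigr => i _; rewrite RintegralZl // expr2.
have pt z : D z -> \sum_(i <- X) c i * h i z <= n * S z.
  move=> Dz; set P := \sum_(i <- X) _; pose H := \sum_(i <- X) h i z ^+ 2.
  (* The Cauchy-Schwarz inequality for c and h. *)
  have q : 0 <= H - P ^+ 2 / N.
    have -> : H - P ^+ 2 / N = \sum_(i <- X) (h i z - P / N * c i) ^+ 2.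
      transitivity (H - 2 * (P / N) * P + (P / N) ^+ 2 * N); first by field; rewrite gt_eqF.
      rewrite /H /P /N !mulr_sumr -sumrB -big_split; apply: eq_bigr => i _ /=; ring.
    by apply: sumr_ge0 => i _; exact: sqr_ge0.
  have q2 : P ^+ 2 <= (n * S z) ^+ 2.
    rewrite exprMn n2; apply: (@le_trans _ _ (N * H)); last by rewrite ler_pM2l // hS.
    by rewrite mulrC -ler_pdivrMr // -subr_ge0.
  have nS0 : 0 <= n * S z by rewrite mulr_ge0 ?S0 // ltW.
  apply: (le_trans (ler_norm P)).
  by rewrite -(@ler_pXn2r _ 2) ?nnegrE // real_normK ?num_real.
have inS : m.-integrable D (EFin \o (fun z => n * S z)).
  by have := integrableZl mD n Si; exact.
have le1 : n ^+ 2 <= n * \int[m]_(z in D) S z.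
  rewrite n2 {1}NE -RintegralZl //; apply: le_Rintegral => //.
  exact: Rintegrable_sum.
rewrite -/N -n2 ler_pXn2r ?nnegrE ?(ltW n0) //.
by rewrite -(ler_pM2l n0) -expr2.
Qed.

End minkowski.

(** * Time integrals *)

Section time_integrals.
Variable R : realType.
Local Notation mu := (@lebesgue_measure R).
Local Notation RR := (measurableTypeR R).
Implicit Types (t s : R) (h phi : R -> R).

Lemma time_segment_itv t : time_segment t = `[Num.min 0 t, Num.max 0 t]%classic.
Proof.
apply/seteqP; split => s; rewrite /= in_itv /=; have [t0|t0] := leP 0 t.
- by move=> [//|/andP[h1 h2]]; rewrite (le_trans t0 h1) (le_trans h2 t0).
- by move=> [/andP[h1 h2]|//]; move: (le_lt_trans (le_trans h1 h2) t0); rewrite ltxx.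
- by left.
- by right.
Qed.

Lemma measurable_time_segment t : measurable (time_segment t).
Proof. by rewrite time_segment_itv; exact: measurable_itv. Qed.

Lemma time_segment_lty t : (mu (time_segment t) < +oo)%E.
Proof. by rewrite time_segment_itv lebesgue_measure_itv /=; case: ifP; rewrite ltry. Qed.

(** A sign that, unlike [Num.sg], is nonzero at t = 0, so that the primitives
    below also make sense there. *)
Definition direction t : R := if 0 <= t then 1 else - 1.

Lemma direction_sqr t : direction t * direction t = 1.
Proof. by rewrite /direction; case: ifP; rewrite ?mulrNN mulr1. Qed.

Lemma direction_norm t : direction t * t = `|t|.
Proof. by rewrite /direction; case: leP => t0; [rewrite mul1r ger0_norm|rewrite mulN1r ltr0_norm]. Qed.

Lemma direction_sg t : Num.sg t * direction t = (t != 0)%:R.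
Proof.
rewrite /direction; have [t0|t0|->] := ltgtP t 0.
- by rewrite ltr0_sg // mulrNN mulr1.
- by rewrite gtr0_sg // mulr1.
- by rewrite sgr0 mul0r.
Qed.

Lemma time_segment_direction t s : time_segment t s ->
  [/\ `|s| = direction t * s, `|t - s| = direction t * (t - s) & `|t - s| = `|t| - `|s|].
Proof.
rewrite /direction; case: leP => t0 h.
- have [h1 h2] : 0 <= s /\ s <= t.
    by case: h => /andP[h1 h2]; split => //; [exact: le_trans t0 h1|exact: le_trans h2 t0].
  by rewrite (ger0_norm t0) (ger0_norm h1) ger0_norm ?subr_ge0 //; split; ring.
- have [h1 h2] : t <= s /\ s <= 0.
    by case: h => /andP[h1 h2] //; move: (le_lt_trans (le_trans h1 h2) t0); rewrite ltxx.
  by rewrite (ltr0_norm t0) (ler0_norm h2) ler0_norm ?subr_le0 //; split; ring.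
Qed.

Lemma time_segment_norm t s : time_segment t s -> `|s| <= `|t|.
Proof. by move=> /time_segment_direction[_ _ h]; rewrite -subr_ge0 -h. Qed.

Lemma norm_sg_le1 t : `|Num.sg t| <= 1.
Proof. by rewrite normr_sg; case: eqP. Qed.

Lemma time_integral_le h phi t : mu.-integrable (time_segment t) (EFin \o h) ->
  mu.-integrable (time_segment t) (EFin \o phi) ->
  (forall s, time_segment t s -> `|h s| <= phi s) ->
  `|time_integral h t| <= \int[mu]_(s in time_segment t) phi s.
Proof.
move=> hi phii hphi; have mt := measurable_time_segment t.
rewrite /time_integral normrM; apply: (@le_trans _ _ (1 * `|\int[mu]_(s in time_segment t) h s|)).
  by rewrite ler_wpM2r // norm_sg_le1.
rewrite mul1r (le_trans (le_normr_Rintegral _ hi)) //.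
by apply: le_Rintegral => //; have := integrable_abse hi; apply.
Qed.

Lemma time_integralB h1 h2 t : mu.-integrable (time_segment t) (EFin \o h1) ->
  mu.-integrable (time_segment t) (EFin \o h2) ->
  time_integral h1 t - time_integral h2 t = time_integral (fun s => h1 s - h2 s) t.
Proof.
move=> i1 i2; rewrite /time_integral -mulrBr RintegralB //; exact: measurable_time_segment.
Qed.

Lemma time_segment_primitive phi Phi t :
  (forall s, time_segment t s -> is_derive s 1 Phi (phi s)) ->
  (forall s, time_segment t s -> {for s, continuous phi}) ->
  mu.-integrable (time_segment t) (EFin \o phi) /\
  \int[mu]_(s in time_segment t) phi s = Num.sg t * (Phi t - Phi 0).
Proof.
rewrite time_segment_itv => dPhi cphi.
have m0 : Num.min 0 t <= Num.max 0 t by rewrite ge_min le_max lexx.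
have d s : Num.min 0 t <= s <= Num.max 0 t -> is_derive s 1 Phi (phi s).
  by move=> h; apply: dPhi; rewrite /= in_itv.
have c s : Num.min 0 t <= s <= Num.max 0 t -> {for s, continuous phi}.
  by move=> h; apply: cphi; rewrite /= in_itv.
split; first exact: segment_integrable.
rewrite (Rintegral_primitive m0 d c).
have [t0|t0|->] := ltgtP t 0.
- by rewrite ltr0_sg // mulN1r opprB.
- by rewrite gtr0_sg // mul1r.
- by rewrite subrr mulr0.
Qed.

Definition decay2 (y : R) : R := (1 + `|y|) ^- 2.

Lemma decay2_gt0 y : 0 < decay2 y.
Proof. by rewrite invr_gt0 exprn_gt0 // ltr_pwDl. Qed.

Lemma decay2_le1 y : decay2 y <= 1.
Proof. by rewrite invf_le1 ?exprn_gt0 ?exprn_ege1 ?lerDl // ltr_pwDl. Qed.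

Lemma ratio_le1 t : Num.sg t * (t / (1 + `|t|)) <= 1.
Proof.
rewrite mulrA -normrEsg ler_pdivrMr ?ltr_pwDl // mul1r lerDr //.
Qed.

Lemma eq_time_segment_integral t h phi (B : R) : (forall s, time_segment t s -> h s = phi s) ->
  mu.-integrable (time_segment t) (EFin \o phi) /\
    \int[mu]_(s in time_segment t) phi s <= B ->
  mu.-integrable (time_segment t) (EFin \o h) /\
    \int[mu]_(s in time_segment t) h s <= B.
Proof.
move=> E [i1 i2]; split.
  apply: eq_integrable i1; first exact: measurable_time_segment.
  by move=> s; rewrite inE => /E /= ->.
suff -> : \int[mu]_(s in time_segment t) h s = \int[mu]_(s in time_segment t) phi s by [].
by apply: eq_Rintegral => s; rewrite inE => /E.
Qed.

Lemma decay2_integral t : mu.-integrable (time_segment t) (EFin \o decay2) /\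
  \int[mu]_(s in time_segment t) decay2 s <= 1.
Proof.
pose e := direction t; pose phi (s : R) := (1 + e * s) ^- 2.
have p0 s : time_segment t s -> 1 + e * s != 0.
  by move=> /time_segment_direction[h _ _]; rewrite -h gt_eqF // ltr_pwDl.
apply: (@eq_time_segment_integral _ _ phi).
  by move=> s /time_segment_direction[h _ _]; rewrite /decay2 h.
(* This primitive needs no division by the sign e. *)
have [||i1 ->] := @time_segment_primitive phi (fun s => s / (1 + e * s)) t.
- move=> s /p0 h; derive_to; first by exact: h.
  by rewrite /phi; field.
- by move=> s /p0 h; rewrite /phi; cont => //; rewrite expf_neq0.
split=> //; rewrite /= mul0r subr0 /e direction_norm; exact: ratio_le1.
Qed.

Lemma decay2_integral_reverse t : mu.-integrable (time_segment t) (EFin \o (fun s => decay2 (t - s))) /\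
  \int[mu]_(s in time_segment t) decay2 (t - s) <= 1.
Proof.
pose e := direction t; pose phi (s : R) := (1 + e * (t - s)) ^- 2.
have p0 s : time_segment t s -> 1 + e * (t - s) != 0.
  by move=> /time_segment_direction[_ h _]; rewrite -h gt_eqF // ltr_pwDl.
apply: (@eq_time_segment_integral _ _ phi).
  by move=> s /time_segment_direction[_ h _]; rewrite /decay2 h.
have [||i1 ->] := @time_segment_primitive phi (fun s => - ((t - s) / (1 + e * (t - s)))) t.
- move=> s /p0 h; derive_to; first by exact: h.
  by rewrite /phi; field.
- by move=> s /p0 h; rewrite /phi; cont => //; rewrite expf_neq0.
split=> //; rewrite /= subrr !subr0 mul0r oppr0 add0r opprK /e direction_norm; exact: ratio_le1.
Qed.

Lemma derivable_rule_expR (f : R -> R) (x df : R) : is_derive x 1 f df ->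
  is_derive x 1 (fun y => expR (f y)) (expR (f x) * df).
Proof. by move=> h; apply: (@is_derive1_comp _ (@expR R) f). Qed.

Lemma exp_integral (a : R) t : 0 < a ->
  mu.-integrable (time_segment t) (EFin \o (fun s => expR (a * `|s|))) /\
  \int[mu]_(s in time_segment t) expR (a * `|s|) <= expR (a * `|t|) / a.
Proof.
move=> a0; pose e := direction t; pose phi (s : R) := expR (a * (e * s)).
apply: (@eq_time_segment_integral _ _ phi).
  by move=> s /time_segment_direction[h _ _]; rewrite h.
have d (c s : R) : is_derive s 1 (fun s => c * expR (a * (e * s))) (c * (a * e) * expR (a * (e * s))).
  eapply is_derive_eq.
    eapply derivable_rule_mul; first by eapply derivable_rule_cst.
    by eapply derivable_rule_expR; der.
  by rewrite /=; ring.
have [||i1 ->] := @time_segment_primitive phi (fun s => e / a * expR (a * (e * s))) t.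
- move=> s _; apply: is_derive_eq (d (e / a) s) _.
  have -> : e / a * (a * e) = e * e by field; rewrite gt_eqF.
  by rewrite direction_sqr mul1r.
- move=> s _; rewrite /phi (_ : (fun s => _) = (fun s => 1 * expR (a * (e * s)))).
    exact: is_derive_continuous (d 1 s).
  by apply/funext => y; rewrite mul1r.
split=> //; rewrite !mulr0 expR0 mulr1 {1}/e direction_norm.
rewrite -[X in _ - X]mulr1 -mulrBr !mulrA direction_sg.
case: eqP => _; rewrite ?mul0r ?divr_ge0 ?expR_ge0 ?(ltW a0) // mul1r mulrC.
by rewrite ler_wpM2r ?invr_ge0 ?(ltW a0) // gerBl.
Qed.

(** As |t| = |s| + |t - s| on the segment, one of 1 + |s| and 1 + |t - s| is at
    least half of 1 + |t|; when it is 1 + |s|, the powers are exchanged, for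
    which b <= 2 is needed. *)
Lemma decay_split (b : R) t s : 0 < b <= 2 -> time_segment t s ->
  (1 + `|t - s|) `^ (- b) * decay2 s <=
  4 * (1 + `|t|) `^ (- b) * (decay2 s + decay2 (t - s)).
Proof.
move=> /andP[b0 b2] /time_segment_direction[_ _ e].
have p (y : R) : 0 < 1 + `|y| by rewrite ltr_pwDl.
have p1 (y : R) : 1 <= 1 + `|y| by rewrite lerDl.
pose a := 1 + `|t - s|; pose c := 1 + `|s|; pose T := 1 + `|t|.
have a0 : 0 < a := p _; have c0 : 0 < c := p _; have T0 : 0 < T := p _.
have Tac : T <= a + c by rewrite /T /a /c e; lra.
have two4 : 2 `^ b <= 4 :> R.
  apply: (@le_trans _ _ (2 `^ 2)); first by rewrite ler_powR // ler1n.
  by rewrite powR_mulrn // -natrX.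
have half (y : R) : 0 < y -> T <= 2 * y -> y `^ (- b) <= 4 * T `^ (- b).
  move=> y0 Ty; rewrite !powRN ler_pdivlMr ?powR_gt0 // mulrC ler_pdivrMr ?powR_gt0 //.
  apply: (@le_trans _ _ ((2 * y) `^ b)).
    by apply: ge0_ler_powR; rewrite ?nnegrE ?(ltW b0) ?(ltW T0) ?mulr_ge0 ?(ltW y0).
  by rewrite powRM ?(ltW y0) // ler_wpM2r ?powR_ge0.
have d0 y : 0 <= decay2 y := ltW (decay2_gt0 y).
have dE y : decay2 y = (1 + `|y|) `^ (- b) * (1 + `|y|) `^ (- (2 - b)).
  rewrite -powRD; last by rewrite (gt_eqF (p y)) implybT.
  rewrite (_ : - b + - (2 - b) = - 2%:R); last by ring.
  by rewrite powR_invn // ltW.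
rewrite -/a -/T; have [h|/ltW h] := leP c a.
  apply: (@le_trans _ _ (4 * T `^ (- b) * decay2 s)).
    by rewrite ler_wpM2r //; apply: half => //; lra_from h Tac.
  by rewrite ler_wpM2l ?mulr_ge0 ?powR_ge0 // lerDl.
apply: (@le_trans _ _ (4 * T `^ (- b) * decay2 (t - s))); last first.
  by rewrite ler_wpM2l ?mulr_ge0 ?powR_ge0 // lerDr.
have -> : decay2 s = c `^ (- b) * c `^ (- (2 - b)) := dE _.
have -> : decay2 (t - s) = a `^ (- b) * a `^ (- (2 - b)) := dE _.
rewrite [leRHS]mulrCA ler_wpM2l ?powR_ge0 //.
apply: ler_pM; rewrite ?powR_ge0 //; first by apply: half => //; lra_from h Tac.
rewrite !powRN lef_pV2 ?posrE ?powR_gt0 //.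
by apply: ge0_ler_powR; rewrite ?nnegrE ?subr_ge0 ?(ltW a0) ?(ltW c0).
Qed.

Lemma decay_convolution (b : R) t : 0 < b <= 2 ->
  mu.-integrable (time_segment t) (EFin \o (fun s => 4 * (1 + `|t|) `^ (- b) * (decay2 s + decay2 (t - s)))) /\
  \int[mu]_(s in time_segment t) (4 * (1 + `|t|) `^ (- b) * (decay2 s + decay2 (t - s)))
     <= 8 * (1 + `|t|) `^ (- b).
Proof.
move=> b02; have mt := measurable_time_segment t.
have [i1 I1] := decay2_integral t; have [i2 I2] := decay2_integral_reverse t.
have i12 : mu.-integrable (time_segment t) (EFin \o (fun s => decay2 s + decay2 (t - s))).
  by have := integrableD mt i1 i2; exact.
split; first by have := integrableZl mt (4 * (1 + `|t|) `^ (- b)) i12; exact.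
rewrite RintegralZl // RintegralD //.
rewrite (_ : 8 * _ = 4 * (1 + `|t|) `^ (- b) * 2); last by ring.
rewrite ler_wpM2l ?mulr_ge0 ?powR_ge0 //; lra.
Qed.

End time_integrals.

(** * The Duhamel operator *)

Section convolution.
Variable R : realType.
Local Notation mu := (@lebesgue_measure R).
Local Notation nu := (@counting lattice R).
Local Notation RR := (measurableTypeR R).
Local Notation conv := (@Defs.conv R).
Implicit Types (x y z : lattice) (g h : lattice -> R).

Lemma conv_bound g h x (c eta : R) : (forall z, `|g z| <= c) -> sum_norm_le h eta ->
  conv_summable g h x /\ `|conv g h x| <= c * eta.
Proof.
move=> gc heta; have c0 : 0 <= c by exact: le_trans (normr_ge0 _) (gc 0).
have s : sum_norm_le (fun y => g (x - y) * h y) (c * eta).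
  by apply: (sum_norm_le_scale _ c0 heta) => y; rewrite normrM ler_wpM2r.
by split; [exact: sum_norm_le_integrable s|exact: sum_norm_le_integral s].
Qed.

Lemma conv_bound_sup g h x (L d : R) : sum_norm_le g L -> (forall y, `|h y| <= d) ->
  conv_summable g h x /\ `|conv g h x| <= d * L.
Proof.
move=> gL hd; have d0 : 0 <= d by exact: le_trans (normr_ge0 _) (hd 0).
have s : sum_norm_le (fun y => g (x - y) * h y) (d * L).
  apply: (sum_norm_le_scale _ d0 (sum_norm_le_reflect x gL)) => y.
  by rewrite normrM mulrC ler_wpM2r.
by split; [exact: sum_norm_le_integrable s|exact: sum_norm_le_integral s].
Qed.

Lemma convB g h1 h2 x : conv_summable g h1 x -> conv_summable g h2 x ->
  conv g h1 x - conv g h2 x = conv g (fun y => h1 y - h2 y) x.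
Proof.
move=> s1 s2; rewrite /Defs.conv -RintegralB //.
by apply: eq_Rintegral => y _; rewrite mulrBr.
Qed.

(** Young's inequality l^2 * l^1 -> l^2. *)
Lemma conv_sqr_le g h (c eta : R) : 0 <= c -> sum_sqr_le g c -> sum_norm_le h eta ->
  sum_sqr_le (conv g h) (c * eta).
Proof.
move=> c0 gc heta X uX.
have gb z : `|g z| <= c := sum_sqr_le_point z c0 gc.
have ch : sum_norm_le (fun y => c * `|h y|) (c * eta).
  by apply: (sum_norm_le_scale _ c0 heta) => y; rewrite normrM normr_id (ger0_norm c0).
have S0 y : 0 <= c * `|h y| by rewrite mulr_ge0.
apply: (@le_trans _ _ ((\int[nu]_y (c * `|h y|)) ^+ 2)).
  apply: (@minkowski_integral _ _ _ nu setT _ X (fun x y => g (x - y) * h y)) => //.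
  - by move=> x; have [s _] := conv_bound x gb heta.
  - exact: sum_norm_le_integrable ch.
  - move=> y _; under eq_bigr do rewrite exprMn.
    rewrite -mulr_suml exprMn real_normK ?num_real // ler_wpM2r ?sqr_ge0 //.
    exact: (sum_sqr_le_shift y gc uX).
have I0 : 0 <= \int[nu]_y (c * `|h y|) by apply: Rintegral_ge0 => y _; exact: S0.
have := sum_norm_le_integral ch; rewrite ger0_norm // => le1.
by apply: lerXn2r; rewrite ?nnegrE // (le_trans I0).
Qed.

Local Notation green := (@Defs.kernel R).
Implicit Type H : lattice -> R -> R.

Definition conv_at H x t s : R := conv (fun z => green z (t - s)) (fun y => H y s) x.

Definition wave H x t : R := time_integral (conv_at H x t) t.

(** The convolution is a pointwise limit of finite sums, each jointly
    measurable. *)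
Lemma measurable_conv_at H x : (forall y, measurable_fun setT (H y : RR -> RR)) ->
  (forall t s, conv_summable (fun z => green z (t - s)) (fun y => H y s) x) ->
  measurable_fun setT (fun z : RR * RR => (conv_at H x z.1 z.2 : RR)).
Proof.
move=> mH sH.
apply: (@measurable_fun_cvg _ _ _ _ (fun n (z : RR * RR) =>
  \sum_(y <- enumeration n) (green (x - y) (z.1 - z.2) * H y z.2))); last first.
  by move=> z _; apply: finite_sums_cvg; exact: sH.
move=> n; apply: measurable_sum => y; apply: measurable_funM.
  have mk : measurable_fun setT (green (x - y) : RR -> RR).
    by apply: continuous_measurable_fun; exact: kernel_continuous.
  apply: (measurableT_comp mk); apply: measurable_funB; [exact: measurable_fst|exact: measurable_snd].
by apply: (measurableT_comp (mH y)); exact: measurable_snd.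
Qed.

Lemma measurable_parametric_integral (P : RR * RR -> R) : measurable_fun setT P ->
  measurable_fun setT (fun t : RR => \int[mu]_s P (t, s)).
Proof.
move=> mP; have mE : measurable_fun setT (EFin \o P) by exact/measurable_EFinP.
have mp := @measurable_fun_fubini_tonelli_F _ _ RR RR R mu _ (measurable_funepos mE) (fun w => funepos_ge0 _ w).
have mn := @measurable_fun_fubini_tonelli_F _ _ RR RR R mu _ (measurable_funeneg mE) (fun w => funeneg_ge0 _ w).
have -> : (fun t : RR => \int[mu]_s P (t, s)) =
    fine \o (fun t => \int[mu]_s ((EFin \o P)^\+ (t, s)) - \int[mu]_s ((EFin \o P)^\- (t, s)))%E.
  apply/funext => t; rewrite /Rintegral integralE /=; congr (fine (_ - _)%E).
    by apply: eq_integral => s _; rewrite !funeposE.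
  by apply: eq_integral => s _; rewrite !funenegE.
apply: (measurableT_comp (fine_measurable measurableT)).
by apply: emeasurable_funB; [exact: mp|exact: mn].
Qed.

Lemma measurable_wave H x : (forall y, measurable_fun setT (H y : RR -> RR)) ->
  (forall t s, conv_summable (fun z => green z (t - s)) (fun y => H y s) x) ->
  measurable_fun setT (wave H x : RR -> RR).
Proof.
move=> mH sH; have mc := measurable_conv_at mH sH.
pose E := [set z : RR * RR | time_segment z.1 z.2].
have mE : measurable E.
  rewrite (_ : E = (fun z : RR * RR => (0 <= z.2) && (z.2 <= z.1) || (z.1 <= z.2) && (z.2 <= 0)) @^-1` [set true]).
    rewrite -[_ @^-1` _]setTI; apply: (_ : measurable_fun setT _) => //.
    by apply: measurable_or; apply: measurable_and; apply: measurable_fun_ler => //;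
      (exact: measurable_fst || exact: measurable_snd).
  by apply/seteqP; split => z /orP.
have msg : measurable_fun setT (Num.sg : RR -> RR).
  have -> : (Num.sg : RR -> RR) = (fun t : RR => if 0 < t then 1 else if t < 0 then -1 else 0).
    by apply/funext => t; have [t0|t0|->] := ltgtP t 0; [rewrite ltr0_sg|rewrite gtr0_sg|rewrite sgr0].
  apply: measurable_fun_ifT => //; first exact: measurable_fun_ltr.
  by apply: measurable_fun_ifT => //; exact: measurable_fun_ltr.
have mI : measurable_fun setT (fun t : RR => \int[mu]_s (conv_at H x t s * \1_E (t, s))).
  apply: (@measurable_parametric_integral (fun w => conv_at H x w.1 w.2 * \1_E w)).
  by apply: measurable_funM.
have -> : wave H x = (fun t : RR => Num.sg t * \int[mu]_s (conv_at H x t s * \1_E (t, s))).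
  apply/funext => t; rewrite /wave /time_integral; congr (_ * _).
  rewrite Rintegral_mkcond; apply: eq_Rintegral => s _.
  rewrite patchE indicE; have -> : ((t, s) \in E) = (s \in time_segment t).
    by apply/idP/idP; rewrite !inE.
  by case: ifP => _; rewrite ?mulr1 ?mulr0.
exact: measurable_funM.
Qed.

End convolution.

Section wave_estimates.
Variable R : realType.
Local Notation mu := (@lebesgue_measure R).
Local Notation RR := (measurableTypeR R).
Local Notation green := (@Defs.kernel R).
Implicit Types (x y : lattice) (H : lattice -> R -> R) (t s : R).
Variable C0 : R.
Hypothesis C0_ge0 : 0 <= C0.
Hypothesis green_sqr : forall t, sum_sqr_le (green^~ t) C0.

(** The bounds that F(u) inherits from u in the ball [in_ball]. *)
Definition decaying_source H (a : R) : Prop :=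
  (forall y, measurable_fun setT (H y : RR -> RR)) /\
  forall s, sum_norm_le (H^~ s) (a * decay2 s).

Lemma green_le x t : `|green x t| <= C0.
Proof. exact: (sum_sqr_le_point x C0_ge0 (green_sqr t)). Qed.

Lemma decaying_source_ge0 H a : decaying_source H a -> 0 <= a.
Proof.
by move=> [_ /(_ 0) /sum_norm_le_ge0]; rewrite pmulr_lge0 ?decay2_gt0.
Qed.

Lemma decaying_source_summable H a x t s : decaying_source H a ->
  conv_summable (fun z => green z (t - s)) (fun y => H y s) x.
Proof. by move=> [_ h]; have [] := conv_bound x (green_le^~ (t - s)) (h s). Qed.

Lemma conv_at_integrable H a x t : decaying_source H a ->
  mu.-integrable (time_segment t) (EFin \o conv_at H x t).
Proof.
move=> Ha; have [mH sH] := Ha.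
apply: (@bounded_integrable _ _ _ _ _ _ (C0 * a)).
- exact: measurable_time_segment.
- exact: time_segment_lty.
- have := measurable_conv_at mH (fun t s => decaying_source_summable x t s Ha).
  by move=> /(measurableT_comp) /(_ (pair1_measurable t)); exact.
- move=> s _; have [_ h] := conv_bound x (green_le^~ (t - s)) (sH s).
  apply: (le_trans h); rewrite ler_wpM2l // ler_piMr ?decay2_le1 //.
  exact: decaying_source_ge0 Ha.
Qed.

Lemma measurable_wave_source H a x : decaying_source H a ->
  measurable_fun setT (wave H x : RR -> RR).
Proof.
move=> Ha; apply: measurable_wave; first by case: Ha.
by move=> t s; exact: decaying_source_summable Ha.
Qed.

Lemma wave_decay H a (b C : R) x t : decaying_source H a -> 0 < b <= 2 ->
  (forall z r, `|green z r| <= C * (1 + `|r|) `^ (- b)) ->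
  `|wave H x t| <= 8 * C * a * (1 + `|t|) `^ (- b).
Proof.
move=> Ha b02 hC; have [mH sH] := Ha; have a0 := decaying_source_ge0 Ha.
have CC0 : 0 <= C.
  by have := le_trans (normr_ge0 _) (hC 0 0); rewrite normr0 addr0 powR1 mulr1.
have mt := measurable_time_segment t.
pose phi s := 4 * (1 + `|t|) `^ (- b) * (decay2 s + decay2 (t - s)).
have [i1 I1] := decay_convolution t b02.
have i2 : mu.-integrable (time_segment t) (EFin \o (fun s => C * a * phi s)).
  by have := integrableZl mt (C * a) i1; exact.
apply: (@le_trans _ _ (\int[mu]_(s in time_segment t) (C * a * phi s))).
  apply: time_integral_le => //; first exact: conv_at_integrable Ha.
  move=> s ts; have [_ h] := conv_bound x (hC^~ (t - s)) (sH s).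
  apply: (le_trans h).
  rewrite (_ : _ * _ = C * a * ((1 + `|t - s|) `^ (- b) * decay2 s)); last by ring.
  by rewrite ler_wpM2l ?mulr_ge0 //; exact: decay_split.
rewrite RintegralZl // (_ : 8 * C * a * _ = C * a * (8 * (1 + `|t|) `^ (- b))); last by ring.
by rewrite ler_wpM2l ?mulr_ge0.
Qed.

Lemma wave_sqr_le H a t : decaying_source H a -> sum_sqr_le (wave H^~ t) (C0 * a).
Proof.
move=> Ha X uX; have [mH sH] := Ha; have a0 := decaying_source_ge0 Ha.
have mt := measurable_time_segment t.
have [i1 I1] := decay2_integral t.
have i2 : mu.-integrable (time_segment t) (EFin \o (fun s => C0 * a * decay2 s)).
  by have := integrableZl mt (C0 * a) i1; exact.
have d0 s : 0 <= C0 * a * decay2 s by rewrite !mulr_ge0 // ltW // decay2_gt0.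
apply: (@le_trans _ _ (\sum_(x <- X) (\int[mu]_(s in time_segment t) conv_at H x t s) ^+ 2)).
  apply: ler_sum => x _; rewrite /wave /time_integral exprMn ler_piMl ?sqr_ge0 //.
  by rewrite -real_normK ?num_real // exprn_ile1 // norm_sg_le1.
apply: (@le_trans _ _ ((\int[mu]_(s in time_segment t) (C0 * a * decay2 s)) ^+ 2)).
  apply: (@minkowski_integral _ _ _ mu _ _ X (fun x => conv_at H x t)) => //.
    by move=> x; exact: conv_at_integrable Ha.
  move=> s _; rewrite -mulrA; exact: (conv_sqr_le C0_ge0 (green_sqr (t - s)) (sH s) uX).
have I0 : 0 <= \int[mu]_(s in time_segment t) (C0 * a * decay2 s).
  by apply: Rintegral_ge0 => s _; exact: d0.
apply: lerXn2r; rewrite ?nnegrE ?mulr_ge0 //.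
by rewrite RintegralZl // ler_piMr // mulr_ge0.
Qed.

End wave_estimates.

Section wave_difference.
Variable R : realType.
Local Notation mu := (@lebesgue_measure R).
Local Notation green := (@Defs.kernel R).
Implicit Types (x y : lattice) (H : lattice -> R -> R) (t s : R).

(** The exponential weight absorbs the growth of the l^1 norm of the kernel: as
    |t - s| = |t| - |s|, what is integrated is e^(4|t|) e^((Lam-4)|s|), and
    the integration gains 1 / (Lam - 4). *)
Lemma wave_difference_le H1 H2 x t (D Lam : R) : 4 < Lam ->
  (forall s, time_segment t s -> conv_summable (fun z => green z (t - s)) (H1^~ s) x) ->
  (forall s, time_segment t s -> conv_summable (fun z => green z (t - s)) (H2^~ s) x) ->
  mu.-integrable (time_segment t) (EFin \o conv_at H1 x t) ->
  mu.-integrable (time_segment t) (EFin \o conv_at H2 x t) ->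
  (forall y s, time_segment t s -> `|H1 y s - H2 y s| <= D * expR (Lam * `|s|)) ->
  `|wave H1 x t - wave H2 x t| <= D / (Lam - 4) * expR (Lam * `|t|).
Proof.
move=> Lam4 s1 s2 i1 i2 hD.
have a0 : 0 < Lam - 4 by rewrite subr_gt0.
have mt := measurable_time_segment t.
have [ie Ie] := exp_integral t a0.
pose c := D * expR (4 * `|t|).
have D0 : 0 <= D.
  have ts : time_segment t 0 by rewrite time_segment_itv /= in_itv /= ge_min le_max !lexx.
  by have := le_trans (normr_ge0 _) (hD 0 0 ts); rewrite normr0 mulr0 expR0 mulr1.
have i3 : mu.-integrable (time_segment t) (EFin \o (fun s => c * expR ((Lam - 4) * `|s|))).
  by have := integrableZl mt c ie; exact.
rewrite /wave time_integralB //.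
apply: (@le_trans _ _ (\int[mu]_(s in time_segment t) (c * expR ((Lam - 4) * `|s|)))).
  apply: time_integral_le => //; first by have := integrableB mt i1 i2; exact.
  move=> s ts; rewrite /conv_at convB //; [|exact: s1|exact: s2].
  have [_ h] := conv_bound_sup x (@kernel_sum_norm_le R (t - s)) (hD^~ s^~ ts).
  apply: (le_trans h); rewrite /c -!mulrA ler_wpM2l // -!expRD ler_expR.
  by have [_ _ ->] := time_segment_direction ts; lra.
rewrite RintegralZl //; apply: (@le_trans _ _ (c * (expR ((Lam - 4) * `|t|) / (Lam - 4)))).
  by rewrite ler_wpM2l // mulr_ge0 ?expR_ge0.
rewrite /c !mulrA -(mulrA D) -expRD mulrAC.
by rewrite (_ : 4 * `|t| + (Lam - 4) * `|t| = Lam * `|t|) //; ring.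
Qed.

End wave_difference.

(** * The power nonlinearity *)

Section power_nonlinearity.
Variable R : realType.
Local Notation mu := (@lebesgue_measure R).
Local Notation RR := (measurableTypeR R).
Variable k : R.
Hypothesis k_ge4 : 4 <= k.
Local Notation F := (nonlinearity k).
Implicit Types (a b M : R).

Lemma measurable_nonlinearity (u : RR -> RR) : measurable_fun setT u ->
  measurable_fun setT (fun s : RR => F (u s) : RR).
Proof.
move=> mu_; apply: measurable_funM => //.
by apply: (measurableT_comp (measurable_powR _)); apply: measurableT_comp.
Qed.

Lemma nonlinearityN a : F (- a) = - F a.
Proof. by rewrite /nonlinearity normrN mulrN. Qed.

Lemma nonlinearity_norm a : `|F a| = `|a| `^ (k - 1) * `|a|.
Proof. by rewrite /nonlinearity normrM ger0_norm // powR_ge0. Qed.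

Lemma nonlinearity_le a : `|a| <= 1 -> `|F a| <= a ^+ 4.
Proof.
move=> a1; rewrite nonlinearity_norm.
have [->|a0] := eqVneq a 0; first by rewrite normr0 mulr0 exprn_ge0.
have n0 : 0 < `|a| by rewrite normr_gt0.
rewrite (_ : a ^+ 4 = `|a| `^ 3%:R * `|a|); last first.
  rewrite powR_mulrn // -exprSr.
  by rewrite -normrX ger0_norm // exprn_even_ge0.
rewrite ler_wpM2r //; apply: ger_powR; first by rewrite n0 a1.
by rewrite lerBrDr natr1.
Qed.

Lemma nonlinearity_le_lipschitz a M : `|a| <= M -> `|F a| <= M `^ (k - 1) * `|a|.
Proof.
move=> aM; rewrite nonlinearity_norm ler_wpM2r //.
have M0 := le_trans (normr_ge0 a) aM.
by apply: ge0_ler_powR; rewrite ?nnegrE //; (have h4 := k_ge4; lra_from h4).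
Qed.

Lemma nonlinearity_lipschitz M a b : 0 < M -> `|a| <= M -> `|b| <= M ->
  `|F a - F b| <= k * M `^ (k - 1) * `|a - b|.
Proof.
move=> M0; have k1 : 1 <= k by (have h4 := k_ge4; lra_from h4).
have L0 : 0 <= M `^ (k - 1) := powR_ge0 _ _.
have L1 : M `^ (k - 1) <= k * M `^ (k - 1) by rewrite ler_peMl.
wlog ba : a b / b <= a.
  move=> h aM bM; have [ba|/ltW ab] := leP b a; first exact: h.
  by rewrite distrC (distrC a); exact: h.
wlog b0 : a b ba / 0 <= b.
  move=> h aM bM; have [b0|b0] := leP 0 b; first exact: h.
  have [a0|a0] := ltP a 0.
    have e (y z : R) : - y - - z = z - y by ring.
    have := h (- b) (- a); rewrite !nonlinearityN !normrN !e lerN2 oppr_ge0.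
    by move=> h1; exact: (h1 ba (ltW a0) bM aM).
  apply: (le_trans (ler_normB _ _)).
  apply: (@le_trans _ _ (M `^ (k - 1) * (`|a| + `|b|))).
    by rewrite mulrDr lerD // nonlinearity_le_lipschitz.
  by rewrite (ger0_norm a0) (ltr0_norm b0) (ger0_norm (_ : 0 <= a - b)) ?subr_ge0 // ler_wpM2r // subr_ge0.
move=> aM bM.
have a0 : 0 <= a := le_trans b0 ba.
have [b00|b00] := eqVneq b 0.
  rewrite b00 {2}/nonlinearity mulr0 !subr0.
  by apply: (le_trans (nonlinearity_le_lipschitz aM)); rewrite ler_wpM2r.
have bp : 0 < b by rewrite lt_neqAle eq_sym b00.
have FE y : 0 <= y -> F y = y `^ k.
  by move=> y0; rewrite /nonlinearity (ger0_norm y0) mulrC mulr_powRB1 //; (have h4 := k_ge4; lra_from h4).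
have d y : b <= y <= a -> is_derive y 1 (fun y => y `^ k) (k * y `^ (k - 1)).
  move=> /andP[h _]; derive_to; first by exact: (lt_le_trans bp h).
  by rewrite mulr1.
have c y : b <= y <= a -> {for y, continuous (fun y => k * y `^ (k - 1))}.
  by move=> /andP[h _]; cont; exact: (lt_le_trans bp h).
rewrite !FE // -(Rintegral_primitive ba d c) (ger0_norm (_ : 0 <= a - b)) ?subr_ge0 //.
apply: Rintegral_le_length => // y yI.
have [h1 h2] := andP yI.
have y0 := le_trans b0 h1.
rewrite ger0_norm ?mulr_ge0 ?powR_ge0 ?(le_trans ler01 k1) //.
rewrite ler_wpM2l ?(le_trans ler01 k1) //.
apply: ge0_ler_powR; rewrite ?nnegrE ?subr_ge0 ?(ltW M0) //.
by rewrite (le_trans h2) // (le_trans (ler_norm a)).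
Qed.

End power_nonlinearity.

(** * The norms of l^p *)

Section lattice_norms.
Variable R : realType.
Local Notation nu := (@counting lattice R).
Implicit Types (h : lattice -> R) (p : \bar R).

Lemma l_norm1_sum h (d : R) : (l_norm 1 h < d%:E)%E -> sum_norm_le h d.
Proof.
rewrite /l_norm Lnorm1 => /ltW hd; apply: integral_norm_sum_le; apply: le_trans hd.
by rewrite le_eqVlt; apply/orP; left; apply/eqP/eq_integral.
Qed.

Lemma counting_ae (P : lattice -> Prop) : (\forall y \ae nu, P y) -> forall x, P x.
Proof.
move=> [N [_ N0 PN]] x; apply: contrapT => Px.
have : nu [set x] = 0%E.
  apply/eqP; rewrite eq_le measure_ge0 andbT -N0; apply: le_measure; rewrite ?inE //.
  by move=> y /= ->; apply: PN.
by move=> h; have := counting_set1 R x; rewrite h => /eqP; rewrite eqe eq_sym oner_eq0.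
Qed.

Lemma counting_setT_gt0 : (0 < nu [set: lattice])%E.
Proof.
apply: (@lt_le_trans _ _ (nu [set (0 : lattice)])).
  by have -> := counting_set1 R 0; rewrite lte_fin.
by apply: le_measure; rewrite ?inE.
Qed.

Lemma integral_pow_Lnorm h (r : R) : 0 < r ->
  (\int[nu]_y (`|h y| `^ r)%:E = (l_norm r%:E h) `^ r)%E.
Proof. by move=> r0; rewrite /l_norm poweR_Lnorm ?gt_eqF. Qed.

Lemma l_norm_pointwise p h (M : R) x : (2%:E <= p)%E -> (l_norm p h <= M%:E)%E -> `|h x| <= M.
Proof.
case: p => [r| |] //; last first.
  move=> _; rewrite /l_norm unlock counting_setT_gt0 => /ess_supP /counting_ae /(_ x).
  by rewrite /= lee_fin.
rewrite lee_fin => r2 hM; have r0 : 0 < r by apply: lt_le_trans r2.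
have M0 : 0 <= M by rewrite -lee_fin; exact: le_trans (Lnorm_ge0 _ _ _) hM.
have hr : (\int[nu]_y (`|h y| `^ r)%:E <= (M `^ r)%:E)%E.
  rewrite integral_pow_Lnorm // -poweR_EFin; apply: gt0_ler_poweR => //; first exact: ltW.
    by rewrite in_itv /= leey andbT Lnorm_ge0.
  by rewrite in_itv /= leey andbT lee_fin.
have hs : sum_norm_le (fun y => `|h y| `^ r) (M `^ r).
  apply: integral_norm_sum_le; apply: le_trans hr.
  by rewrite le_eqVlt; apply/orP; left; apply/eqP/eq_integral => y _; rewrite ger0_norm ?powR_ge0.
have := sum_norm_le_point x hs; rewrite ger0_norm ?powR_ge0 // => le1.
rewrite leNgt; apply/negP => lt1; move: le1; rewrite leNgt => /negP; apply.
by apply: gt0_ltr_powR; rewrite ?nnegrE.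
Qed.

(** Between 2 and infinity: |h|^p <= q^(p-2) |h|^2. *)
Lemma l_norm_interpolation p h (q A : R) : (2%:E <= p)%E -> 0 < q -> 0 < A ->
  (forall x, `|h x| <= q) -> sum_sqr_le h A ->
  (l_norm p h <= (q `^ (1 - 2 * fine (p^-1)%E) * A `^ (2 * fine (p^-1)%E))%:E)%E.
Proof.
case: p => [r| |] //; last first.
  move=> _ q0 A0 hq hA; rewrite /l_norm unlock counting_setT_gt0 invey /= mulr0 subr0 powRr1 ?(ltW q0) // powRr0 mulr1.
  by apply/ess_supP; apply: (@aeW _ _ _ nu) => x; rewrite /= lee_fin.
rewrite lee_fin => r2 q0 A0 hq hA; have r0 : 0 < r by apply: lt_le_trans r2.
rewrite inver gt_eqF //= .
have hs : sum_norm_le (fun y => `|h y| `^ r) (q `^ (r - 2) * A ^+ 2).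
  move=> X uX; apply: (@le_trans _ _ (\sum_(x <- X) q `^ (r - 2) * h x ^+ 2)); last first.
    by rewrite -mulr_sumr ler_wpM2l ?powR_ge0 // hA.
  apply: ler_sum => x _; rewrite ger0_norm ?powR_ge0 //.
  have [->|x0] := eqVneq (h x) 0; first by rewrite normr0 powR0 ?gt_eqF // mulr_ge0 ?powR_ge0 ?sqr_ge0.
  have n0 : 0 < `|h x| by rewrite normr_gt0.
  rewrite (_ : r = (r - 2) + 2%:R); last by ring.
  rewrite powRD; last by rewrite (gt_eqF n0) implybT.
  rewrite powR_mulrn // real_normK ?num_real // addrK ler_wpM2r ?sqr_ge0 //.
  by apply: ge0_ler_powR; rewrite ?nnegrE ?subr_ge0 ?(ltW q0).
have hi := integral_norm_le hs.
have -> : (l_norm r%:E h = ((l_norm r%:E h) `^ r) `^ r^-1)%E.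
  by rewrite -poweRrM mulfV ?gt_eqF // poweRe1 // Lnorm_ge0.
rewrite -integral_pow_Lnorm //.
have -> : q `^ (1 - 2 * r^-1) * A `^ (2 * r^-1) = (q `^ (r - 2) * A ^+ 2) `^ r^-1.
  rewrite powRM ?powR_ge0 ?sqr_ge0 // -powR_mulrn ?(ltW A0) // -!powRrM.
  by rewrite mulrBl mulfV ?gt_eqF.
rewrite -poweR_EFin; apply: gt0_ler_poweR; rewrite ?invr_ge0 ?(ltW r0) //.
- by rewrite in_itv /= leey andbT; apply: integral_ge0 => y _; rewrite lee_fin powR_ge0.
- by rewrite in_itv /= leey andbT lee_fin mulr_ge0 ?powR_ge0 ?sqr_ge0.
- apply: le_trans hi; rewrite le_eqVlt; apply/orP; left; apply/eqP/eq_integral => y _.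
  by rewrite [in RHS]ger0_norm ?powR_ge0.
Qed.

End lattice_norms.

(** * Fixed point and uniqueness *)

Section geometric_limits.
Variable R : realType.

Lemma geometric_limit (w : nat -> R) (E : R) :
  (forall n, `|w n.+1 - w n| <= E / 2 ^+ n) ->
  exists l, forall n, `|w n - l| <= 2 * E / 2 ^+ n.
Proof.
(* Subtracting and adding the tail of the geometric series makes the sequence
   monotone. *)
move=> hw; pose a n := w n - 2 * E / 2 ^+ n; pose b n := w n + 2 * E / 2 ^+ n.
have E0 : 0 <= E by have := le_trans (normr_ge0 _) (hw 0); rewrite expr0 divr1.
have p0 n : 0 < 2 ^+ n :> R by rewrite exprn_gt0.
have half n : 2 * E / 2 ^+ n.+1 = E / 2 ^+ n by rewrite exprS; field; rewrite gt_eqF.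
have dbl n : 2 * E / 2 ^+ n = E / 2 ^+ n + E / 2 ^+ n by rewrite -mulrDl; congr (_ / _); ring.
have na : nondecreasing_seq a.
  apply/nondecreasing_seqP => n; rewrite /a half dbl.
  by have := hw n; rewrite ler_norml => /andP[h _]; lra_from h.
have nb : nonincreasing_seq b.
  apply/nonincreasing_seqP => n; rewrite /b half dbl.
  by have := hw n; rewrite ler_norml => /andP[_ h]; lra_from h.
have ab n : a n <= b n.
  by rewrite /a /b lerD2l ge0_cp // divr_ge0 ?mulr_ge0 // ltW.
have abm m n : a m <= b n.
  have [mn|/ltnW nm] := leqP m n; first by apply: le_trans (na _ _ mn) (ab n).
  by apply: le_trans (ab m) (nb _ _ nm).
have ca : cvgn a.
  by apply: nondecreasing_is_cvgn => //; exists (b 0) => _ [n _ <-]; exact: abm.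
exists (limn a) => n.
have h1 : a n <= limn a by exact: nondecreasing_cvgn_le.
have h2 : limn a <= b n by apply: limr_le => //; near=> m; exact: abm.
by move: h1 h2; rewrite /a /b ler_norml => h1 h2; apply/andP; split; lra_from h1 h2.
Unshelve. all: by end_near. Qed.

Lemma cvg_geometric_bound (w : nat -> R) (l K : R) :
  (forall n, `|w n - l| <= K / 2 ^+ n) -> w n @[n --> \oo] --> l.
Proof.
move=> h; have c : (fun n => K / 2 ^+ n) @ \oo --> (0 : R).
  rewrite (_ : (fun n => _) = geometric K (2^-1)); last by apply/funext => n; rewrite /= exprVn.
  by apply: cvg_geometric; rewrite ger0_norm // invf_lt1 // ltr1n.
apply/cvgrPdist_le => e e0; have /cvgrPdist_le /(_ e e0) := c.
apply: filterS => n; rewrite sub0r normrN => h'; rewrite distrC.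
by apply: (le_trans (h n)); apply: le_trans h'; exact: ler_norm.
Qed.

Lemma eq_of_geometric (a b K : R) : (forall n, `|a - b| <= K / 2 ^+ n) -> a = b.
Proof.
move=> h; have c := @cvg_geometric_bound (fun=> a) b K h.
by have := cvg_lim _ c; rewrite lim_cst // => ->.
Qed.

Lemma cvg_le_const (w : nat -> R) (l M : R) : w n @[n --> \oo] --> l -> (forall n, w n <= M) -> l <= M.
Proof.
move=> c h; rewrite -(cvg_lim _ c) //; apply: limr_le; first by apply/cvg_ex; exists l.
by near=> n; exact: h.
Unshelve. all: by end_near. Qed.

Lemma sum_sqr_le_add (g h : lattice -> R) (a b : R) : 0 < a -> 0 < b ->
  sum_sqr_le g a -> sum_sqr_le h b -> sum_sqr_le (fun x => g x + h x) (a + b).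
Proof.
move=> a0 b0 ga hb X uX.
apply: (@le_trans _ _ (\sum_(x <- X) ((1 + b / a) * g x ^+ 2 + (1 + a / b) * h x ^+ 2))).
  apply: ler_sum => x _; rewrite -subr_ge0.
  have -> : (1 + b / a) * g x ^+ 2 + (1 + a / b) * h x ^+ 2 - (g x + h x) ^+ 2 =
    (b * g x - a * h x) ^+ 2 / (a * b) by field; rewrite !gt_eqF.
  by rewrite divr_ge0 ?sqr_ge0 // ltW // mulr_gt0.
rewrite big_split /= -!mulr_sumr.
have -> : (a + b) ^+ 2 = (1 + b / a) * a ^+ 2 + (1 + a / b) * b ^+ 2 by field; rewrite !gt_eqF.
have q (c d : R) : 0 < c -> 0 < d -> 0 <= 1 + c / d by move=> c0 d0; rewrite addr_ge0 // divr_ge0 // ltW.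
by apply: lerD; rewrite ler_wpM2l ?q //; [exact: ga|exact: hb].
Qed.

End geometric_limits.

Section picard.
Variable R : realType.
Local Notation mu := (@lebesgue_measure R).
Local Notation RR := (measurableTypeR R).
Local Notation green := (@Defs.kernel R).
Local Notation conv := (@Defs.conv R).
Implicit Types (x y : lattice) (u v : lattice -> R -> R) (t s : R).
Variables (k C : R).
Hypothesis k_ge4 : 4 <= k.
Hypothesis C_ge1 : 1 <= C.
Hypothesis green_sqr : forall t, sum_sqr_le (green^~ t) C.
Hypothesis green_decay : forall x t, `|green x t| <= C * (1 + `|t|) `^ (- 1).
Local Notation F := (nonlinearity k).

(** The constants are such that [data_size] and the nonlinear term each
    contribute one half of the radius: C * data_size = radius / 2 = 8 * C *
    radius^2. *)
Definition radius : R := (16 * C)^-1.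
Definition data_size : R := radius / (2 * C).

Let C_gt0 : 0 < C. Proof. exact: lt_le_trans C_ge1. Qed.

Lemma radius_gt0 : 0 < radius. Proof. by rewrite invr_gt0 mulr_gt0. Qed.

Lemma data_size_gt0 : 0 < data_size.
Proof. by rewrite divr_gt0 ?radius_gt0 // mulr_gt0. Qed.

Lemma radius_le1 : radius <= 1.
Proof.
rewrite invf_le1 ?mulr_gt0 // -[leLHS]mulr1; apply: ler_pM => //; by rewrite ler1n.
Qed.

Lemma radiusE : 16 * C * radius = 1.
Proof. by rewrite mulfV // gt_eqF // mulr_gt0. Qed.

Lemma data_sizeE : C * data_size = radius / 2.
Proof. by rewrite /data_size; field; rewrite gt_eqF. Qed.

Variable f : lattice -> R.
Hypothesis f_small : sum_norm_le f data_size.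

Definition linear_part x t : R := conv (green^~ t) f x.

Definition step u x t : R := linear_part x t + wave (fun y s => F (u y s)) x t.

Definition in_ball u : Prop :=
  [/\ forall y, measurable_fun setT (u y : RR -> RR),
      forall x t, `|u x t| <= radius * (1 + `|t|) `^ (- 1) &
      forall t, sum_sqr_le (u^~ t) radius].

Let one_plus_gt0 t : 0 < 1 + `|t|. Proof. by rewrite ltr_pwDl. Qed.

Lemma in_ball_le1 u x t : in_ball u -> `|u x t| <= 1.
Proof.
move=> [_ h _]; apply: (le_trans (h x t)); rewrite -[leRHS]mul1r.
apply: ler_pM; rewrite ?powR_ge0 ?radius_le1 ?(ltW radius_gt0) //.
by rewrite powR_inv1 ?(ltW (one_plus_gt0 t)) // invf_le1 // lerDl.
Qed.

(** As |F(u)| <= u^4, two factors are bounded pointwise, which gives the decay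
    in time, and the other two are summed over the lattice. *)
Lemma in_ball_source u : in_ball u -> decaying_source (fun y s => F (u y s)) (radius ^+ 2).
Proof.
move=> ub; have [mu_ hu su] := ub; have A0 := radius_gt0; split.
  by move=> y; exact: (measurable_nonlinearity k (mu_ y)).
move=> s X uX; pose q := radius * (1 + `|s|) `^ (- 1).
apply: (@le_trans _ _ (\sum_(x <- X) q ^+ 2 * u x s ^+ 2)).
  apply: ler_sum => x _; apply: (le_trans (nonlinearity_le k_ge4 (in_ball_le1 x s ub))).
  rewrite (_ : u x s ^+ 4 = u x s ^+ 2 * u x s ^+ 2); last by ring.
  rewrite ler_wpM2r ?sqr_ge0 // -real_normK ?num_real //.
  by apply: lerXn2r; rewrite ?nnegrE ?mulr_ge0 ?powR_ge0 ?(ltW A0) //; exact: hu.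
rewrite -mulr_sumr; apply: (@le_trans _ _ (q ^+ 2 * 1)).
  rewrite ler_wpM2l ?sqr_ge0 //; apply: (le_trans (su s X uX)).
  by rewrite exprn_ile1 ?(ltW A0) ?radius_le1.
rewrite mulr1 /q exprMn ler_wpM2l ?sqr_ge0 //.
by rewrite /decay2 powR_inv1 ?(ltW (one_plus_gt0 s)) // exprVn.
Qed.

Lemma linear_part_bound x t : conv_summable (green^~ t) f x /\
  `|linear_part x t| <= C * data_size * (1 + `|t|) `^ (- 1).
Proof.
have [s h] := conv_bound x (green_decay^~ t) f_small; split => //.
by apply: (le_trans h); rewrite mulrAC.
Qed.

Lemma measurable_linear_part x : measurable_fun setT (linear_part x : RR -> RR).
Proof.
have e t : linear_part x t = conv_at (fun y _ => f y) x t 0 by rewrite /linear_part /conv_at subr0.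
rewrite (_ : (linear_part x : RR -> RR) = (fun w : RR * RR => conv_at (fun y _ => f y) x w.1 w.2) \o (pair^~ 0)).
  apply: measurableT_comp; last exact: pair2_measurable.
  apply: measurable_conv_at => //.
  by move=> t s; have [] := conv_bound x (green_decay^~ (t - s)) f_small.
by apply/funext => t; rewrite /= e.
Qed.

Lemma step_in_ball u : in_ball u -> in_ball (step u).
Proof.
move=> ub; have Hs := in_ball_source ub; have A0 := radius_gt0.
have C0 := ltW C_gt0.
have e1 : 8 * C * radius ^+ 2 = radius / 2.
  by rewrite expr2 mulrA (_ : 8 * C * radius = 2^-1) 1?mulrC //; have := radiusE; lra.
split.
- move=> y; apply: measurable_funD; first exact: measurable_linear_part.
  exact: (measurable_wave_source C0 green_sqr y Hs).
- move=> x t; apply: (le_trans (ler_normD _ _)).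
  have [_ h1] := linear_part_bound x t.
  have b1 : 0 < (1 : R) <= 2 by rewrite ltr01 ler1n.
  have h2 := wave_decay C0 green_sqr x t Hs b1 green_decay.
  rewrite data_sizeE in h1; rewrite e1 in h2.
  by apply: (le_trans (lerD h1 h2)); rewrite -mulrDl -splitr.
- move=> t; have h1 : sum_sqr_le (linear_part^~ t) (radius / 2).
    by rewrite -data_sizeE; exact: conv_sqr_le.
  have h2 := wave_sqr_le C0 green_sqr t Hs.
  have h3 : sum_sqr_le (wave (fun y s => F (u y s))^~ t) (radius / 2).
    have p0 : 0 <= C * radius ^+ 2 by rewrite mulr_ge0 ?sqr_ge0.
    have le1 : C * radius ^+ 2 <= radius / 2 by rewrite -e1; lra.
    move=> X uX; apply: (le_trans (h2 X uX)); apply: lerXn2r => //; rewrite nnegrE //.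
    exact: le_trans le1.
  have a2 : 0 < radius / 2 by rewrite divr_gt0.
  by have := sum_sqr_le_add a2 a2 h1 h3; rewrite -splitr.
Qed.

(** k is a Lipschitz constant of F on [-1, 1], and k / (growth - 4) = 1/2. *)
Definition growth : R := 4 + 2 * k.

Let growth_gt4 : 4 < growth.
Proof. by have h := k_ge4; rewrite /growth; lra. Qed.

Lemma step_contraction u v (D : R) : in_ball u -> in_ball v ->
  (forall x t, `|u x t - v x t| <= D * expR (growth * `|t|)) ->
  forall x t, `|step u x t - step v x t| <= D / 2 * expR (growth * `|t|).
Proof.
move=> ub vb h x t; rewrite /step opprD addrACA subrr add0r.
have C0 := ltW C_gt0; have su := in_ball_source ub; have sv := in_ball_source vb.
have h1 := @wave_difference_le R (fun y s => F (u y s)) (fun y s => F (v y s)) x t (k * D) growth growth_gt4.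
apply: le_trans (h1 _ _ _ _ _) _.
- by move=> s _; exact: (decaying_source_summable C0 green_sqr x t s su).
- by move=> s _; exact: (decaying_source_summable C0 green_sqr x t s sv).
- exact: (conv_at_integrable C0 green_sqr x t su).
- exact: (conv_at_integrable C0 green_sqr x t sv).
- move=> y s _; have := @nonlinearity_lipschitz R k k_ge4 1 _ _ ltr01 (in_ball_le1 y s ub) (in_ball_le1 y s vb).
  rewrite powR1 mulr1 => h2; apply: (le_trans h2); rewrite -mulrA ler_wpM2l //.
  by have h4 := k_ge4; lra.
rewrite (_ : k * D / (growth - 4) = D / 2) //.
by rewrite /growth; have h4 := k_ge4; field; rewrite gt_eqF //; lra.
Qed.

Lemma zero_in_ball : in_ball (fun _ _ => 0).
Proof.
have A0 := radius_gt0; split.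
- by move=> y; exact: measurable_cst.
- by move=> x t; rewrite normr0 mulr_ge0 ?powR_ge0 // ltW.
- by move=> t X _; rewrite big1 ?sqr_ge0 // => x _; rewrite expr0n.
Qed.

Definition picard n := iter n step (fun _ _ => 0).

Lemma picard_in_ball n : in_ball (picard n).
Proof. by elim: n => [|n IH]; [exact: zero_in_ball|exact: step_in_ball]. Qed.

Lemma picard_step n x t :
  `|picard n.+1 x t - picard n x t| <= expR (growth * `|t|) / 2 ^+ n.
Proof.
suff h : forall x t, `|picard n.+1 x t - picard n x t| <= 2 ^- n * expR (growth * `|t|).
  by rewrite mulrC; exact: h.
elim: n => [|n IH] {x t}x t.
  rewrite expr0 invr1 mul1r [picard 0 x t]/= subr0.
  apply: (le_trans (in_ball_le1 x t (picard_in_ball 1))).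
  by rewrite -expR0 ler_expR mulr_ge0 // ltW // (lt_trans _ growth_gt4).
have := step_contraction (picard_in_ball n.+1) (picard_in_ball n) IH x t.
by rewrite exprSr invfM mulrC.
Qed.

Lemma fixed_point_exists : exists2 u, in_ball u & forall x t, u x t = step u x t.
Proof.
have /choice[U hU] : forall z : lattice * R, exists l, forall n,
    `|picard n z.1 z.2 - l| <= 2 * expR (growth * `|z.2|) / 2 ^+ n.
  by move=> [x t]; apply: geometric_limit => n; exact: picard_step.
pose u x t := U (x, t).
have hu n x t : `|picard n x t - u x t| <= 2 * expR (growth * `|t|) / 2 ^+ n := hU (x, t) n.
have cu x t : picard n x t @[n --> \oo] --> u x t by exact: cvg_geometric_bound (fun n => hu n x t).
have ub : in_ball u.
  split.
  - move=> y; apply: (@measurable_fun_cvg _ _ _ _ (fun n => picard n y)).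
      by move=> n; have [m _ _] := picard_in_ball n; exact: m.
    by move=> t _; exact: cu.
  - move=> x t; apply: (@cvg_le_const _ (fun n => `|picard n x t|)).
      by apply: cvg_norm; exact: cu.
    by move=> n; have [_ h _] := picard_in_ball n; exact: h.
  - move=> t X uX; apply: (@cvg_le_const _ (fun n => \sum_(x <- X) picard n x t ^+ 2)).
      apply: cvg_sum_seq => x; under eq_fun do rewrite expr2; rewrite expr2.
      by apply: cvgM; exact: cu.
    by move=> n; have [_ _ h] := picard_in_ball n; exact: h.
exists u => // x t; apply: (@eq_of_geometric _ _ _ (2 * expR (growth * `|t|))) => n.
have h1 := hu n.+1 x t.
have h2 : `|step (picard n) x t - step u x t| <= 2 / 2 ^+ n / 2 * expR (growth * `|t|).
  apply: (step_contraction (picard_in_ball n) ub) => y s.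
  by have := hu n y s; rewrite mulrAC.
rewrite -[u x t](subrK (picard n.+1 x t)) -addrA (le_trans (ler_normD _ _)) //.
rewrite distrC; apply: (le_trans (lerD h1 h2)).
by rewrite exprS le_eqVlt; apply/orP; left; apply/eqP; field; rewrite expf_neq0.
Qed.

Lemma fixed_point_solution u : in_ball u -> (forall x t, u x t = step u x t) ->
  duhamel_solution k f u.
Proof.
move=> ub ue x t; have C0 := ltW C_gt0; have su := in_ball_source ub; split.
- by have [] := linear_part_bound x t.
- by move=> s _; exact: (decaying_source_summable C0 green_sqr x t s su).
- exact: (conv_at_integrable C0 green_sqr x t su).
- exact: ue.
Qed.

(** The contraction argument on the time interval |t| <= |t0|, with a Lipschitz
    constant L of F on an interval that contains the values of both
    solutions there. *)
Lemma bounded_solution_unique u v : duhamel_solution k f u -> duhamel_solution k f v ->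
  (forall T, exists M, forall x t, `|t| <= T -> `|u x t| <= M) ->
  (forall T, exists M, forall x t, `|t| <= T -> `|v x t| <= M) -> v = u.
Proof.
move=> us vs ubd vbd; apply/funext => x0; apply/funext => t0.
have [Mu hMu] := ubd `|t0|; have [Mv hMv] := vbd `|t0|.
pose M := 1 + `|Mu| + `|Mv|.
have M0 : 0 < M by rewrite /M -addrA ltr_pwDl // addr_ge0.
have uM x t : `|t| <= `|t0| -> `|u x t| <= M.
  move=> h; apply: (le_trans (hMu x t h)); apply: (le_trans (ler_norm _)).
  by rewrite /M addrAC lerDr addr_ge0.
have vM x t : `|t| <= `|t0| -> `|v x t| <= M.
  move=> h; apply: (le_trans (hMv x t h)); apply: (le_trans (ler_norm _)).
  by rewrite /M lerDr addr_ge0.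
pose L := k * M `^ (k - 1).
have L0 : 0 < L by rewrite mulr_gt0 ?powR_gt0 // (lt_le_trans _ k_ge4).
pose Lam := 4 + 2 * L.
have Lam4 : 4 < Lam by rewrite ltrDl mulr_gt0.
have key n : forall x t, `|t| <= `|t0| -> `|v x t - u x t| <= 2 * M / 2 ^+ n * expR (Lam * `|t|).
  elim: n => [|n IH] x t tt0.
    rewrite expr0 divr1; apply: (le_trans (ler_normB _ _)).
    apply: (@le_trans _ _ (2 * M * 1)).
      by have h1 := uM x t tt0; have h2 := vM x t tt0; lra.
    rewrite ler_wpM2l ?mulr_ge0 ?(ltW M0) // -expR0 ler_expR mulr_ge0 //.
    by rewrite ltW // (lt_trans _ Lam4).
  have [_ vs2 vi ve] := vs x t; have [_ us2 ui ue] := us x t.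
  rewrite ve ue opprD addrACA subrr add0r.
  have h1 := @wave_difference_le R (fun y s => F (v y s)) (fun y s => F (u y s)) x t (L * (2 * M / 2 ^+ n)) Lam Lam4.
  apply: le_trans (h1 vs2 us2 vi ui _) _.
    move=> y s ts; have st := le_trans (time_segment_norm ts) tt0.
    have := @nonlinearity_lipschitz R k k_ge4 M _ _ M0 (vM y s st) (uM y s st) => h2.
    by apply: (le_trans h2); rewrite -/L -[leRHS]mulrA ler_wpM2l ?(ltW L0) //; exact: IH.
  rewrite (_ : L * _ / (Lam - 4) = 2 * M / 2 ^+ n.+1) // exprS /Lam.
  by field; rewrite expf_neq0 //= addrC addKr mulf_neq0 // gt_eqF.
apply: (@eq_of_geometric _ _ _ (2 * M * expR (Lam * `|t0|))) => n.
by have := key n x0 t0 (lexx _); rewrite mulrAC.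
Qed.

End picard.

(** * Decay of the solution *)

Section solution_decay.
Variable R : realType.
Local Notation green := (@Defs.kernel R).

Lemma kernel_constant : exists C : R, [/\ 1 <= C, forall t, sum_sqr_le (green^~ t) C &
  forall x t, `|green x t| <= C * (1 + `|t|) `^ (- 1)].
Proof.
have [C0 C00 h0] := kernel_sum_sqr_le R.
have e12 : 0 < (2^-1 : R) < 3 / 2 by apply/andP; split; lra.
have [C1 C10 h1] := kernel_decay e12.
exists (C0 + C1 + 1); split.
- by rewrite lerDr addr_ge0 // ltW.
- move=> t X uX; apply: (le_trans (h0 t X uX)); apply: lerXn2r; rewrite ?nnegrE ?(ltW C00) //.
    by rewrite !addr_ge0 // ltW.
  by rewrite -addrA lerDl addr_ge0 // ltW.
- move=> x t; apply: (le_trans (h1 x t)).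
  rewrite (_ : 3 / 2 - 2^-1 = 1); last by lra.
  by rewrite ler_wpM2r ?powR_ge0 // addrAC lerDr addr_ge0 // ltW.
Qed.

(** The solution inherits the decay of the kernel, since its source is summable
    with a norm integrable in time. *)
Lemma fixed_point_decay (k C : R) (f : lattice -> R) (u : lattice -> R -> R) (e : R) :
  4 <= k -> 1 <= C -> (forall t, sum_sqr_le (green^~ t) C) ->
  sum_norm_le f (data_size C) -> in_ball C u ->
  (forall x t, u x t = step k f u x t) -> 0 < e < 3 / 2 ->
  exists2 B : R, 0 < B & forall x t, `|u x t| <= B * (1 + `|t|) `^ (- (3 / 2 - e)).
Proof.
move=> k4 C1 hsqr hf ub ue eI.
have [Ce Ce0 hCe] := kernel_decay eI.
have C0 : 0 < C by exact: lt_le_trans C1.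
have d0 := data_size_gt0 C1.
have r0 := radius_gt0 C1.
exists (Ce * data_size C + 8 * Ce * radius C ^+ 2).
  by apply: addr_gt0; [exact: mulr_gt0|apply: mulr_gt0; [exact: mulr_gt0|exact: exprn_gt0]].
move=> x t; rewrite ue /step mulrDl; apply: (le_trans (ler_normD _ _)); apply: lerD.
  have [_ h] := conv_bound x (hCe^~ t) hf.
  by apply: (le_trans h); rewrite mulrAC.
apply: (@wave_decay R C (ltW C0) hsqr) => //.
  exact: in_ball_source.
by move/andP: eI => [h1 h2]; apply/andP; split; lra_from h1 h2.
Qed.

Lemma exponent_range (p : \bar R) : (2%:E <= p)%E -> 0 <= 1 - 2 * fine (p^-1)%E.
Proof.
case: p => [r| |] //; last by rewrite invey /= mulr0 subr0.
rewrite lee_fin => r2; have r0 : 0 < r by apply: lt_le_trans r2.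
by rewrite inver gt_eqF //= subr_ge0 ler_pdivrMr // mul1r.
Qed.

End solution_decay.

Theorem theorem5p9 (R : realType) (k : R) (k_ge4 : 4 <= k) :
  exists2 delta : R, 0 < delta &
    forall f : lattice -> R, (l_norm 1 f < delta%:E)%E ->
    exists u : lattice -> R -> R,
    forall p : \bar R, (2%:E <= p)%E ->
      [/\ global_lp_solution k f p u,
          (forall v, global_lp_solution k f p v -> v = u) &
          forall eps : R, 0 < eps < 3 / 2 ->
          exists C : R, forall t : R,
            (l_norm p (fun x => u x t)
               <= (C * (1 + `|t|) `^ (- zeta eps p))%:E)%E].
Proof.
have [C [C1 hsqr hdec]] := kernel_constant R.
exists (data_size C); first exact: data_size_gt0.
move=> f /l_norm1_sum hf.
have [u ub ue] := fixed_point_exists k_ge4 C1 hsqr hdec hf.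
have us := fixed_point_solution k_ge4 C1 hsqr hdec hf ub ue.
have r0 := radius_gt0 C1.
have n0 (t : R) : 0 < 1 + `|t| by rewrite ltr_pwDl.
exists u => p p2; have th0 := exponent_range p2.
have decay (eps : R) : 0 < eps < 3 / 2 -> exists2 K : R, 0 <= K & forall t : R,
    (l_norm p (fun x => u x t) <= (K * (1 + `|t|) `^ (- zeta eps p))%:E)%E.
  move=> eI; have [B B0 hB] := fixed_point_decay k_ge4 C1 hsqr hf ub ue eI.
  exists (B `^ (1 - 2 * fine (p^-1)%E) * radius C `^ (2 * fine (p^-1)%E)).
    by rewrite mulr_ge0 // powR_ge0.
  move=> t; have q0 : 0 < B * (1 + `|t|) `^ (- (3 / 2 - eps)) by rewrite mulr_gt0 // powR_gt0.
  have [_ _ usq] := ub.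
  apply: le_trans (l_norm_interpolation p2 q0 r0 (hB^~ t) (usq t)) _.
  rewrite lee_fin powRM ?powR_ge0 ?(ltW B0) // -powRrM /zeta mulNr mulrAC.
  exact: lexx.
split.
- split=> // T; have e12 : 0 < (2^-1 : R) < 3 / 2 by apply/andP; split; lra.
  have [K K0 hK] := decay _ e12; exists K => t _; apply: (le_trans (hK t)).
  rewrite lee_fin ler_piMr // powRN invf_le1 ?powR_gt0 //.
  rewrite -[leLHS](powRr0 (1 + `|t|)); apply: ler_powR; first by rewrite lerDl.
  by rewrite mulr_ge0 //; lra.
- move=> v [vs vb]; apply: (bounded_solution_unique k_ge4 us vs).
    by move=> T; exists 1 => x t _; exact: in_ball_le1 ub.
  by move=> T; have [M hM] := vb T; exists M => x t /hM; exact: l_norm_pointwise.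
- by move=> eps /decay[K _ hK]; exists K.
Qed.
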